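(* Let $\mathcal{D}=(d_1,\ldots,d_m)$ with $\sum_i d_i=N$, and let $I,J\in \mathrm{OSP}(\mathcal{D})$ be such that $\ell(J)=\ell(I)-1$ and $J$ is obtained from $I$ by interchanging an element $a\in I_\alpha$ with an element $b\in I_\beta$, where $a>b$ and $\alpha<\beta$. Put $$N_I(a,b)=\big|\{d>a:\ \alpha<I(d)\le\beta\}\big|+\big|\{d<b:\ \alpha-1<I(d)\le \beta-1\}\big|.$$ Then the incidence coefficient of the Schubert cells $\Omega_I,\Omega_J\subseteq \mathrm{Fl}_{\mathcal{D}}(\mathbb{R}^N)$ is $$[\Omega_I,\Omega_J]=\begin{cases}0, & N_I(a,b)\text{ even},\\ \pm 2, & N_I(a,b)\text{ odd}.\end{cases}$$
   Context: Let $\mathcal{D}=(d_1,\ldots,d_m)$ be positive integers with sum $N$. $X=\mathrm{Fl}_{\mathcal{D}}(\mathbb{R}^N)$ is the manifold of flags $F_1\subset\cdots\subset F_m=\mathbb{R}^N$ with $\dim F_i=d_1+\cdots+d_i$. $\mathrm{OSP}(\mathcal{D})$ is the set of ordered set partitions $I=(I_1,\ldots,I_m)$ of $[N]=\{1,\ldots,N\}$ with $|I_j|=d_j$; $I$ is also regarded as a function $[N]\to[m]$ with $I(k)=j$ iff $k\in I_j$. Put $\ell(I)=|\{(c,d): c>d,\ I(c)<I(d)\}|$. With $E_k=\langle e_1,\ldots,e_k\rangle$, the Schubert cell is $\Omega_I=\{F_\bullet:\dim (F_i\cap E_k)=|\{l\in I_1\cup\cdots\cup I_i:\ l\le k\}|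 \text{ for all } i,k\}$; it is a cell of dimension $\ell(I)$. Incidence coefficients. Choose a coorientation (orientation of the normal bundle) of each cell. The Vassiliev complex of the stratification of $X$ by Schubert cells has as $k$-cochains the integer linear combinations of the cells of codimension $k$, with $d\Omega_I=\sum_J[\Omega_I,\Omega_J]\Omega_J$ (sum over cells with $\operatorname{codim}\Omega_J=\operatorname{codim}\Omega_I+1$); its cohomology is $H^*(X;\mathbb{Z})$. The coefficient $[\Omega_I,\Omega_J]$ is $0$ if $\Omega_J\not\subseteq\overline{\Omega_I}$. Otherwise let $D\subset X$ be a submanifold with $\dim D=\operatorname{codim}\Omega_J$, transverse to all cells of $\overline{\Omega_I}$ and meeting $\Omega_J$ in a single point $b_0$; $D\cap\Omega_I$ is a disjoint union of curves $L_i$ having $b_0$ in their closure. Along $L_i$ one has $TD=TL_i\oplus\nu(\Omega_I)$; orient $TL_i$ towards $b_0$, $\nu(\Omega_I)$ by the coorientation of $\Omega_I$, put $TL_i$ first, and extend the resulting orientation of $TD$ to $b_0$. The contribution of $L_i$ is $+1$ if this agrees with the orientation of $T_{b_0}D\cong\nu(\Omega_J)_{b_0}$ given by the coorientation of $\Omega_J$, and $-1$ otherwise; $[\Omega_I,\Omega_J]$ is the sum of these contributions. *)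

(* Defs.v *)
From HB Require Import structures.
From mathcomp Require Import all_boot all_order all_algebra all_fingroup.
From mathcomp Require Import all_classical all_reals all_analysis.

Set Implicit Arguments.
Unset Strict Implicit.
Unset Printing Implicit Defensive.

Import Order.TTheory GRing.Theory Num.Theory.
Import numFieldNormedType.Exports.

Local Open Scope classical_set_scope.
Local Open Scope ring_scope.

(* Indices are 0-based: [N] is 'I_N and [m] is 'I_m. Vectors of R^N are row
   vectors, on which matrices act on the right. *)

Section OrderedSetPartitions.
Variables (N m : nat) (d : 'I_m -> nat).
Implicit Types I : {ffun 'I_N -> 'I_m}.

(* An ordered set partition is represented by its function [N] -> [m]. *)
Definition is_osp I : Prop := forall j, #|[set k | I k == j]%SET| = d j.

Definition ell I : nat :=
  #|[set p : 'I_N * 'I_N | (p.2 < p.1)%N && (I p.1 < I p.2)%N]%SET|.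

Definition dim_flag : nat :=
  (\sum_(i < m) \sum_(j < m | (i < j)%N) d i * d j)%N.

Definition codim_cell I : nat := (dim_flag - ell I)%N.

(* The condition alpha - 1 < I(x) <= beta - 1 is written with both bounds
   shifted by one, to avoid truncated subtraction. *)
Definition NI I (a b : 'I_N) : nat :=
  (#|[set x : 'I_N | (a < x)%N && (I a < I x <= I b)%N]%SET| +
   #|[set x : 'I_N | (x < b)%N && (I a < (I x).+1 <= I b)%N]%SET|)%N.

End OrderedSetPartitions.

Section Flags.
Variables (R : realType) (N m : nat) (d : 'I_m -> nat).

Definition first_rows (g : 'M[R]_N) (k : nat) : {vspace 'rV[R]_N} :=
  <<[seq row l g | l : 'I_N <- enum 'I_N & (l < k)%N]>>%VS.

Record flag := Flag {
  flag_space :> 'I_m -> {vspace 'rV[R]_N} ;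
  _ : forall i j : 'I_m, (i <= j)%N -> (flag_space i <= flag_space j)%VS ;
  _ : forall i : 'I_m,
      \dim (flag_space i) = (\sum_(j < m | (j <= i)%N) d j)%N }.

HB.instance Definition _ := gen_eqMixin flag.
HB.instance Definition _ := gen_choiceMixin flag.

(* g |-> F for [adapted g F] is the quotient map GL_N(R) -> X = GL_N(R) / P
   that defines the topology and the smooth structure of X. *)
Definition adapted (g : 'M[R]_N) (F : flag) : Prop :=
  g \in unitmx /\ forall i, F i = first_rows g (\sum_(j < m | (j <= i)%N) d j)%N.

(* The quotient topology: the preimage of U in GL_N(R) is the trace on GL_N(R)
   of an open set of matrices. *)
Definition flag_open (U : set flag) : Prop :=
  exists2 V : set 'M[R]_N, open V &
    forall g F, adapted g F -> (U F <-> V g).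

Lemma flag_openT : flag_open setT.
Proof. by exists setT; [exact: openT|]. Qed.

Lemma flag_openI : setI_closed flag_open.
Proof.
move=> U1 U2 [V1 oV1 h1] [V2 oV2 h2]; exists (V1 `&` V2); first exact: openI.
move=> g F gF; have := h1 _ _ gF; have := h2 _ _ gF.
by move=> [? ?] [? ?]; split=> -[? ?]; split; auto.
Qed.

Lemma flag_open_bigU (T : Type) (f : T -> set flag) :
  (forall i, flag_open (f i)) -> flag_open (\bigcup_i f i).
Proof.
move=> fo.
have /choice[V hV] : forall i, exists V : set 'M[R]_N, open V /\
    forall g F, adapted g F -> (f i F <-> V g).
  by move=> i; have [V oV h] := fo i; exists V.
exists (\bigcup_i V i); first by apply: bigcup_open => i _; have [] := hV i.
move=> g F gF; split=> -[i _ h]; exists i => //.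
  by apply/(proj2 (hV i) g F gF).
by apply/(proj2 (hV i) g F gF).
Qed.

HB.instance Definition _ :=
  isOpenTopological.Build flag flag_openT flag_openI flag_open_bigU.

Definition cell (I : {ffun 'I_N -> 'I_m}) : set flag :=
  [set F | forall (i : 'I_m) (k : nat), (k <= N)%N ->
     \dim (F i :&: first_rows 1%:M k)%VS =
       #|[set l : 'I_N | (I l <= i)%N && (l < k)%N]%SET|].

End Flags.

Section Smooth.
Variables (R : realType) (V W : normedModType R).

Fixpoint Cn (n : nat) (U : set V) (f : V -> W) : Prop :=
  match n with
  | 0 => forall x, U x -> {for x, continuous f}
  | n'.+1 => (forall x, U x -> differentiable f x) /\
             (forall v, Cn n' U (fun x => 'd f x v))
  end.

Definition smooth (U : set V) (f : V -> W) : Prop := forall n, Cn n U f.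

End Smooth.

Section TangentVectors.
Variables (R : realType) (N m : nat) (d : 'I_m -> nat).
Local Notation X := (flag R N d).

(* The tangent space of X at F is T_F X = End(R^N) / stab F: if phi is a map
   into X lifted by a GL_N(R)-valued map g, then near x one has
   phi y = phi x * (g(x)^-1 g(y)), so the derivative of phi at x along v is the
   class modulo stab (phi x) of the matrix [lift_deriv g x v]. Tangent vectors
   are always handled below through matrices representing them, and tangent
   subspaces through their full preimages, which contain stab F. *)
Definition stab (F : X) : set 'M[R]_N :=
  [set A | forall i v, v \in F i -> v *m A \in F i].

Definition lift_deriv (V : normedModType R) (g : V -> 'M[R]_N) (x v : V) :
  'M[R]_N := invmx (g x) *m 'd g x v.

Definition immersion (V : normedModType R) (U : set V) (phi : V -> X)
    (g : V -> 'M[R]_N) : Prop :=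
  [/\ open U,
      forall x, U x -> adapted (g x) (phi x),
      smooth U g &
      forall x v, U x -> stab (phi x) (lift_deriv g x v) -> v = 0].

(* With W := the image of U, the last clause says that phi is a homeomorphism
   from U onto an open subset of D. *)
Definition chart (q : nat) (D : set X) (U : set 'rV[R]_q) (phi : 'rV[R]_q -> X)
    (g : 'rV[R]_q -> 'M[R]_N) : Prop :=
  [/\ immersion U phi g,
      set_inj U phi &
      forall U' : set 'rV[R]_q, open U' -> U' `<=` U ->
        exists2 W : set X, open W & phi @` U' = W `&` D].

Definition submanifold (q : nat) (D : set X) : Prop :=
  forall F, D F -> exists U phi g x, [/\ @chart q D U phi g, U x & phi x = F].

Definition velocity (gamma : R -> X) (t : R) (A : 'M[R]_N) : Prop :=
  exists g : R -> 'M[R]_N,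
    [/\ differentiable g t,
        \forall s \near t, adapted (g s) (gamma s) &
        A = lift_deriv g t 1].

Definition tangent (S : set X) (F : X) : set 'M[R]_N :=
  [set A | exists gamma : R -> X,
     [/\ gamma 0 = F, \forall s \near (0 : R), S (gamma s) &
         velocity gamma 0 A]].

Definition transverse (S S' : set X) : Prop :=
  forall F, S F -> S' F ->
    forall A, exists B C, [/\ tangent S F B, tangent S' F C & A = B + C].

End TangentVectors.

Section Incidence.
Variables (R : realType) (N m : nat) (d : 'I_m -> nat).
Local Notation X := (flag R N d).

(* v represents a basis of the quotient of 'M_N by the subspace T. *)
Definition quot_basis (c : nat) (T : set 'M[R]_N) (v : 'I_c -> 'M[R]_N) : Prop :=
  forall A, exists! a : 'rV[R]_c, T (A - \sum_i a 0 i *: v i).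

(* An orientation of the quotient by T, as a sign on its bases. *)
Definition orientation (c : nat) (T : set 'M[R]_N)
    (o : ('I_c -> 'M[R]_N) -> int) : Prop :=
  (forall v, quot_basis T v -> o v = 1 \/ o v = -1) /\
  (forall v w (B : 'M[R]_c), quot_basis T v -> quot_basis T w ->
     (forall i, T (w i - \sum_j B i j *: v j)) -> o w = sgz (\det B) * o v).

(* A coorientation of a cell S of codimension c: an orientation of each normal
   space T_F X / T_F S that depends continuously on F in S. A fixed tuple v of
   matrices gives continuous sections of T X, hence of the normal bundle, so
   continuity can be tested on such tuples. *)
Definition coorientation (c : nat) (S : set X)
    (o : X -> ('I_c -> 'M[R]_N) -> int) : Prop :=
  (forall F, S F -> orientation (tangent S F) (o F)) /\
  (forall F v, S F -> quot_basis (tangent S F) v ->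
     \forall G \near F, S G -> quot_basis (tangent S G) v -> o G v = o F v).

(* gamma, on ]0, 1[, parametrizes a curve having b0 in its closure, the end at
   b0 being t -> 0+ and no other: orienting the curve towards b0 is orienting
   it by decreasing t. *)
Definition curve_from (b0 : X) (gamma : R -> X) : Prop :=
  [/\ exists h, immersion (`]0, 1[ : set R) gamma h,
      set_inj (`]0, 1[ : set R) gamma,
      gamma t @[t --> 0^'+] --> b0 &
      ~ closure (gamma @` (`[2^-1, 1[ : set R)) b0].

(* D is a transversal to the cell of J at b0 (the cell of I having codimension k
   and that of J codimension k + 1), and the curves L_i = gamma i (]0, 1[) are
   the components of its intersection with the cell of I. *)
Definition slice (k : nat) (I J : {ffun 'I_N -> 'I_m}) (D : set X) (b0 : X)
    (r : nat) (gamma : 'I_r -> R -> X) : Prop :=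
  [/\ submanifold k.+1 D,
      forall K : {ffun 'I_N -> 'I_m}, is_osp d K ->
        cell K `<=` closure (cell I : set X) -> transverse D (cell K),
      D `&` cell J = [set b0],
      forall i, curve_from b0 (gamma i) &
      trivIset setT (fun i => gamma i @` `]0, 1[) /\
      D `&` cell I = \bigcup_i (gamma i @` `]0, 1[)].

(* The contribution e of the curve gamma. In a chart phi of D at b0 = phi x0,
   the coordinates trivialize T D and so carry orientations of T D along gamma
   over to T_b0 D. At the point phi x = gamma t, the rows of B are the
   coordinates of a basis of T D whose first vector is the velocity of gamma
   reversed, that is towards b0. This basis followed by the sign of oI on the
   other vectors gives the orientation sgz (\det B) * oI of T D relative to the
   coordinates; that of T_b0 D is the sign of oJ on the coordinate basis. *)
Definition contribution (k : nat)
    (oI : X -> ('I_k -> 'M[R]_N) -> int) (oJ : X -> ('I_k.+1 -> 'M[R]_N) -> int)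
    (D : set X) (b0 : X) (gamma : R -> X) (e : int) : Prop :=
  exists U phi g x0,
    [/\ @chart R N m d k.+1 D U phi g, U x0, phi x0 = b0 &
      \forall t \near (0 : R)^'+,
        exists x (B : 'M[R]_k.+1),
          [/\ U x, phi x = gamma t, B \in unitmx,
              velocity gamma t (- lift_deriv g x (row ord0 B)) &
              sgz (\det B) *
                oI (gamma t) (fun i => lift_deriv g x (row (lift ord0 i) B)) =
              e * oJ b0 (fun i => lift_deriv g x0 (row i 1%:M))]].

Definition incidence_sum (k : nat) (I J : {ffun 'I_N -> 'I_m})
    (oI : X -> ('I_k -> 'M[R]_N) -> int) (oJ : X -> ('I_k.+1 -> 'M[R]_N) -> int)
    (n : int) : Prop :=
  exists D b0 r (gamma : 'I_r -> R -> X) (e : 'I_r -> int),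
    [/\ slice k I J D b0 gamma,
        forall i, contribution oI oJ D b0 (gamma i) (e i) &
        n = \sum_i e i].

(* [Omega_I, Omega_J] = n: when the cell of J lies in the closure of that of I,
   n is the value, independent of the choice of D, of the sum of contributions. *)
Definition incidence (k : nat) (I J : {ffun 'I_N -> 'I_m})
    (oI : X -> ('I_k -> 'M[R]_N) -> int) (oJ : X -> ('I_k.+1 -> 'M[R]_N) -> int)
    (n : int) : Prop :=
  (~ cell J `<=` closure (cell I : set X) -> n = 0) /\
  (cell J `<=` closure (cell I : set X) ->
     forall n', incidence_sum I J oI oJ n' <-> n' = n).

End Incidence.

(* Main.v *)
(* Near a flag of the cell of J, flags are given by matrices u in the unipotent
   group opposite to the parabolic of J. In this chart the cell of I consists of the
   u = (1 + t E_ba) v with t <> 0 and v lower unitriangular, and the cell of J is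
   t = 0. Hence a transversal D to the cell of J meets the cell of I near b0 in two
   arcs, t > 0 and t < 0. Measured in the chart, the coorientation of the cell of I
   has a constant sign on each side, and the contributions of the arcs are these two
   signs with opposite prefactors, as the arcs approach b0 from opposite sides. The
   reflection e_a |-> -e_a exchanges the sides. Since the coorientation has a
   constant sign when measured in the chart of I, which contains the whole cell, the
   two signs differ by the product of the signs with which the reflection acts on the
   normal coordinates of both charts, which are indexed by the ascents l < c,
   I(l) < I(c), and by those of J other than (b, a). This product is (-1)^{N_I(a,b)},
   so the two contributions cancel when N_I(a,b) is even and agree when it is odd. *)

From HB Require Import structures.
Require Import Defs.
From mathcomp Require Import all_boot all_order all_algebra all_fingroup.
From mathcomp Require Import all_classical all_reals all_analysis.
From mathcomp Require Import ring lra zify.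

Set Implicit Arguments.
Unset Strict Implicit.
Unset Printing Implicit Defensive.

Import Order.TTheory GRing.Theory Num.Theory.
Import numFieldNormedType.Exports.

Local Open Scope classical_set_scope.
Local Open Scope ring_scope.

(** * Differentiation and limits of matrices *)

(** The definition of [incidence] quantifies over all slices, so every slice must give the announced
    sum, and some slice with contributions must exist. For the first, D, its charts and its curves
    are arbitrary. Near b0, transversality makes D a graph over [Psi], the vector of local equations
    of the cell of J; in these coordinates the cell of I is the first axis without its origin. That
    exactly two curves occur follows from this: two curves on one side would share points, and each
    side is reached because the points of D on the axis close to b0 lie on initial parts of the
    curves. The second uses upper triangular coordinates.

    Coorientations are given pointwise, with continuity tested on fixed tuples of matrices. They are
    therefore measured by a sign [cosign] against an explicit conormal form, and this sign is
    constant along paths by the intermediate value theorem. The condition on the lengths enters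
    through [exch_cover]: no index strictly between b and a has its block between those of a and b.
    This determines the shape of the cell of I in the chart of J and the parity count alike. *)

Section DifferentialMatrix.
Variables (R : realType) (V : normedModType R).

Lemma is_diff_bigsum (W : normedModType R) (T : Type) (r : seq T)
    (f df : T -> V -> W) (x : V) :
  (forall i, is_diff x (f i) (df i)) ->
  is_diff x (fun y => \sum_(i <- r) f i y) (fun v => \sum_(i <- r) df i v).
Proof.
move=> h; elim: r => [|i r IH].
  have E (F : T -> V -> W) : (fun y => \sum_(j <- [::]) F j y) = cst 0.
    by apply/funext => y; rewrite big_nil.
  by rewrite !E; exact: is_diff_cst.
have E (F : T -> V -> W) : (fun y => \sum_(j <- i :: r) F j y) =
    F i + (fun y => \sum_(j <- r) F j y) by apply/funext => y; rewrite big_cons.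
by rewrite !E; exact: is_diffD.
Qed.

Lemma is_diff_Zl (W : normedModType R) (f df : V -> R) (w : W) (x : V) :
  is_diff x f df -> is_diff x (fun y => f y *: w) (fun v => df v *: w).
Proof.
move=> [dfx dfE]; apply: DiffDef; first exact: differentiableZl.
by rewrite diffZl // dfE.
Qed.

Lemma is_diff_mx m n (f df : V -> 'M[R]_(m, n)) (x : V) :
  (forall i j, is_diff x (fun y => f y i j) (fun v => df v i j)) ->
  is_diff x f df.
Proof.
move=> h.
rewrite (_ : f = fun y => \sum_i \sum_j f y i j *: delta_mx i j); last first.
  by apply/funext => y; rewrite -matrix_sum_delta.
rewrite (_ : df = fun y => \sum_i \sum_j df y i j *: delta_mx i j); last first.
  by apply/funext => y; rewrite -matrix_sum_delta.
apply: is_diff_bigsum => i; apply: is_diff_bigsum => j; exact: is_diff_Zl.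
Qed.

Lemma is_diff_coord m n (f df : V -> 'M[R]_(m, n)) (x : V) i j :
  is_diff x f df -> is_diff x (fun y => f y i j) (fun v => df v i j).
Proof.
move=> fx.
have dc : differentiable (fun M : 'M[R]_(m, n) => M i j) (f x).
  exact: differentiable_coord.
pose c : 'M[R]_(m, n) -> R^o := fun M => M i j.
have lc : linear c by move=> k A B; rewrite /c !mxE.
pose C := GRing.isLinear.Build _ _ _ _ c lc.
pose cl : {linear 'M[R]_(m, n) -> R^o} := HB.pack c C.
have cc : continuous cl by exact: coord_continuous.
have dl : is_diff (f x) cl cl.
  by apply: DiffDef; [exact: linear_differentiable | exact: diff_lin].
exact: (is_diff_comp fx dl).
Qed.

Lemma is_diff_mulmx m n p (f df : V -> 'M[R]_(m, n)) (g dg : V -> 'M[R]_(n, p))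
    (x : V) : is_diff x f df -> is_diff x g dg ->
  is_diff x (fun y => f y *m g y) (fun v => df v *m g x + f x *m dg v).
Proof.
move=> fx gx; apply: is_diff_mx => i j.
have -> : (fun v => (df v *m g x + f x *m dg v) i j) =
    (fun v => \sum_k (f x i k * dg v k j + g x k j * df v i k)).
  apply/funext => v; rewrite !mxE -big_split /=; apply: eq_bigr => k _.
  by rewrite addrC [df v i k * _]mulrC.
under eq_fun do rewrite mxE.
apply: (@is_diff_bigsum R^o) => k.
exact: (is_diffM (is_diff_coord i k fx) (is_diff_coord k j gx)).
Qed.

Lemma differentiable_mx m n (f : V -> 'M[R]_(m, n)) (x : V) :
  (forall i j, differentiable (fun y => f y i j) x) -> differentiable f x.
Proof.
move=> h; pose df v : 'M[R]_(m, n) := \matrix_(i, j) 'd (fun y => f y i j) x v.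
have [] // : is_diff x f df.
apply: is_diff_mx => i j; have -> : (fun v => df v i j) = 'd (fun y => f y i j) x.
  by apply/funext => v; rewrite mxE.
exact: differentiableP.
Qed.

Lemma differentiable_coordf m n (f : V -> 'M[R]_(m, n)) (x : V) i j :
  differentiable f x -> differentiable (fun y => f y i j) x.
Proof. by move=> /differentiableP fx; have [] := is_diff_coord i j fx. Qed.

Lemma differentiable_bigprod (T : Type) (r : seq T) (f : T -> V -> R) (x : V) :
  (forall i, differentiable (f i) x) ->
  differentiable (fun y => \prod_(i <- r) f i y) x.
Proof.
move=> h; elim: r => [|i r IH].
  under eq_fun do rewrite big_nil.
  exact: differentiable_cst.
under eq_fun do rewrite big_cons.
by apply: differentiableM.
Qed.

Lemma differentiable_bigsum (T : Type) (r : seq T) (f : T -> V -> R) (x : V) :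
  (forall i, differentiable (f i) x) ->
  differentiable (fun y => \sum_(i <- r) f i y) x.
Proof.
move=> h; have [] // := @is_diff_bigsum R^o T r f (fun i => 'd (f i) x) x _.
Qed.

Lemma differentiable_det n (f : V -> 'M[R]_n) (x : V) :
  differentiable f x -> differentiable (fun y => \det (f y)) x.
Proof.
move=> h; rewrite /determinant; apply: differentiable_bigsum => s.
apply: differentiableM; first exact: differentiable_cst.
by apply: differentiable_bigprod => i; exact: differentiable_coordf.
Qed.

Lemma differentiable_adj n (f : V -> 'M[R]_n) (x : V) :
  differentiable f x -> differentiable (fun y => \adj (f y)) x.
Proof.
move=> h; apply: differentiable_mx => i j.
under eq_fun do rewrite mxE.
apply: differentiableM; first exact: differentiable_cst.
apply: differentiable_det; apply: differentiable_mx => i' j'.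
under eq_fun do rewrite !mxE; exact: differentiable_coordf.
Qed.

Lemma is_diff_near_eq (W : normedModType R) (f g df dg : V -> W) (x : V) :
  is_diff x f df -> is_diff x g dg -> {near x, f =1 g} -> df = dg.
Proof.
move=> fx gx fg; apply/funext => v.
have [dfx <-] := fx; have [dgx <-] := gx.
have [->|v0] := eqVneq v 0; first by rewrite !linear0.
by rewrite -!deriveE //; apply: near_eq_derive.
Qed.

End DifferentialMatrix.

Section MatrixLimits.
Variable R : realType.

Lemma mx_coord_le m n (A : 'M[R]_(m, n)) i j : `|A i j| <= `|A|.
Proof.
rewrite [leRHS]/Num.Def.normr/= mx_normrE.
exact: (le_bigmax _ (fun ij : 'I_m * 'I_n => `|A ij.1 ij.2|) (i, j)).
Qed.

Lemma mx_norm_le m n (A : 'M[R]_(m, n)) c :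
  0 <= c -> (forall i j, `|A i j| <= c) -> `|A| <= c.
Proof.
move=> c0 h; rewrite [leLHS]/Num.Def.normr/= mx_normrE.
by apply: bigmax_le => // i _; exact: h.
Qed.

Lemma norm_mulmx_le m n p (A : 'M[R]_(m, n)) (B : 'M[R]_(n, p)) :
  `|A *m B| <= n%:R * (`|A| * `|B|).
Proof.
apply: mx_norm_le => [|i j]; first by rewrite !mulr_ge0.
rewrite mxE (le_trans (ler_norm_sum _ _ _))//.
have -> : n%:R * (`|A| * `|B|) = \sum_(k < n) `|A| * `|B|.
  by rewrite sumr_const card_ord mulr_natl.
apply: ler_sum => k _; by rewrite normrM ler_pM ?mx_coord_le.
Qed.

Section Filter.
Variables (T : Type) (F : set_system T).
Context {FF : Filter F}.

Lemma cvg_mx m n (f : T -> 'M[R]_(m, n)) (A : 'M[R]_(m, n)) :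
  (forall i j, f x i j @[x --> F] --> A i j) -> f x @[x --> F] --> A.
Proof.
move=> h; apply/cvgrPdist_le => e e0.
have : \forall x \near F, forall ij : 'I_m * 'I_n, `|A ij.1 ij.2 - f x ij.1 ij.2| <= e.
  by apply: filter_forall => -[i j]; move/cvgrPdist_le : (h i j); exact.
apply: filterS => x hx; apply: mx_norm_le (ltW e0) _ => i j.
by rewrite !mxE; exact: (hx (i, j)).
Qed.

Lemma cvg_coord m n (f : T -> 'M[R]_(m, n)) (A : 'M[R]_(m, n)) i j :
  f x @[x --> F] --> A -> f x i j @[x --> F] --> A i j.
Proof.
move=> /cvgrPdist_le h; apply/cvgrPdist_le => e /h; apply: filterS => x.
by apply: le_trans; have := mx_coord_le (A - f x) i j; rewrite !mxE.
Qed.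

Lemma cvg_mxD m n (f g : T -> 'M[R]_(m, n)) (A B : 'M[R]_(m, n)) :
  f x @[x --> F] --> A -> g x @[x --> F] --> B ->
  f x + g x @[x --> F] --> A + B.
Proof. by move=> fA gB; exact: (@cvgD _ _ _ _ _ f g). Qed.

Lemma cvg_mxB m n (f g : T -> 'M[R]_(m, n)) (A B : 'M[R]_(m, n)) :
  f x @[x --> F] --> A -> g x @[x --> F] --> B ->
  f x - g x @[x --> F] --> A - B.
Proof. by move=> fA gB; exact: (@cvgB _ _ _ _ _ f g). Qed.

Lemma cvg_bigsum (I : Type) (r : seq I) (f : I -> T -> R) (a : I -> R) :
  (forall i, f i x @[x --> F] --> a i) ->
  \sum_(i <- r) f i x @[x --> F] --> \sum_(i <- r) a i.
Proof.
move=> h; elim: r => [|i r IH].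
  by rewrite big_nil; under eq_fun do rewrite big_nil; exact: cvg_cst.
rewrite big_cons; under eq_fun do rewrite big_cons; exact: cvgD.
Qed.

Lemma cvg_bigprod (I : Type) (r : seq I) (f : I -> T -> R) (a : I -> R) :
  (forall i, f i x @[x --> F] --> a i) ->
  \prod_(i <- r) f i x @[x --> F] --> \prod_(i <- r) a i.
Proof.
move=> h; elim: r => [|i r IH].
  by rewrite big_nil; under eq_fun do rewrite big_nil; exact: cvg_cst.
rewrite big_cons; under eq_fun do rewrite big_cons; exact: cvgM.
Qed.

Lemma cvg_mulmx m n p (f : T -> 'M[R]_(m, n)) (g : T -> 'M[R]_(n, p))
    (A : 'M[R]_(m, n)) (B : 'M[R]_(n, p)) :
  f x @[x --> F] --> A -> g x @[x --> F] --> B ->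
  f x *m g x @[x --> F] --> A *m B.
Proof.
move=> fA gB; apply: cvg_mx => i j; rewrite mxE; under eq_fun do rewrite mxE.
by apply: cvg_bigsum => k; apply: cvgM; exact: cvg_coord.
Qed.

Lemma cvg_det n (f : T -> 'M[R]_n) (A : 'M[R]_n) :
  f x @[x --> F] --> A -> \det (f x) @[x --> F] --> \det A.
Proof.
move=> fA; apply: cvg_bigsum => s; apply: cvgM; first exact: cvg_cst.
by apply: cvg_bigprod => i; exact: cvg_coord.
Qed.

Lemma cvg_adj n (f : T -> 'M[R]_n) (A : 'M[R]_n) :
  f x @[x --> F] --> A -> \adj (f x) @[x --> F] --> \adj A.
Proof.
move=> fA; apply: cvg_mx => i j; rewrite mxE; under eq_fun do rewrite mxE.
apply: cvgM; first exact: cvg_cst.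
apply: cvg_det; apply: cvg_mx => i' j'.
rewrite !mxE; under eq_fun do rewrite !mxE; exact: cvg_coord.
Qed.

Lemma near_unitmx n (f : T -> 'M[R]_n) (A : 'M[R]_n) :
  f x @[x --> F] --> A -> A \in unitmx -> \forall x \near F, f x \in unitmx.
Proof.
move=> /cvg_det fA; rewrite unitmxE unitfE => A0.
by apply: filterS (cvgr_neq0 _ fA A0) => x fx0; rewrite unitmxE unitfE.
Qed.

Lemma cvg_invmx n (f : T -> 'M[R]_n) (A : 'M[R]_n) :
  f x @[x --> F] --> A -> A \in unitmx -> invmx (f x) @[x --> F] --> invmx A.
Proof.
move=> fA uA.
have H : (\det (f x))^-1 *: \adj (f x) @[x --> F] --> invmx A.
  rewrite /invmx uA; apply: cvgZ; last exact: cvg_adj.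
  by apply: cvgV; [rewrite -unitfE -unitmxE | exact: cvg_det].
apply: cvg_trans H; apply: near_eq_cvg.
by apply: filterS (near_unitmx fA uA) => x ux; rewrite /invmx ux.
Qed.

End Filter.

(** The inverse function theorem with explicit balls. With [P] the inverse of [M x0], the map [g]
    has small derivative near [x0], hence is 2^-1-Lipschitz there by the mean value theorem, and f x
    = y says that x is fixed by x |-> g x + y *m P. No iteration is used: a minimizer of the
    displacement on a compact ball is sent to a point displaced at most half as much, so the
    displacement is 0. *)
Lemma local_diffeo n (f : 'rV[R]_n -> 'rV[R]_n) (x0 : 'rV[R]_n)
    (M : 'rV[R]_n -> 'M[R]_n) :
  (\forall x \near x0, is_diff x f (fun v => v *m M x)) ->
  M x @[x --> x0] --> M x0 -> M x0 \in unitmx ->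
  exists2 r, 0 < r &
    (forall x x', `|x - x0| < r -> `|x' - x0| < r -> f x = f x' -> x = x') /\
    (forall e, 0 < e -> exists2 dlt, 0 < dlt & forall y, `|y - f x0| < dlt ->
       exists2 x, `|x - x0| < e & f x = y).
Proof.
move=> df cM uM; set P := invmx (M x0).
pose g x : 'rV[R]_n := x - f x *m P.
have dg : \forall x \near x0, is_diff x g (fun v => v *m (1%:M - M x *m P)).
  apply: filterS df => x dfx.
  have -> : (fun v : 'rV[R]_n => v *m (1%:M - M x *m P)) =
      id - (fun v : 'rV[R]_n => v *m M x *m P + f x *m (0 : 'M[R]_n)).
    by apply/funext => v; rewrite !fctE mulmx0 addr0 -mulmxA mulmxBr mulmx1.
  apply: is_diffB; apply: is_diff_mulmx; exact: is_diff_cst.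
(* [norm_mulmx_le] costs a factor n, so this bound on the derivative gives the Lipschitz constant
   1/2; the added 1 covers n = 0. *)
pose c : R := (2 * (n%:R + 1))^-1.
have c0 : 0 < c by rewrite invr_gt0 mulr_gt0 // ltr_pwDr.
have : \forall x \near x0, `|1%:M - M x *m P| <= c.
  have : 1%:M - M x *m P @[x --> x0] --> (1%:M - M x0 *m P : 'M[R]_n).
    apply: (cvg_mxB (F := nbhs x0)); first exact: cvg_cst.
    by apply: (cvg_mulmx (F := nbhs x0)) => //; exact: cvg_cst.
  rewrite mulmxV // subrr => /cvgrPdist_le /(_ _ c0).
  by apply: filterS => x; rewrite sub0r normrN.
move=> cK; have [r /= r0 hr] : exists2 r, 0 < r & forall x, `|x - x0| < r ->
    is_diff x g (fun v => v *m (1%:M - M x *m P)) /\ `|1%:M - M x *m P| <= c.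
  have : \forall x \near x0, is_diff x g (fun v => v *m (1%:M - M x *m P)) /\
      `|1%:M - M x *m P| <= c by exact: filterI.
  move=> /nbhs_ballP[r /= r0 hr]; exists r => // x xr; apply: hr.
  by rewrite -ball_normE /= distrC.
have lip x x' : `|x - x0| < r -> `|x' - x0| < r -> `|g x - g x'| <= 2^-1 * `|x - x'|.
  move=> xr x'r; apply: mx_norm_le => [|i j]; first by rewrite mulr_ge0.
  pose p (t : R) : 'rV[R]_n := x' + t *: (x - x').
  have pr t : 0 <= t <= 1 -> `|p t - x0| < r.
    move=> /andP[t0 t1].
    have -> : p t - x0 = t *: (x - x0) + (1 - t) *: (x' - x0).
      apply/matrixP => i' j'; rewrite !mxE; lra.
    rewrite (le_lt_trans (ler_normD _ _)) // !normrZ ger0_norm // ger0_norm ?subr_ge0 //.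
    have [->|tn0] := eqVneq t 0; first by rewrite mul0r subr0 mul1r add0r.
    have tp : 0 < t by rewrite lt_def tn0.
    rewrite (@lt_le_trans _ _ (t * r + (1 - t) * r)) //; last by lra.
    by rewrite ltr_leD ?ltr_pM2l // ler_wpM2l ?subr_ge0 // ltW.
  have dp t : is_diff t p (fun s => s *: (x - x')).
    have -> : p = cst x' + (fun s => s *: (x - x')) by [].
    rewrite -[X in is_diff _ _ X]add0r; apply: is_diffD.
  have dgp (t : R) : 0 <= t <= 1 ->
      is_derive t 1 (fun t => g (p t) i j) (((x - x') *m (1%:M - M (p t) *m P)) i j).
    move=> /pr /hr[dgt _].
    have [dd dE] := is_diff_coord i j (is_diff_comp (dp t) dgt).
    apply: DeriveDef; first exact: diff_derivable.
    by rewrite deriveE // dE /= scale1r.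
  have [||t tI] := @MVT_segment R (fun t => g (p t) i j)
     (fun t => ((x - x') *m (1%:M - M (p t) *m P)) i j) 0 1 ler01.
  - by move=> t; rewrite in_itv /= => /andP[t0 t1]; apply: dgp; rewrite !ltW.
  - apply: derivable_within_continuous => t tI.
    by move: tI; rewrite in_itv /= => /dgp[].
  have [p0 p1] : p 0 = x' /\ p 1 = x by rewrite /p scale0r addr0 scale1r addrC subrK.
  rewrite subr0 mulr1 p0 p1 => gE; have -> : (g x - g x') i j = g x i j - g x' i j by rewrite !mxE.
  rewrite gE.
  have tI' : 0 <= t <= 1 by move: tI; rewrite in_itv.
  have [_ hM] := hr _ (pr _ tI').
  rewrite (le_trans (mx_coord_le _ _ _)) // (le_trans (norm_mulmx_le _ _)) //.
  rewrite mulrCA mulrC ler_wpM2r //.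
  apply: le_trans (_ : n%:R * c <= _); first by rewrite ler_wpM2l.
  by rewrite /c invfM mulrCA ler_piMr // ler_pdivrMr ?ltr_pwDr // mul1r lerDl.
have fg x y : (g x + y *m P == x) = (f x == y).
  rewrite /g -subr_eq0 addrAC [x - _]addrC addrK addrC -mulmxBl.
  apply/eqP/eqP => [/(congr1 (mulmx^~ (M x0)))|->]; last by rewrite subrr mul0mx.
  by rewrite mul0mx -mulmxA mulVmx // mulmx1 => /eqP; rewrite subr_eq0 => /eqP.
exists r => //; split.
  move=> x x' xr x'r ff'; apply/eqP; rewrite -subr_eq0 -normr_le0.
  have := lip _ _ xr x'r.
  have -> : g x - g x' = x - x' by rewrite /g ff' opprB addrA subrK.
  lra.
move=> e e0; pose rho : R := Num.min e r / 2.
have rho0 : 0 < rho by rewrite divr_gt0 // lt_min e0.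
have rhoe : rho < e by rewrite ltr_pdivrMr // gt_min; apply/orP; left; lra.
have rhor : rho < r by rewrite ltr_pdivrMr // gt_min; apply/orP; right; lra.
pose C := n%:R * `|P| + 1.
have C0 : 0 < C by rewrite ltr_wpDl // mulr_ge0.
(* Half of the radius [rho] is consumed by the Lipschitz bound for [g], the other half is left to
   the term (y - f x0) *m P. *)
exists (rho / 2 / C); first by apply: divr_gt0 => //; apply: divr_gt0.
move=> y yd; pose T x := g x + y *m P.
pose K := [set x | `|x - x0| <= rho].
have TK x : K x -> K (T x).
  rewrite /K /= => xK; have -> : T x - x0 = (g x - g x0) + (y - f x0) *m P.
    by rewrite /T /g mulmxBl opprB; apply/matrixP => i j; rewrite !mxE; lra.
  rewrite (le_trans (ler_normD _ _)) // [leRHS](splitr rho) lerD //.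
    rewrite (le_trans (lip _ _ _ _)) ?subrr ?normr0 //; first exact: le_lt_trans rhor.
    by rewrite mulrC ler_pM2r.
  rewrite (le_trans (norm_mulmx_le _ _)) // mulrCA.
  move: yd; rewrite ltr_pdivlMr // => /ltW; apply: le_trans.
  by rewrite ler_wpM2l // /C; lra.
have [|||x /[!inE] xK xmin] := @EVT_min_rV R n (fun x => `|T x - x|) K.
- by exists x0; rewrite /K /= subrr normr0 ltW.
- apply: bounded_closed_compact.
    exists (`|x0| + rho); split; first exact: num_real.
    move=> B hB x xK /=; rewrite -(subrK x0 x) (le_trans (ler_normD _ _)) //.
    by move: xK; rewrite /K /= => xK; lra.
  rewrite (_ : K = (fun x => `|x - x0|) @^-1` [set t | t <= rho]) //.
  apply: closed_comp; last exact: closed_le.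
  move=> x _; apply: (cvg_norm (F := nbhs x)).
  apply: (cvg_mxB (F := nbhs x)); [exact: cvg_id | exact: cvg_cst].
- apply: continuous_in_subspaceT => x /[!inE] xK.
  have xr : `|x - x0| < r by apply: le_lt_trans xK _.
  have [[dgx _] _] := hr _ xr.
  apply: (cvg_norm (F := nbhs x)).
  apply: (cvg_mxB (F := nbhs x)); last exact: cvg_id.
  apply: (cvg_mxD (F := nbhs x)); last exact: cvg_cst.
  exact: differentiable_continuous.
exists x; first exact: le_lt_trans rhoe.
apply/eqP; rewrite -fg -/(T x) -subr_eq0 -normr_le0.
have := xmin (T x); rewrite inE => /(_ (TK _ xK)).
have := lip (T x) x (le_lt_trans (TK _ xK) rhor) (le_lt_trans xK rhor).
have -> : T (T x) - T x = g (T x) - g x by rewrite {1}/T {3}/T opprD addrACA subrr addr0.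
lra.
Qed.

End MatrixLimits.

(** * Flags and adapted matrices *)

Section Support.
Variables (R : realType) (N : nat).
Implicit Types (A B g u : 'M[R]_N) (r : rel 'I_N) (v : 'rV[R]_N).

Definition supp r A := forall l c, ~~ r l c -> A l c = 0.

Lemma supp_mul r A B : transitive r -> supp r A -> supp r B -> supp r (A *m B).
Proof.
move=> tr hA hB l c nr; rewrite mxE big1 // => k _.
have [rlk|/hA->] := boolP (r l k); last by rewrite mul0r.
have [rkc|/hB->] := boolP (r k c); last by rewrite mulr0.
by rewrite (tr _ _ _ rlk rkc) in nr.
Qed.

Lemma supp_add r A B : supp r A -> supp r B -> supp r (A + B).
Proof. by move=> hA hB l c n; rewrite !mxE hA // hB // addr0. Qed.

Lemma supp_opp r A : supp r A -> supp r (- A).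
Proof. by move=> hA l c n; rewrite !mxE hA // oppr0. Qed.

Lemma supp_scale r (a : R) A : supp r A -> supp r (a *: A).
Proof. by move=> hA l c n; rewrite !mxE hA // mulr0. Qed.

Lemma supp_1 r : reflexive r -> supp r 1%:M.
Proof. by move=> rr l c; rewrite !mxE; case: eqP => // ->; rewrite rr. Qed.

(** For fixed l, let [P] project onto the coordinates c with r l c. Transitivity makes the row space
    of [P] stable under A, and by rank A maps it onto itself, so it is stable under the inverse of A
    as well; reflexivity puts row l of the inverse into it. *)
Lemma supp_inv r A : reflexive r -> transitive r -> supp r A ->
  A \in unitmx -> supp r (invmx A).
Proof.
move=> rr tr hA uA l.
pose P : 'M[R]_N := \matrix_(i, j) ((i == j) && r l j)%:R.
have mulP n (B : 'M[R]_(n, N)) i j : (B *m P) i j = if r l j then B i j else 0.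
  rewrite mxE (bigD1 j) //= big1 ?addr0 => [|k kj].
    by rewrite mxE eqxx /=; case: (r l j); rewrite ?mulr1 ?mulr0.
  by rewrite mxE (negPf kj) mulr0.
have PAP : P *m A *m P = P *m A.
  apply/matrixP => i j; rewrite mulP; case: ifPn => // nr; rewrite mxE big1 // => k _.
  rewrite mxE; case: (i == k) => /=; last by rewrite mul0r.
  have [rk|] := boolP (r l k); last by rewrite mul0r.
  by rewrite hA ?mulr0 //; apply: contra nr; exact: tr.
have le1 : (P *m A <= P)%MS by rewrite -PAP submxMl.
have le2 : (P <= P *m A)%MS.
  rewrite -(geq_leqif (mxrank_leqif_sup le1)) mxrankMfree //.
  by rewrite row_free_unit.
have /submxP[X XE] := le2.
have E : P *m invmx A = X *m P by rewrite {1}XE !mulmxA mulmxK.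
move=> c nr; have : (P *m invmx A) l c = 0.
  by rewrite E mulP (negPf nr).
rewrite mxE (bigD1 l) //= big1 ?addr0 => [|k kl].
  by rewrite mxE eqxx rr mul1r.
by rewrite mxE eq_sym (negPf kl) mul0r.
Qed.

Lemma unitmx_inj A : (forall v, v *m A = 0 -> v = 0) -> A \in unitmx.
Proof.
move=> h; rewrite -row_free_unit -kermx_eq0; apply/rowV0P => v /sub_kermxP.
exact: h.
Qed.

Definition lowR : rel 'I_N := fun l c => (c <= l)%N.
Definition upR : rel 'I_N := fun l c => (l <= c)%N.

Lemma lowR_refl : reflexive lowR. Proof. by move=> l; rewrite /lowR leqnn. Qed.
Lemma lowR_trans : transitive lowR.
Proof. by move=> k l c h1 h2; exact: leq_trans h2 h1. Qed.
Lemma upR_refl : reflexive upR. Proof. by move=> l; rewrite /upR leqnn. Qed.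
Lemma upR_trans : transitive upR.
Proof. by move=> k l c h1 h2; exact: leq_trans h1 h2. Qed.

Lemma lower_unit A : supp lowR A -> (forall l, A l l != 0) -> A \in unitmx.
Proof.
move=> hA dA; rewrite unitmxE det_trig; last first.
  by apply/is_trig_mxP => i j ij; apply: hA; rewrite /lowR -ltnNge.
by rewrite unitfE; apply/prodf_neq0 => i _; exact: dA.
Qed.

Definition rowspan g (s : seq 'I_N) : {vspace 'rV[R]_N} :=
  <<[seq row l g | l <- s]>>%VS.

Lemma rowspanP g s v : g \in unitmx ->
  (v \in rowspan g s) <-> (forall l, l \notin s -> (v *m invmx g) 0 l = 0).
Proof.
move=> ug; split.
  move=> vs l ls.
  pose f : 'Hom('rV[R]_N, 'rV[R]_1) := linfun (mulmxr (invmx g *m delta_mx l ord0)).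
  have : (rowspan g s <= lker f)%VS.
    apply/span_subvP => _ /mapP[l' l's ->]; rewrite memv_ker lfunE /=.
    rewrite mulmxA -row_mul mulmxV // -row_mul mul1mx; apply/eqP/rowP => j.
    rewrite !mxE; case: eqP => //= E; by rewrite -E l's in ls.
  move=> /subvP/(_ _ vs); rewrite memv_ker lfunE /= mulmxA => /eqP /rowP/(_ ord0).
  rewrite [RHS]mxE => <-; rewrite [RHS]mxE [RHS](bigD1 l) //= big1 ?addr0 => [|k kl].
    by rewrite [delta_mx _ _ _ _]mxE !eqxx mulr1.
  by rewrite [delta_mx _ _ _ _]mxE (negPf kl) /= mulr0.
move=> h; rewrite -(mulmxKV ug v) (mulmx_sum_row (v *m invmx g)).
apply: memv_suml => l _; have [ls|/h->] := boolP (l \in s); last first.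
  by rewrite scale0r mem0v.
by apply/memvZ/memv_span/map_f.
Qed.

Lemma dim_rowspan g s : g \in unitmx -> uniq s -> \dim (rowspan g s) = size s.
Proof.
move=> ug us; rewrite -[RHS](size_map (fun l => row l g)); apply/eqP.
rewrite -/(free _); pose X := in_tuple [seq row l g | l <- s].
suff : free X by [].
apply/freeP => k; pose c : 'rV[R]_N :=
    \sum_i k i *: delta_mx ord0 (tnth (in_tuple s) (cast_ord (size_map _ _) i)).
have E (i : 'I_(size [seq row l g | l <- s])) :
    X`_i = row (tnth (in_tuple s) (cast_ord (size_map _ _) i)) g.
  have x0 := tnth (in_tuple s) (cast_ord (size_map _ _) i).
  rewrite (tnth_nth x0) /= (nth_map x0) //.
  by rewrite -[X in (_ < X)%N](size_map (fun l => row l g)).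
move=> Xs; have c0 : c = 0.
  have : c *m g = 0.
    rewrite -[RHS]Xs mulmx_suml; apply: eq_bigr => i _.
    by rewrite -scalemxAl -rowE E.
  by move=> /(congr1 (mulmx^~ (invmx g))); rewrite mulmxK // mul0mx.
move=> i; move: c0 => /rowP/(_ (tnth (in_tuple s) (cast_ord (size_map _ _) i))).
rewrite mxE summxE (bigD1 i) //= big1 ?addr0 => [|j ji]; first by rewrite !mxE !eqxx mulr1.
rewrite !mxE eqxx /=; case: eqP; last by rewrite mulr0.
move=> /eqP; have x0 := tnth (in_tuple s) (cast_ord (size_map _ _) i).
rewrite !(tnth_nth x0) /= nth_uniq //; last 2 first.
- by rewrite -[X in (_ < X)%N](size_map (fun l => row l g)).
- by rewrite -[X in (_ < X)%N](size_map (fun l => row l g)).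
by move=> /eqP/val_inj ij; rewrite ij eqxx in ji.
Qed.

Lemma dim_rowspan_filter g (P : pred 'I_N) : g \in unitmx ->
  \dim (rowspan g [seq l <- enum 'I_N | P l]) = #|[set l | P l]%SET|.
Proof.
move=> ug; have uF : uniq [seq l <- enum 'I_N | P l] by apply/filter_uniq/enum_uniq.
rewrite dim_rowspan // cardE; apply/perm_size/uniq_perm => //; first exact: enum_uniq.
by move=> l; rewrite mem_filter !mem_enum !inE; exact: andbT.
Qed.

Lemma first_rowsE g k :
  first_rows g k = rowspan g [seq l : 'I_N <- enum 'I_N | (l < k)%N].
Proof. by []. Qed.

Lemma first_rowsP g k v : g \in unitmx ->
  (v \in first_rows g k) <-> (forall l : 'I_N, (k <= l)%N -> (v *m invmx g) 0 l = 0).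
Proof.
move=> ug; rewrite first_rowsE; apply: (iff_trans (rowspanP _ _ ug)).
by split=> h l hl; apply: h; move: hl; rewrite mem_filter mem_enum andbT -leqNgt.
Qed.

Lemma first_rows1P k v :
  (v \in first_rows 1%:M k) <-> (forall l : 'I_N, (k <= l)%N -> v 0 l = 0).
Proof.
apply: (iff_trans (first_rowsP _ _ (unitmx1 _ _))).
by rewrite invmx1 mulmx1.
Qed.

End Support.

Lemma sorted_count_leq (s : seq nat) (i r : nat) : sorted leq s ->
  (r < size s)%N -> (r < count (fun x => x <= i)%N s)%N = (nth 0%N s r <= i)%N.
Proof.
elim: s r => //= x s IH r xs; have ss := path_sorted xs.
have [xi|xi] := leqP x i; first by case: r => //= r; rewrite add1n !ltnS; exact: IH.
have -> : count (fun x => x <= i)%N s = 0%N.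
  apply/eqP; rewrite -leqn0 leqNgt -has_count; apply/hasPn => y ys.
  have /allP/(_ y ys) xy := order_path_min leq_trans xs.
  by rewrite -ltnNge (leq_trans xi).
case: r => [|r] /=; first by rewrite [RHS]leqNgt xi.
rewrite ltnS ltn0 => rs; apply/esym/negbTE; rewrite -ltnNge.
have /allP/(_ _ (mem_nth 0%N rs)) xy := order_path_min leq_trans xs.
by rewrite (leq_trans xi).
Qed.

Section OSP.
Variables (N m : nat) (d : 'I_m -> nat).
Implicit Types K : {ffun 'I_N -> 'I_m}.

Lemma osp_card_le K (i : nat) : is_osp d K ->
  (#|[set l | (K l <= i)%N]%SET| = \sum_(j < m | j <= i) d j)%N.
Proof.
move=> oK; rewrite -sum1_card (partition_big K (fun j : 'I_m => j <= i)%N) /=; last first.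
  by move=> l; rewrite inE.
apply: eq_bigr => j ji; rewrite -(oK j) -sum1_card; apply: eq_bigl => l.
by rewrite !inE; case: eqP => [->|]; rewrite ?andbF // ji.
Qed.

(** The permutation that lists the indices block after block. It links [adapted], where the blocks
    of rows are consecutive, to lifts whose rows keep their index and are labelled by [K]. *)
Lemma osp_sort K : is_osp d K -> exists s : 'S_N, forall (r : 'I_N) (i : nat),
  (r < \sum_(j < m | j <= i) d j)%N = (K (s r) <= i)%N.
Proof.
move=> oK; pose e := sort (relpre (fun l => nat_of_ord (K l)) leq) (enum 'I_N).
have se : size e = N by rewrite size_sort size_enum_ord.
have ue : uniq e by rewrite sort_uniq enum_uniq.
have inj_s : injective (fun r : 'I_N => nth r e r).
  move=> r r' /eqP; rewrite (set_nth_default r) ?se // nth_uniq ?se //.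
  by move=> /eqP/val_inj.
exists (perm inj_s) => r i; rewrite permE -(osp_card_le i oK).
have -> : #|[set l | (K l <= i)%N]%SET| =
    count (fun x => x <= i)%N (map (fun l => nat_of_ord (K l)) e).
  rewrite count_map cardE -size_filter; apply/perm_size.
  apply: uniq_perm; rewrite ?enum_uniq ?filter_uniq //.
  by move=> l; rewrite mem_enum inE mem_filter mem_sort mem_enum andbT.
rewrite sorted_count_leq ?size_map ?se //; last first.
  by rewrite sorted_map; apply: sort_sorted => x y; exact: leq_total.
by rewrite (nth_map r) ?se.
Qed.

End OSP.

Section Kad.
Variables (R : realType) (N m : nat) (d : 'I_m -> nat).
Local Notation X := (flag R N d).
Implicit Types (K : {ffun 'I_N -> 'I_m}) (g h p u : 'M[R]_N) (F G : X).

Lemma flag_ext F G : (forall i, F i = G i) -> F = G.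
Proof.
case: F => F F1 F2; case: G => G G1 G2 /= FG.
have E : F = G by apply/funext.
case: _ / E G1 G2 {FG} => G1 G2; congr Flag; exact: Prop_irrelevance.
Qed.

(* The flag F is spanned by the rows of g, row l going into the block K l. *)
Definition kad K g F : Prop := g \in unitmx /\
  forall i v, v \in F i <-> forall l, (i < K l)%N -> (v *m invmx g) 0 l = 0.

Definition blockR K : rel 'I_N := fun l c => (K c <= K l)%N.

Lemma blockR_refl K : reflexive (blockR K).
Proof. by move=> l; rewrite /blockR leqnn. Qed.

Lemma blockR_trans K : transitive (blockR K).
Proof. by move=> k l c h1 h2; exact: leq_trans h2 h1. Qed.

Lemma kad_rowspan K g F i : kad K g F ->
  F i = rowspan g [seq l <- enum 'I_N | (K l <= i)%N].
Proof.
move=> [ug gF]; apply/vspaceP => v; apply/idP/idP.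
  move=> /gF h; apply/rowspanP => // l; rewrite mem_filter mem_enum andbT -ltnNge.
  exact: h.
move=> /(rowspanP _ _ ug) h; apply/gF => l il; apply: h.
by rewrite mem_filter mem_enum andbT -ltnNge.
Qed.

Lemma kad_inj K g F G : kad K g F -> kad K g G -> F = G.
Proof. by move=> h1 h2; apply: flag_ext => i; rewrite !(@kad_rowspan K g). Qed.

Lemma ex_kad K g : is_osp d K -> g \in unitmx -> exists F, kad K g F.
Proof.
move=> oK ug; pose S i := rowspan g [seq l <- enum 'I_N | (K l <= i)%N].
have S1 (i j : 'I_m) : (i <= j)%N -> (S i <= S j)%VS.
  move=> ij; apply/subvP => v /(rowspanP _ _ ug) h; apply/rowspanP => // l.
  rewrite mem_filter mem_enum andbT -ltnNge => jl; apply: h.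
  by rewrite mem_filter mem_enum andbT -ltnNge (leq_ltn_trans ij).
have S2 (i : 'I_m) : \dim (S i) = (\sum_(j < m | (j <= i)%N) d j)%N.
  exact: etrans (dim_rowspan_filter _ ug) (osp_card_le i oK).
exists (Flag S1 S2); split => // i v; apply: (iff_trans (rowspanP _ _ ug)).
by split=> h l; have := h l; rewrite mem_filter mem_enum andbT -ltnNge.
Qed.

Lemma adapted_perm K (s : 'S_N) g F :
  (forall (r : 'I_N) (i : nat),
    (r < \sum_(j < m | j <= i) d j)%N = (K (s r) <= i)%N) ->
  adapted (perm_mx s *m g) F <-> kad K g F.
Proof.
move=> sP; rewrite /adapted /kad unitmx_mul unitmx_perm /=.
have E v r : g \in unitmx ->
    (v *m invmx (perm_mx s *m g)) 0 r = (v *m invmx g) 0 (s r).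
  move=> ug; have -> : invmx (perm_mx s *m g) = invmx g *m perm_mx (s^-1)%g.
    have us : perm_mx s *m g \in unitmx by rewrite unitmx_mul unitmx_perm.
    rewrite -[LHS]mulmx1 -[RHS](mulKmx us); congr (_ *m _).
    rewrite !mulmxA mulmxK // -perm_mxM mulgV perm_mx1 //.
  rewrite mulmxA mxE (bigD1 (s r)) //= big1 ?addr0 => [|k kr].
    by rewrite !mxE permK eqxx mulr1.
  rewrite !mxE; case: eqP => [sk|_]; last by rewrite mulr0.
  by rewrite -sk permKV eqxx in kr.
split=> -[ug h]; split => //.
  move=> i v; rewrite h.
  have us : perm_mx s *m g \in unitmx by rewrite unitmx_mul unitmx_perm.
  apply: (iff_trans (first_rowsP _ _ us)); split=> hh l.
    move=> il; have := hh ((s^-1)%g l); rewrite E // permKV; apply.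
    by rewrite leqNgt sP permKV -ltnNge.
  by rewrite leqNgt sP -ltnNge => il; rewrite E //; apply: hh.
move=> i; apply/vspaceP => v; apply/idP/idP.
  have us : perm_mx s *m g \in unitmx by rewrite unitmx_mul unitmx_perm.
  move=> /h hh; apply/first_rowsP => // l; rewrite leqNgt sP -ltnNge => il.
  by rewrite E //; apply: hh.
have us : perm_mx s *m g \in unitmx by rewrite unitmx_mul unitmx_perm.
move=> /(first_rowsP _ _ us) hh; apply/h => l il.
have := hh ((s^-1)%g l); rewrite E // permKV; apply.
by rewrite leqNgt sP permKV -ltnNge.
Qed.

(** With [kad_mul]: the lifts of a flag form one orbit of the parabolic subgroup of block lower
    triangular matrices acting on the left. *)
Lemma kad_eq K g h F : kad K g F -> kad K h F -> supp (blockR K) (h *m invmx g).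
Proof.
move=> [ug gF] [uh hF] l c; rewrite /blockR -ltnNge => lc.
have /gF/(_ c lc) : row l h \in F (K l).
  apply/hF => c' lc'; rewrite -row_mul mulmxV // !mxE; case: eqP => // lc2.
  by rewrite lc2 ltnn in lc'.
by rewrite -row_mul mxE.
Qed.

Lemma kad_mul K g p F : p \in unitmx -> supp (blockR K) p -> kad K g F ->
  kad K (p *m g) F.
Proof.
move=> up sp [ug gF]; split; first by rewrite unitmx_mul up.
have sq : supp (blockR K) (invmx p).
  by apply: supp_inv => //; [exact: blockR_refl | exact: blockR_trans].
have stable (q : 'M[R]_N) (i : 'I_m) (w : 'rV[R]_N) : supp (blockR K) q ->
    (forall l, (i < K l)%N -> w 0 l = 0) ->
    forall l, (i < K l)%N -> (w *m q) 0 l = 0.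
  move=> hq hw l il; rewrite mxE big1 // => k _.
  have [ik|ki] := ltnP i (K k); first by rewrite hw // mul0r.
  by rewrite hq ?mulr0 // /blockR -ltnNge (leq_ltn_trans ki).
have E : invmx (p *m g) = invmx g *m invmx p.
  have upg : p *m g \in unitmx by rewrite unitmx_mul up.
  by rewrite -[RHS](mulKmx upg) !mulmxA (mulmxK ug) mulmxK.
move=> i v; rewrite gF E mulmxA; split; first exact: stable.
move=> h; have := stable p i _ sp h; rewrite mulmxKV //.
Qed.

Lemma stab_kad K g F A : kad K g F ->
  stab F A <-> supp (blockR K) (g *m A *m invmx g).
Proof.
move=> [ug gF]; split.
  move=> sA l c; rewrite /blockR -ltnNge => lc.
  have : row l g \in F (K l).
    apply/gF => c' lc'; rewrite -row_mul mulmxV // !mxE; case: eqP => // lc2.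
    by rewrite lc2 ltnn in lc'.
  by move=> /sA/gF/(_ c lc); rewrite -!row_mul mxE.
move=> sA i v /gF h; apply/gF => l il.
have -> : v *m A *m invmx g = v *m invmx g *m (g *m A *m invmx g).
  by rewrite !mulmxA mulmxKV.
rewrite mxE big1 // => k _.
have [ik|ki] := ltnP i (K k); first by rewrite h // mul0r.
by rewrite sA ?mulr0 // /blockR -ltnNge (leq_ltn_trans ki).
Qed.

(** For lower triangular [g] the first k rows span E_k. Thus F_i and E_k are spanned by parts of one
    basis, and their intersection by the common rows. *)
Lemma cell_of_kad K g F : kad K g F -> supp (@lowR N) g -> cell K F.
Proof.
move=> gF sg i k kN; have [ug h] := gF.
have -> : (F i :&: first_rows 1%:M k)%VS =
    rowspan g [seq l : 'I_N <- enum 'I_N | (K l <= i)%N && (l < k)%N].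
  have stable (q : 'M[R]_N) (w : 'rV[R]_N) : supp (@lowR N) q ->
      (forall l : 'I_N, (k <= l)%N -> w 0 l = 0) ->
      forall l : 'I_N, (k <= l)%N -> (w *m q) 0 l = 0.
    move=> hq hw l il; rewrite mxE big1 // => j _.
    have [ik|ki] := leqP k j; first by rewrite hw // mul0r.
    by rewrite hq ?mulr0 // /lowR -ltnNge (leq_trans ki).
  have sq : supp (@lowR N) (invmx g).
    by apply: supp_inv => //; [exact: lowR_refl | exact: lowR_trans].
  apply/vspaceP => v; rewrite memv_cap; apply/andP/idP.
    move=> [/h v1 /first_rows1P v2]; apply/rowspanP => // l.
    rewrite mem_filter mem_enum andbT negb_and -ltnNge -leqNgt => /orP[/v1//|].
    exact: stable.
  move=> /(rowspanP _ _ ug) hv; split.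
    apply/h => l il; apply: hv.
    by rewrite mem_filter mem_enum andbT negb_and -ltnNge il.
  apply/first_rows1P; rewrite -(mulmxKV ug v); apply: stable => // l kl.
  by apply: hv; rewrite mem_filter mem_enum andbT negb_and -leqNgt kl orbT.
exact: dim_rowspan_filter.
Qed.

(* The pivots of F with respect to the standard flag give a lower unitriangular
   lift of F. *)
Lemma kad_of_cell K F : is_osp d K -> cell K F ->
  exists g, [/\ kad K g F, supp (@lowR N) g & forall l, g l l = 1].
Proof.
move=> oK cF.
have piv (l : 'I_N) : exists v : 'rV[R]_N,
    [/\ v \in F (K l), v 0 l = 1 & forall c : 'I_N, (l < c)%N -> v 0 c = 0].
  have d1 := cF (K l) l (ltnW (ltn_ord l)).
  have d2 := cF (K l) l.+1 (ltn_ord l).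
  have dlt : (\dim (F (K l) :&: first_rows 1%:M l) <
      \dim (F (K l) :&: first_rows 1%:M l.+1))%N.
    rewrite d1 d2; apply: proper_card; apply/properP; split.
      by apply/fintype.subsetP => c; rewrite !inE => /andP[-> /ltnW]; rewrite ltnS.
    by exists l; rewrite !inE ?leqnn ?ltnS ?leqnn ?ltnn ?andbF.
  have /subvPn[v] : ~~ (F (K l) :&: first_rows 1%:M l.+1 <=
      F (K l) :&: first_rows 1%:M l)%VS.
    by apply/negP => /dimvS; rewrite leqNgt dlt.
  rewrite !memv_cap => /andP[v1 /first_rows1P v2] ; rewrite v1 /= => v3.
  have vl : v 0 l != 0.
    apply: contra v3 => /eqP vl; apply/first_rows1P => c.
    by rewrite leq_eqVlt => /orP[/eqP/val_inj <-//|/v2].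
  exists ((v 0 l)^-1 *: v); split; first exact: memvZ.
    by rewrite mxE mulVf //.
  by move=> c lc; rewrite mxE [v 0 c]v2 ?mulr0 //.
have [w hw] := choice piv; pose g := \matrix_l w l.
have sg : supp (@lowR N) g.
  move=> l c; rewrite /lowR -ltnNge mxE => lc.
  by have [_ _] := hw l; apply.
have dg l : g l l = 1 by rewrite mxE; have [] := hw l.
have ug : g \in unitmx by apply: lower_unit => // l; rewrite dg oner_eq0.
exists g; split => //; split => // i v.
have -> : F i = rowspan g [seq l <- enum 'I_N | (K l <= i)%N].
  apply/esym/eqP; rewrite eqEdim; apply/andP; split.
    apply/span_subvP => _ /mapP[l + ->]; rewrite mem_filter mem_enum andbT => li.
    rewrite rowK; have [wF _ _] := hw l.
    by case: (F) wF => S S1 S2 /=; apply/subvP/S1.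
  have -> : \dim (F i) = (\sum_(j < m | (j <= i)%N) d j)%N by case: (F).
  by apply/eq_leq/esym; exact: etrans (dim_rowspan_filter _ ug) (osp_card_le i oK).
apply: (iff_trans (rowspanP _ _ ug)).
by split=> h l; have := h l; rewrite mem_filter mem_enum andbT -ltnNge.
Qed.

End Kad.

(** * The chart of a cell *)

Section Chart.
Variables (R : realType) (N m : nat).
Implicit Types (K : {ffun 'I_N -> 'I_m}) (g h p u A Y : 'M[R]_N).

Definition strictR K : rel 'I_N := fun l c => (K l < K c)%N.

Definition unip K u := forall l c, (K c <= K l)%N -> u l c = (l == c)%:R.

Lemma unip1 K : unip K 1%:M.
Proof. by move=> l c _; rewrite mxE. Qed.

Lemma unip_supp K u :
  unip K u -> supp (fun l c => (l == c) || (K l < K c)%N) u.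
Proof.
move=> hu l c; rewrite negb_or -leqNgt => /andP[lc Klc].
by rewrite hu // (negPf lc).
Qed.

Lemma unip_unit K u : unip K u -> u \in unitmx.
Proof.
move=> hu; apply: unitmx_inj => v vu.
suff H n l : (K l < n)%N -> v 0 l = 0 by apply/rowP => l; rewrite mxE (H (K l).+1).
elim: n l => // n IH l ln; move: vu => /rowP/(_ l).
rewrite !mxE (bigD1 l) //= hu // eqxx mulr1 big1 ?addr0 // => k kl.
have [kk|kk] := leqP (K l) (K k); first by rewrite hu // (negPf kl) mulr0.
by rewrite IH ?mul0r // (leq_trans kk).
Qed.

Lemma unip_inv K u : unip K u -> unip K (invmx u).
Proof.
move=> hu; have uu := unip_unit hu.
have s : supp (fun l c => (l == c) || (K l < K c)%N) (invmx u).
  apply: supp_inv => //; [by move=> l; rewrite eqxx | | exact: unip_supp].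
  move=> k l c /orP[/eqP->//|lk] /orP[/eqP<-|kc]; first by rewrite lk orbT.
  by rewrite (ltn_trans lk kc) orbT.
move=> l c cl; have [<-|lc] := eqVneq l c; last first.
  by rewrite s // negb_or lc -leqNgt.
have := mulVmx uu => /matrixP/(_ l l); rewrite !mxE eqxx (bigD1 l) //= hu //.
rewrite eqxx mulr1 big1 ?addr0 // => k kl.
have [kk|kk] := leqP (K l) (K k); first by rewrite hu // (negPf kl) mulr0.
by rewrite s ?mul0r // negb_or eq_sym kl -leqNgt ltnW.
Qed.

Lemma unip_mul K u h : unip K u -> unip K h -> unip K (u *m h).
Proof.
move=> hu hh l c cl; rewrite mxE (bigD1 l) //= hu // eqxx mul1r hh //.
rewrite big1 ?addr0 // => k kl.
have [kk|kk] := leqP (K k) (K l); first by rewrite hu // eq_sym (negPf kl) mul0r.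
rewrite [h k c]hh; last by rewrite (leq_trans cl) // ltnW.
case: eqP => [kc|]; last by rewrite mulr0.
by rewrite kc ltnNge cl in kk.
Qed.

Lemma unip_block1 K u : unip K u -> supp (blockR K) u -> u = 1%:M.
Proof.
move=> hu su; apply/matrixP => l c; rewrite mxE.
have [cl|lc] := leqP (K c) (K l); first exact: hu.
rewrite su /blockR -?ltnNge //; case: eqP => // E.
by rewrite E ltnn in lc.
Qed.

Lemma unip_addr K u Y : unip K u -> supp (strictR K) Y -> unip K (u + Y).
Proof.
by move=> hu sY l c cl; rewrite mxE hu // sY ?addr0 // /strictR -leqNgt.
Qed.

Lemma supp_strict_mull K Y u : supp (strictR K) Y -> unip K u ->
  supp (strictR K) (Y *m u).
Proof.
move=> sY hu l c; rewrite /strictR -leqNgt => cl; rewrite mxE big1 // => k _.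
have [kk|kk] := leqP (K k) (K l); first by rewrite sY ?mul0r // /strictR -leqNgt.
rewrite [u k c]hu; last by rewrite (leq_trans cl) // ltnW.
case: eqP => [kc|]; last by rewrite mulr0.
by rewrite kc ltnNge cl in kk.
Qed.

(** The leading block of [g], formed by the indices of blocks up to i, is completed by the identity,
    so that all leading blocks are square of the same size and their determinants are the leading
    block minors. *)
Definition Zblock K (i : nat) g : 'M[R]_N :=
  \matrix_(l, c) (if (K l <= i)%N && (K c <= i)%N then g l c else (l == c)%:R).

(** Block elimination: row l comes from the inverse of the leading block up to [K l], and
    multiplying by it turns row l of [g] into a row of a unipotent matrix. The inverse is spelled
    out as adjugate over determinant because [invmx] is defined by cases, while this formula can be
    differentiated directly. *)
Definition pmx K g : 'M[R]_N := \matrix_(l, c)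
  (if (K c <= K l)%N
   then ((\det (Zblock K (K l) g))^-1 *: \adj (Zblock K (K l) g)) l c else 0).

Definition coordmx K g : 'M[R]_N := pmx K g *m g.

Definition goodmx K g := forall i : 'I_m, Zblock K i g \in unitmx.

Lemma pmx_block K g : supp (blockR K) (pmx K g).
Proof. by move=> l c; rewrite /blockR mxE => /negPf ->. Qed.

Lemma pmxE K g l c : goodmx K g -> pmx K g l c =
  if (K c <= K l)%N then invmx (Zblock K (K l) g) l c else 0.
Proof. by move=> hg; rewrite mxE /invmx hg. Qed.

Lemma unip_coordmx K g : goodmx K g -> unip K (coordmx K g).
Proof.
move=> hg l c cl; have /matrixP/(_ l c) := mulVmx (hg (K l)).
rewrite [RHS]mxE => <-; rewrite mxE [RHS]mxE; apply: eq_bigr => k _.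
rewrite pmxE //; have [kl|lk] := leqP (K k) (K l).
  by rewrite [Zblock _ _ _ k c]mxE kl cl.
rewrite [Zblock _ _ _ k c]mxE leqNgt lk /=; case: eqP => [kc|]; last by rewrite mul0r mulr0.
by rewrite kc ltnNge cl in lk.
Qed.

Lemma Zblock_mul K i p g : supp (blockR K) p ->
  Zblock K i (p *m g) = Zblock K i p *m Zblock K i g.
Proof.
move=> sp; apply/matrixP => l c; rewrite [RHS]mxE.
have [li|il] := leqP (K l) i; last first.
  rewrite mxE leqNgt il /= (bigD1 l) //= !mxE leqNgt il /= eqxx mul1r.
  rewrite big1 ?addr0 // => k kl.
  by rewrite mxE leqNgt il /= eq_sym (negPf kl) mul0r.
have [ci|ic] := leqP (K c) i.
  rewrite mxE li ci /= mxE; apply: eq_bigr => k _; rewrite !mxE li ci /=.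
  have [ki|ik] := leqP (K k) i => //=.
  rewrite sp; last by rewrite /blockR -ltnNge (leq_ltn_trans li).
  case: eqP => [lk|]; last by rewrite !mul0r.
  by rewrite -lk ltnNge li in ik.
rewrite mxE li leqNgt ic /=; have -> : (l == c) = false.
  by apply/eqP => lc; rewrite -lc ltnNge li in ic.
rewrite big1 // => k _; rewrite !mxE li (leqNgt (K c)) ic /= andbF.
have [ki|ik] := leqP (K k) i.
  case: eqP => [kc|]; last by rewrite mulr0.
  by rewrite -kc ltnNge ki in ic.
case: eqP => [lk|]; last by rewrite mul0r.
by rewrite -lk ltnNge li in ik.
Qed.

Lemma Zblock_unip K i u : unip K u -> unip K (Zblock K i u).
Proof. by move=> hu l c cl; rewrite mxE; case: ifP => // _; exact: hu. Qed.

Lemma Zblock1 K i : Zblock K i 1%:M = 1%:M :> 'M[R]_N.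
Proof. by apply/matrixP => l c; rewrite !mxE; case: ifP. Qed.

Lemma goodmx_mul K p u : p \in unitmx -> supp (blockR K) p -> unip K u ->
  goodmx K (p *m u).
Proof.
move=> up sp hu i; rewrite Zblock_mul // unitmx_mul (unip_unit (Zblock_unip i hu)).
rewrite andbT; have := Zblock_mul i (invmx p) sp.
by rewrite mulmxV // Zblock1 => /esym/mulmx1_unit[].
Qed.

Definition projS K Y : 'M[R]_N := \matrix_(l, c) (if (K l < K c)%N then Y l c else 0).

(* The derivative, in the coordinate u, of the flag spanned by the rows of u
   moving with velocity A. *)
Definition theta K u A : 'M[R]_N := projS K (u *m A *m invmx u) *m u.

Lemma projS_strict K Y : supp (strictR K) (projS K Y).
Proof. by move=> l c; rewrite /strictR mxE => /negPf ->. Qed.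

Lemma projS_id K Y : supp (strictR K) Y -> projS K Y = Y.
Proof.
by move=> sY; apply/matrixP => l c; rewrite mxE; case: ifPn => // n; rewrite sY.
Qed.

Lemma projS_block K Y : supp (blockR K) Y -> projS K Y = 0.
Proof.
move=> sY; apply/matrixP => l c; rewrite !mxE; case: ifPn => // n.
by rewrite sY // /blockR -ltnNge.
Qed.

Lemma projSD K A Y : projS K (A + Y) = projS K A + projS K Y.
Proof. by apply/matrixP => l c; rewrite !mxE; case: ifP; rewrite ?addr0. Qed.

Lemma projSZ K (a : R) Y : projS K (a *: Y) = a *: projS K Y.
Proof. by apply/matrixP => l c; rewrite !mxE; case: ifP; rewrite ?mulr0. Qed.

Lemma thetaD K u A Y : theta K u (A + Y) = theta K u A + theta K u Y.
Proof. by rewrite /theta mulmxDr mulmxDl projSD mulmxDl. Qed.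

Lemma thetaZ K u (a : R) Y : theta K u (a *: Y) = a *: theta K u Y.
Proof. by rewrite /theta -scalemxAr -scalemxAl projSZ -scalemxAl. Qed.

Lemma theta_strict K u A : unip K u -> supp (strictR K) (theta K u A).
Proof. by move=> hu; apply: supp_strict_mull => //; exact: projS_strict. Qed.

Lemma theta_lift K u Y : unip K u -> supp (strictR K) Y ->
  theta K u (invmx u *m Y) = Y.
Proof.
move=> hu sY; have uu := unip_unit hu.
rewrite /theta mulmxA mulmxV // mul1mx projS_id ?mulmxKV //.
by apply: supp_strict_mull => //; exact: unip_inv.
Qed.

End Chart.

Section Coordinates.
Variables (R : realType) (N m : nat) (d : 'I_m -> nat).
Local Notation X := (flag R N d).
Implicit Types (K : {ffun 'I_N -> 'I_m}) (g h p u A Y : 'M[R]_N) (F G : X).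

(** With [theta_lift]: [theta K u] induces an isomorphism of T_F X onto the strictly block upper
    triangular matrices, the tangent space of the chart. *)
Lemma theta_eq0 K u F A : unip K u -> kad K u F -> theta K u A = 0 <-> stab F A.
Proof.
move=> hu uF; rewrite (stab_kad A uF); have uu := unip_unit hu; split.
  move=> /(congr1 (mulmx^~ (invmx u))); rewrite mulmxK // mul0mx => /matrixP p0.
  move=> l c; rewrite /blockR -ltnNge => lc.
  by have := p0 l c; rewrite mxE lc [in RHS]mxE.
by move=> s; rewrite /theta projS_block ?mul0mx.
Qed.

Lemma kad_unip_inj K u h F : unip K u -> unip K h -> kad K u F -> kad K h F ->
  u = h.
Proof.
move=> hu hh uF hF; have uu := unip_unit hu.
have : h *m invmx u = 1%:M.
  apply: (@unip_block1 _ _ _ K); last exact: kad_eq hF.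
  by apply: unip_mul => //; exact: unip_inv.
by move=> /(congr1 (mulmx^~ u)); rewrite mulmxKV // mul1mx.
Qed.

Definition ucoord K F : 'M[R]_N := xget 1%:M [set u | unip K u /\ kad K u F].

Definition inchart K F := exists u, unip K u /\ kad K u F.

Lemma ucoordP K F : inchart K F -> unip K (ucoord K F) /\ kad K (ucoord K F) F.
Proof. by move=> [u hu]; rewrite /ucoord; case: xgetP => [v _ //|/(_ u)]; case. Qed.

Lemma ucoordE K u F : unip K u -> kad K u F -> ucoord K F = u.
Proof.
move=> hu uF; have [h1 h2] : unip K (ucoord K F) /\ kad K (ucoord K F) F.
  by apply: ucoordP; exists u.
exact: kad_unip_inj uF.
Qed.

Lemma kad_coordmx K g F : goodmx K g -> kad K g F -> kad K (coordmx K g) F.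
Proof.
move=> hg gF; have := unip_unit (unip_coordmx hg).
rewrite /coordmx unitmx_mul => /andP[up _].
by apply: kad_mul => //; exact: pmx_block.
Qed.

(** Elimination gives one direction, multiplicativity of the leading blocks under the parabolic
    subgroup the other. The minors depend continuously on the lift, which is how the chart is seen
    to be open. *)
Lemma inchart_good K g F : kad K g F -> inchart K F <-> goodmx K g.
Proof.
move=> gF; split=> [[u [hu uF]]|hg]; last first.
  by exists (coordmx K g); split; [exact: unip_coordmx | exact: kad_coordmx].
have uu := unip_unit hu; have [ug _] := gF.
rewrite -(mulmxKV uu g); apply: goodmx_mul => //; last exact: kad_eq gF.
by rewrite unitmx_mul ug unitmx_inv.
Qed.

Lemma ucoord_coordmx K g F : kad K g F -> goodmx K g -> ucoord K F = coordmx K g.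
Proof.
by move=> gF hg; apply: ucoordE; [exact: unip_coordmx | exact: kad_coordmx].
Qed.

(** The leading blocks of the lower unitriangular lift are lower triangular with diagonal 1, so
    elimination applies everywhere on the cell and does not leave the lower triangular matrices. *)
Lemma cell_inchart K F : is_osp d K -> cell K F ->
  inchart K F /\ supp (@lowR N) (ucoord K F).
Proof.
move=> oK /(kad_of_cell oK)[g [gF sg dg]].
have sZ i : supp (@lowR N) (Zblock K i g).
  move=> l c n; rewrite mxE; case: ifP => _; first exact: sg.
  by case: eqP n => // ->; rewrite /lowR leqnn.
have hg : goodmx K g.
  move=> i; apply: lower_unit => // l; rewrite mxE; case: ifP => _.
    by rewrite dg oner_eq0.
  by rewrite eqxx oner_eq0.
split; first by rewrite (inchart_good gF).
rewrite (ucoord_coordmx gF) //; apply: supp_mul => //; first exact: lowR_trans.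
move=> l c n; rewrite pmxE //; case: ifP => // _.
by apply: (supp_inv (@lowR_refl N) (@lowR_trans N) (sZ _)).
Qed.

Lemma cell_ucoord K F : is_osp d K -> inchart K F ->
  cell K F <-> supp (@lowR N) (ucoord K F).
Proof.
move=> oK cF; split; first by move=> /(cell_inchart oK)[].
by apply: cell_of_kad; have [] := ucoordP cF.
Qed.

End Coordinates.

Section NearDifferential.
Variables (R : realType) (V W : normedModType R).

Lemma is_diff_near0 (z : V -> W) (x : V) :
  (\forall y \near x, z y = 0) -> is_diff x z 0.
Proof.
move=> z0; have zx : z x = 0 := nbhs_singleton z0.
have dz : z \o shift x = cst (z x) + \0 +o_ 0 id.
  apply/eqaddoP => _/posnumP[eps]; rewrite zx.
  have : \forall y \near (0 : V), z (y + x) = 0.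
    by rewrite (near_shift x) /=; apply: filterS z0 => y /=; rewrite sub0r subrK.
  apply: filterS => y /= zy.
  by rewrite /= !fctE zy addr0 subr0 normr0 mulr_ge0.
have dE : 'd z x = \0 :> (V -> W).
  by apply: diff_unique => //; exact: cst_continuous.
apply: DiffDef => //.
apply/diff_locallyP; rewrite dE; split => //; exact: cst_continuous.
Qed.

Lemma is_diff_near (f g df : V -> W) (x : V) : is_diff x f df ->
  (\forall y \near x, f y = g y) -> is_diff x g df.
Proof.
move=> fx fg; have -> : g = f + (g - f) by apply/funext => y; rewrite !fctE addrC subrK.
rewrite -[df]addr0; apply: is_diffD; apply: is_diff_near0.
by apply: filterS fg => y; rewrite !fctE => ->; rewrite subrr.
Qed.

End NearDifferential.

(** * Topology of the flag manifold and differentiability of the coordinates *)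

Section FlagTopology.
Variables (R : realType) (N m : nat) (d : 'I_m -> nat).
Local Notation X := (flag R N d).
Implicit Types (K : {ffun 'I_N -> 'I_m}) (g h p u A Y : 'M[R]_N) (F G : X).

(** The quotient map from GL_N is open, so neighbourhoods of a flag can be tested near a single
    lift. *)
Lemma nbhs_kad K g F (W : set X) : is_osp d K -> kad K g F ->
  nbhs F W <-> \forall h \near g, forall G, kad K h G -> W G.
Proof.
move=> oK gF; have [s sP] := osp_sort oK; pose w : 'M[R]_N := perm_mx s.
have kP h G : adapted (w *m h) G <-> kad K h G by exact: adapted_perm.
have uw : w \in unitmx by exact: unitmx_perm.
split.
  rewrite nbhsE => -[U [oU UF] UW]; have [V oV VP] := (oU : flag_open U).
  have Vg : V (w *m g) by apply/(VP _ F) => //; apply/kP.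
  have : \forall h \near g, V (w *m h).
    have c : w *m h @[h --> nbhs g] --> w *m g.
      by apply: cvg_mulmx; [exact: cvg_cst | exact: cvg_id].
    exact: (c _ (open_nbhs_nbhs (conj oV Vg))).
  by apply: filterS => h Vh G /kP hG; apply/UW/(VP _ _ hG).
move=> nW; pose V0 := interior [set h | forall G : X, kad K h G -> W G].
pose U := [set G : X | exists2 h, V0 h & kad K h G].
have oV0 : open V0 by exact: open_interior.
suff oU : open (U : set X).
  have UF : U F by exists g.
  apply: filterS (open_nbhs_nbhs (conj oU UF)) => G [h V0h hG].
  by have := interior_subset V0h; exact.
(* The saturation of [V0] under the parabolic subgroup, a union of open sets; [invmx w] undoes the
   sorting of the rows. *)
exists (\bigcup_(p in [set p | p \in unitmx /\ supp (blockR K) p])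
    [set g' | V0 (p *m (invmx w *m g'))]).
  apply: bigcup_open => p _; apply: open_comp oV0 => g' _.
  apply: (cvg_mulmx (F := nbhs g')); first exact: cvg_cst.
  by apply: (cvg_mulmx (F := nbhs g')); [exact: cvg_cst | exact: cvg_id].
move=> g' G; rewrite -{1}(mulKVmx uw g') => /kP g'G; split.
  move=> [h V0h hG]; exists (h *m invmx (invmx w *m g')); last first.
    by have [u' _] := g'G; rewrite /= mulmxKV.
  have [u' _] := g'G; have [uh _] := hG; split; last exact: kad_eq hG.
  by rewrite unitmx_mul uh unitmx_inv.
by move=> [p [up sp] Vp]; exists (p *m (invmx w *m g')) => //; exact: kad_mul.
Qed.

Lemma cvg_flag (T : Type) (Fl : set_system T) {FF : Filter Fl} K (h : T -> 'M[R]_N)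
    (G : T -> X) g F : is_osp d K -> kad K g F ->
  h t @[t --> Fl] --> g -> (\forall t \near Fl, kad K (h t) (G t)) ->
  G t @[t --> Fl] --> F.
Proof.
move=> oK gF hg hG W /(nbhs_kad _ oK gF) nW.
have hW : \forall t \near Fl, forall G' : X, kad K (h t) G' -> W G' := hg _ nW.
change (Fl (G @^-1` W)); near=> t.
by apply: (near hW t) => //; near: t.
Unshelve. all: by end_near. Qed.

Lemma cvg_Zblock K i (T : Type) (Fl : set_system T) {FF : Filter Fl}
    (h : T -> 'M[R]_N) g : h t @[t --> Fl] --> g ->
  Zblock K i (h t) @[t --> Fl] --> Zblock K i g.
Proof.
move=> hg; apply: cvg_mx => l c; rewrite mxE; under eq_fun do rewrite mxE.
by case: ifP => _; [exact: cvg_coord | exact: cvg_cst].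
Qed.

Lemma near_goodmx K (T : Type) (Fl : set_system T) {FF : Filter Fl}
    (h : T -> 'M[R]_N) g : h t @[t --> Fl] --> g -> goodmx K g ->
  \forall t \near Fl, goodmx K (h t).
Proof.
move=> hg gg; apply: filter_forall => i.
by apply: near_unitmx (gg i); exact: cvg_Zblock.
Qed.

Lemma cvg_coordmx K (T : Type) (Fl : set_system T) {FF : Filter Fl}
    (h : T -> 'M[R]_N) g : h t @[t --> Fl] --> g -> goodmx K g ->
  coordmx K (h t) @[t --> Fl] --> coordmx K g.
Proof.
move=> hg gg; apply: cvg_mulmx => //; apply: cvg_mx => l c.
rewrite mxE; under eq_fun do rewrite mxE; case: ifP => _; last exact: cvg_cst.
have dZ : \det (Zblock K (K l) g) != 0 by rewrite -unitfE -unitmxE.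
apply: cvg_coord; apply: cvgZ.
  by apply: cvgV => //; apply: cvg_det; exact: cvg_Zblock.
by apply: cvg_adj; exact: cvg_Zblock.
Qed.

Lemma near_inchart K F : is_osp d K -> inchart K F ->
  \forall G \near F, inchart K G.
Proof.
move=> oK cF; have [hu uF] := ucoordP cF; apply/(nbhs_kad _ oK uF).
have gu : goodmx K (ucoord K F) by apply/(inchart_good uF).
have : \forall h \near ucoord K F, goodmx K h.
  by apply: (near_goodmx (Fl := nbhs (ucoord K F))) gu; exact: cvg_id.
by apply: filterS => h gh G hG; apply/(inchart_good hG).
Qed.

Lemma ucoord_continuous K F : is_osp d K -> inchart K F ->
  ucoord K G @[G --> F] --> ucoord K F.
Proof.
move=> oK cF W nW; have [hu uF] := ucoordP cF; apply/(nbhs_kad _ oK uF).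
have gu : goodmx K (ucoord K F) by apply/(inchart_good uF).
have n1 : \forall h \near ucoord K F, goodmx K h.
  by apply: (near_goodmx (Fl := nbhs (ucoord K F))) gu; exact: cvg_id.
have n2 : \forall h \near ucoord K F, W (coordmx K h).
  have := @cvg_coordmx K _ (nbhs (ucoord K F)) _ id _ (@cvg_id _ _) gu.
  by rewrite -(ucoord_coordmx uF gu); apply.
apply: filterS (filterI n1 n2) => h [gh Wh] G hG /=.
by rewrite (ucoord_coordmx hG gh).
Qed.

(** Hausdorff separation: since F and G differ, some entry of [h *m invmx g] is nonzero outside the
    block pattern. It stays nonzero for nearby lifts, and by [kad_eq] these represent different
    flags. *)
Lemma near_neq K g h F G : is_osp d K -> kad K g F -> kad K h G -> F <> G ->
  \forall F' \near F & G' \near G, F' <> G'.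
Proof.
move=> oK gF hG FG; have [ug _] := gF; have [uh _] := hG.
have [l [c [nb n0]]] : exists l c, ~~ blockR K l c /\ (h *m invmx g) l c != 0.
  apply: contrapT => H; apply: FG.
  have sp : supp (blockR K) (h *m invmx g).
    move=> l c nb; apply/eqP; apply: contrapT => /negP n0; apply: H.
    by exists l, c.
  apply: (kad_inj _ hG); rewrite -(mulmxKV ug h); apply: kad_mul => //.
  by rewrite unitmx_mul uh unitmx_inv.
have : \forall g' \near g & h' \near h, (h' *m invmx g') l c != 0.
  have : (x.2 *m invmx x.1) l c @[x --> (nbhs g, nbhs h)] --> (h *m invmx g) l c.
    apply: cvg_coord; apply: cvg_mulmx; first exact: cvg_snd.
    by apply: cvg_invmx => //; exact: cvg_fst.
  by move=> H; exact: (cvgr_neq0 _ H n0).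
move=> [[A B] /= [nA nB] AB].
exists ([set F' : X | exists2 g', A g' & kad K g' F'],
        [set G' : X | exists2 h', B h' & kad K h' G']) => /=.
  split; [apply/(nbhs_kad _ oK gF) | apply/(nbhs_kad _ oK hG)].
    by apply: filterS nA => g' Ag' F' ?; exists g'.
  by apply: filterS nB => g' Ag' F' ?; exists g'.
move=> [F' G'] /= [[g' Ag' gF'] [h' Bh' hG']] E.
have := AB (g', h') (conj Ag' Bh'); rewrite /= -E in hG' *.
by rewrite (kad_eq gF' hG') ?eqxx.
Qed.

Lemma differentiable_coordmx (V : normedModType R) K (f : V -> 'M[R]_N) (x : V) :
  differentiable f x -> goodmx K (f x) -> differentiable (pmx K \o f) x.
Proof.
move=> df gf; apply: differentiable_mx => l c; rewrite /pmx /=.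
under eq_fun do rewrite mxE.
case: (K c <= K l)%N; last exact: differentiable_cst.
under eq_fun do rewrite mxE.
have dZ : differentiable (fun y => Zblock K (K l) (f y)) x.
  apply: differentiable_mx => i j; under eq_fun do rewrite mxE.
  case: ((K i <= K l)%N && (K j <= K l)%N); last exact: differentiable_cst.
  exact: differentiable_coordf.
apply: differentiableM; last by apply/differentiable_coordf/differentiable_adj.
apply: differentiableV; first exact: differentiable_det.
by rewrite -unitfE -unitmxE.
Qed.

(* Differentiating u = p f, with p in the parabolic subgroup, shows that u A u^-1
   and u' u^-1 have the same strictly upper block part, where A = f^-1 f'. *)
Lemma theta_deriv K u p f dp df : u = p *m f -> unip K u -> f \in unitmx ->
  supp (blockR K) p -> supp (blockR K) dp ->
  supp (strictR K) (dp *m f + p *m df) ->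
  theta K u (invmx f *m df) = dp *m f + p *m df.
Proof.
move=> uE hu uf sp sdp; set du := dp *m f + p *m df => sdu.
have uu := unip_unit hu.
have up : p \in unitmx by move: uu; rewrite uE unitmx_mul => /andP[].
rewrite /theta.
have -> : u *m (invmx f *m df) *m invmx u = du *m invmx u - dp *m invmx p.
  have fE : f = invmx p *m u by rewrite uE mulKmx.
  rewrite /du mulmxDl.
  have -> : dp *m f *m invmx u = dp *m invmx p.
    by rewrite {1}fE -!mulmxA mulmxV // mulmx1.
  rewrite addrAC subrr add0r; congr (_ *m _); rewrite mulmxA; congr (_ *m _).
  by rewrite uE mulmxK.
rewrite projSD projS_id; last first.
  by apply: supp_strict_mull => //; exact: unip_inv.
rewrite projS_block ?addr0 ?mulmxKV //; apply: supp_opp.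
apply: supp_mul => //; first exact: blockR_trans.
by apply: supp_inv => //; [exact: blockR_refl | exact: blockR_trans].
Qed.

Lemma is_diff_entry_cst (V : normedModType R) n1 n2 (f df : V -> 'M[R]_(n1, n2))
    (x v : V) l c (k : R) :
  is_diff x f df -> (\forall y \near x, f y l c = k) -> df v l c = 0.
Proof.
move=> /(is_diff_coord l c) fx fk.
have h0 : is_diff x (cst k : V -> R^o) 0 by exact: is_diff_cst.
by have := is_diff_near_eq fx h0 fk => /(congr1 (fun w : V -> R => w v)).
Qed.

(** Near x the coordinate is the product of [pmx] and the lift. The entries of [pmx] above the
    blocks, and those of the unipotent product in or below them, are constant; differentiating these
    entries gives the support conditions of [theta_deriv]. *)
Lemma is_diff_ucoord_kad (V : normedModType R) K (f df : V -> 'M[R]_N) (Fl : V -> X)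
    (x : V) : is_diff x f df ->
  (\forall y \near x, kad K (f y) (Fl y)) -> inchart K (Fl x) ->
  is_diff x (fun y => ucoord K (Fl y))
    (fun v => theta K (ucoord K (Fl x)) (invmx (f x) *m df v)).
Proof.
move=> dffP kf cF; have [dfx _] := dffP; have kx := nbhs_singleton kf.
have gx : goodmx K (f x) by apply/(inchart_good kx).
have ng : \forall y \near x, goodmx K (f y).
  apply: (near_goodmx (Fl := nbhs x)) gx; exact: differentiable_continuous.
have nU : \forall y \near x, coordmx K (f y) = ucoord K (Fl y).
  by apply: filterS (filterI kf ng) => y [ky gy]; rewrite (ucoord_coordmx ky gy).
have [dp dpP] : exists dp : V -> 'M[R]_N, is_diff x (pmx K \o f) dp.
  by exists ('d (pmx K \o f) x); exact: differentiableP (differentiable_coordmx dfx gx).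
have du : is_diff x (fun y => coordmx K (f y))
    (fun v => dp v *m f x + pmx K (f x) *m df v).
  exact: is_diff_mulmx dpP dffP.
apply: is_diff_near nU.
have uE : ucoord K (Fl x) = coordmx K (f x) by exact: ucoord_coordmx.
suff -> : (fun v => theta K (ucoord K (Fl x)) (invmx (f x) *m df v)) =
  (fun v => dp v *m f x + pmx K (f x) *m df v) by exact: du.
apply/funext => v; apply: theta_deriv => //.
- by have [] := ucoordP cF.
- by have [] := kx.
- exact: pmx_block.
- move=> l c nb; have H := @is_diff_entry_cst V _ _ _ dp x v l c 0 dpP; apply: H.
  by apply: filterE => y; exact: pmx_block.
- move=> l c; rewrite /strictR -leqNgt => cl.
  have H := @is_diff_entry_cst V _ _ _ _ x v l c (l == c)%:R du; apply: H.
  by apply: filterS ng => y gy; rewrite unip_coordmx.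
Qed.

Lemma is_diff_ucoord (V : normedModType R) K (f : V -> 'M[R]_N) (Fl : V -> X)
    (x : V) : is_osp d K -> differentiable f x ->
  (\forall y \near x, adapted (f y) (Fl y)) -> inchart K (Fl x) ->
  is_diff x (fun y => ucoord K (Fl y))
    (fun v => theta K (ucoord K (Fl x)) (lift_deriv f x v)).
Proof.
move=> oK df af cF; have [s sP] := osp_sort oK; pose w : 'M[R]_N := perm_mx s.
have uw : w \in unitmx by exact: unitmx_perm.
have dwf : is_diff x (fun y => invmx w *m f y) (fun v => invmx w *m 'd f x v).
  suff -> : (fun v => invmx w *m 'd f x v) =
      (fun v => (0 : V -> 'M[R]_N) v *m f x + invmx w *m 'd f x v).
    exact: is_diff_mulmx (is_diff_cst (invmx w) x) (differentiableP df).
  by apply/funext => v; rewrite [(0 : V -> 'M[R]_N) v](_ : _ = 0) // mul0mx add0r.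
have kf : \forall y \near x, kad K (invmx w *m f y) (Fl y).
  by apply: filterS af => y ay; apply/(adapted_perm _ _ sP); rewrite -/w mulKVmx.
have [uwf _] := nbhs_singleton kf.
suff <- : (fun v => theta K (ucoord K (Fl x))
   (invmx (invmx w *m f x) *m (invmx w *m 'd f x v))) =
   (fun v => theta K (ucoord K (Fl x)) (lift_deriv f x v)).
  exact: is_diff_ucoord_kad dwf kf cF.
apply/funext => v; rewrite /lift_deriv; congr theta.
have uf : f x \in unitmx by move: uwf; rewrite unitmx_mul => /andP[].
rewrite -[LHS](mulKmx uf); congr (_ *m _).
by rewrite -{1}(mulKVmx uw (f x)) -mulmxA mulKVmx // mulKVmx.
Qed.

End FlagTopology.

(** * Ascents and the exchange of a and b *)

Section Counting.
Variables (N m : nat) (d : 'I_m -> nat).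
Implicit Types K : {ffun 'I_N -> 'I_m}.

Definition asc K : {set 'I_N * 'I_N} := [set p : 'I_N * 'I_N | (p.1 < p.2)%N && (K p.1 < K p.2)%N]%SET.

(** The pairs with K p.1 < K p.2 number dim X and split, by the order of p.1 and p.2, into the
    ascents and the pairs counted by [ell]. Hence the ascents can index the normal directions of the
    cell. *)
Lemma card_asc K : is_osp d K -> (#|asc K| + ell K)%N = dim_flag d.
Proof.
move=> oK; pose A := [set p : 'I_N * 'I_N | (K p.1 < K p.2)%N]%SET.
pose B := [set p : 'I_N * 'I_N | (p.1 < p.2)%N]%SET.
have -> : asc K = (A :&: B)%SET by apply/setP => p; rewrite !inE andbC.
have -> : ell K = #|(A :\: B)%SET|.
  apply: eq_card => p; rewrite !inE -leqNgt ltn_neqAle.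
  have [->|] := eqVneq p.1 p.2; first by rewrite ltnn !andbF.
  by rewrite -(inj_eq val_inj) eq_sym => ->.
rewrite cardsID -sum1_card.
have -> : (\sum_(p in A) 1 = \sum_x \sum_(y | K x < K y) 1)%N.
  by rewrite pair_big_dep /=; apply: eq_bigl => p; rewrite inE.
have fib (P : pred 'I_m) : (\sum_(y | P (K y)) 1 = \sum_(j | P j) d j)%N.
  rewrite (partition_big K P) //=; apply: eq_bigr => j Pj.
  rewrite -(oK j) -sum1_card; apply: eq_bigl => y; rewrite inE.
  by case: eqP => [->|]; rewrite ?andbF // Pj.
under eq_bigr do rewrite (fib (fun j => K _ < j)%N).
rewrite (partition_big K predT) //=; apply: eq_bigr => i _.
under eq_bigr => x /eqP -> do [].
by rewrite sum_nat_const -big_distrr /= -(oK i); congr (_ * _)%N; apply: eq_card => x; rewrite inE.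
Qed.

Lemma sum_split2 (T : finType) (a b : T) (h : T -> T -> nat) : a != b ->
  (\sum_x \sum_y h x y =
   h a a + h a b + h b a + h b b +
   (\sum_(y | (y != a) && (y != b)) (h a y + h b y + h y a + h y b)) +
   \sum_(x | (x != a) && (x != b)) \sum_(y | (y != a) && (y != b)) h x y)%N.
Proof.
move=> ab; have S (f : T -> nat) :
    (\sum_x f x = f a + f b + \sum_(x | (x != a) && (x != b)) f x)%N.
  by rewrite (bigD1 a) //= (bigD1 b) 1?eq_sym // addnA.
rewrite S; under [X in (_ + X)%N]eq_bigr => x _ do rewrite S.
rewrite !S !big_split /=; lia.
Qed.

(** Here p, q, i stand for I a, I b, I y: the two sides count the inversions of y with a or b after
    and before the exchange. *)
Lemma exch_nat (a b y p q i : nat) : (b < a)%N -> (p < q)%N ->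
  ((y < b) && (p < i) + (y < a) && (q < i) + (b < y) && (i < p) +
     (a < y) && (i < q) <=
   (y < a) && (p < i) + (y < b) && (q < i) + (a < y) && (i < p) +
     (b < y) && (i < q))%N.
Proof.
move=> ba pq.
case: (ltnP y b) => h1; case: (ltnP y a) => h2; case: (ltnP b y) => h3;
  case: (ltnP a y) => h4; try (exfalso; lia);
  rewrite /= ?add0n ?addn0; clear h1 h2 h3 h4;
  do 4?[case: ltnP => ? //=]; lia.
Qed.

(** The left side counts the ascents of I and of J formed by a and y, that is the sign changes due
    to y. For y > a the conditions p < i and q < i cancel except when p < i <= q; for y < a the
    conditions i < p and i < q cancel except when p <= i < q, and [exch_cover] excludes this case
    for y between b and a. What remains is the share of y in [NI]. *)
Lemma exch_sign_nat (a b y p q i : nat) : (b < a)%N -> y != a -> y != b ->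
  ((b < y < a)%N -> ~~ (p <= i <= q)%N) -> (p < q)%N ->
  odd ((a < y) && (p < i) + (y < a) && (i < p) + (a < y) && (q < i) + (y < a) && (i < q))%N
  = odd ((a < y) && (p < i <= q) + (y < b) && (p < i.+1 <= q))%N.
Proof.
move=> ba ya yb cov pq.
have [h|h] := ltnP a y.
  have -> : (y < a)%N = false by lia.
  have -> : (y < b)%N = false by lia.
  by rewrite /= !addn0; do 4?[case: ltnP => ? //=]; lia.
have -> : (y < a)%N = true by lia.
have [h'|h'] := ltnP y b; rewrite /= !add0n ?addn0; move: cov => /=.
  by move=> _; do 4?[case: ltnP => ? //=]; lia.
have -> : (b < y < a)%N = true by lia.
by move=> /(_ isT); do 4?[case: ltnP => ? //=]; lia.
Qed.

Section Exchange.
Variables (I J : {ffun 'I_N -> 'I_m}) (a b : 'I_N).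
Hypotheses (lt_ba : (b < a)%N) (lt_Iab : (I a < I b)%N)
  (J_def : J = [ffun x => I (tperm a b x)]) (ellIJ : ell I = (ell J).+1).

Lemma exch_neq : a != b.
Proof. by apply/eqP => E; move: lt_ba; rewrite E ltnn. Qed.

Lemma exch_a : J a = I b. Proof. by rewrite J_def ffunE tpermL. Qed.
Lemma exch_b : J b = I a. Proof. by rewrite J_def ffunE tpermR. Qed.
Lemma exch_other c : c != a -> c != b -> J c = I c.
Proof. by move=> ca cb; rewrite J_def ffunE tpermD 1?eq_sym. Qed.

(* Exchanging a and b loses the inversion (a, b) and two more for each c between
   them with I a <= I c <= I b. *)
Lemma exch_cover (c : 'I_N) : (b < c < a)%N -> ~~ (I a <= I c <= I b)%N.
Proof.
move=> /andP[bc ca]; apply/negP => /andP[ac cb].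
have ab := exch_neq; pose t := tperm a b.
have ellE K : ell K = (\sum_(x : 'I_N) \sum_(y : 'I_N) ((y < x) && (K x < K y)))%N.
  rewrite /ell -sum1_card pair_bigA /= big_mkcond; apply: eq_bigr => p _.
  by rewrite inE; case: ifP.
have eJ : ell J = (\sum_(x : 'I_N) \sum_(y : 'I_N) ((t y < t x) && (I x < I y)))%N.
  rewrite ellE (reindex_inj (@perm_inj _ t)); apply: eq_bigr => x _.
  rewrite (reindex_inj (@perm_inj _ t)); apply: eq_bigr => y _.
  by rewrite J_def !ffunE !tpermK.
move: ellIJ; rewrite eJ ellE !(sum_split2 _ ab) /t.
have -> : (\sum_(x | (x != a) && (x != b)) \sum_(y | (y != a) && (y != b))
    ((tperm a b y < tperm a b x) && (I x < I y)))%N =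
  (\sum_(x | (x != a) && (x != b)) \sum_(y | (y != a) && (y != b))
    ((y < x) && (I x < I y)))%N.
  apply: eq_bigr => x /andP[xa xb]; apply: eq_bigr => y /andP[ya yb].
  by rewrite !tpermD 1?eq_sym.
rewrite !tpermL !tpermR !ltnn /= lt_ba lt_Iab.
have -> : (a < b)%N = false by apply/negbTE; rewrite -leqNgt ltnW.
have -> : (I b < I a)%N = false by apply/negbTE; rewrite -leqNgt ltnW.
pose F := (\sum_(y : 'I_N | (y != a) && (y != b))
  ((y < a) && (I a < I y) + (y < b) && (I b < I y) +
   (a < y) && (I y < I a) + (b < y) && (I y < I b)))%N.
pose G := (\sum_(y : 'I_N | (y != a) && (y != b))
  ((tperm a b y < b) && (I a < I y) + (tperm a b y < a) && (I b < I y) +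
   (b < tperm a b y) && (I y < I a) + (a < tperm a b y) && (I y < I b)))%N.
rewrite -/F -/G; suff : (G < F)%N by move=> GF /=; rewrite !add0n !addn0 => E; lia.
have cna : c != a by apply/eqP => E; rewrite E ltnn in ca.
have cnb : c != b by apply/eqP => E; rewrite E ltnn in bc.
rewrite /G /F (bigD1 c) ?cna //= [X in (_ < X)%N](bigD1 c) ?cna //= -addSn.
apply: leq_add.
  rewrite !tpermD 1?eq_sym //.
  have -> : (c < b)%N = false by apply/negbTE; rewrite -leqNgt ltnW.
  have -> : (a < c)%N = false by apply/negbTE; rewrite -leqNgt ltnW.
  have -> : (I b < I c)%N = false by apply/negbTE; rewrite -leqNgt.
  have -> : (I c < I a)%N = false by apply/negbTE; rewrite -leqNgt.
  rewrite bc ca /= ?addn0 ?add0n; move: ac cb lt_Iab.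
  by do 2!case: ltnP => /=; lia.
apply: leq_sum => y /andP[/andP[ya yb] _]; rewrite !tpermD 1?eq_sym //.
exact: exch_nat.
Qed.

(** Only a and b change blocks, so the rank functions of I and J agree off this rectangle. Off it,
    the rank conditions of the cell of I can be read in the chart of J. *)
Lemma exch_rank (i k : nat) : ~~ ((I a <= i < I b) && (b < k <= a))%N ->
  #|[set l | (J l <= i)%N && (l < k)%N]%SET| = #|[set l | (I l <= i)%N && (l < k)%N]%SET|.
Proof.
move=> out; have [ka|ak] := ltnP a k.
  rewrite -(card_imset _ (@perm_inj _ (tperm a b))); apply: eq_card => l.
  rewrite -{1}(tpermK a b l) mem_imset; last exact: perm_inj.
  rewrite !inE J_def ffunE tpermK; congr andb.
  case: tpermP => [->|->|] //; [by rewrite ka (ltn_trans lt_ba ka)|].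
  by rewrite ka (ltn_trans lt_ba ka).
apply: eq_card => l; rewrite !inE.
have [->|la] := eqVneq l a; first by rewrite [(a < k)%N]ltnNge ak !andbF.
have [->|lb] := eqVneq l b; last by rewrite exch_other.
rewrite exch_b; have [bk|] := ltnP b k; last by rewrite !andbF.
move: out lt_Iab; rewrite bk ak !andbT.
by case: (leqP (I a) i) => ?; case: (leqP (I b) i) => ? //=; lia.
Qed.

Variable R : comNzRingType.

Definition flip (l : 'I_N) : R := if l == a then -1 else 1.

Lemma prod_flip_asc K : \prod_(p in asc K) (flip p.1 * flip p.2) =
  \prod_(y : 'I_N) ((-1) ^+ ((a < y) && (K a < K y))%N * (-1) ^+ ((y < a) && (K y < K a))%N).
Proof.
pose h (x y : 'I_N) : R := if (x < y)%N && (K x < K y)%N then flip x * flip y else 1.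
have -> : \prod_(p in asc K) (flip p.1 * flip p.2) = \prod_x \prod_y h x y.
  rewrite pair_bigA /= big_mkcond; apply: eq_bigr => p _.
  by rewrite inE /h; case: ifP.
rewrite (bigD1 a) //= (bigD1 a) //= [RHS](bigD1 a) //= /h !ltnn /= !mul1r.
under [X in _ * X]eq_bigr => x xa.
  rewrite (bigD1 a) //= big1 => [|y ya].
    rewrite mulr1; over.
  by rewrite /flip (negPf xa) (negPf ya) mulr1; case: ifP.
rewrite -big_split /=; apply: eq_bigr => y ya.
rewrite /flip eqxx (negPf ya) mulr1 mul1r.
by do !case: ifP => ?; rewrite ?expr1 ?expr0.
Qed.

Lemma exch_parity :
  \prod_(p in asc I) (flip p.1 * flip p.2) *
  \prod_(p in asc J :\ (b, a)) (flip p.1 * flip p.2) = (-1) ^+ NI I a b.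
Proof.
have ab := exch_neq; have [Ja Jb] := (exch_a, exch_b).
(* The removed ascent (b, a) of J has sign -1. This is compensated by the factor of y = b, which is
   again the pair (b, a), while y = b does not count in [NI]. *)
have : \prod_(p in asc J) (flip p.1 * flip p.2) =
    - \prod_(p in asc J :\ (b, a)) (flip p.1 * flip p.2).
  rewrite (big_setD1 (b, a)) ?inE /= ?lt_ba ?Ja ?Jb //.
  by rewrite /flip eqxx eq_sym (negPf ab) mul1r mulN1r.
move=> /(congr1 -%R); rewrite opprK => <-; rewrite !prod_flip_asc.
rewrite mulrN -big_split /=.
have -> : NI I a b = (\sum_(y : 'I_N) (((a < y) && (I a < I y <= I b)) +
    ((y < b) && (I a < (I y).+1 <= I b))))%N.
  have cardE (P : pred 'I_N) : (#|[set y | P y]%SET| = \sum_y P y)%N.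
    by rewrite -sum1_card big_mkcond; apply: eq_bigr => y _; rewrite inE; case: ifP.
  by rewrite /NI !cardE -big_split.
rewrite -prodrXr (bigD1 b) //= [RHS](bigD1 b) //= Jb Ja ltnn.
have -> : (a < b)%N = false by apply/negbTE; rewrite -leqNgt ltnW.
have -> : (I b < I a)%N = false by apply/negbTE; rewrite -leqNgt ltnW.
rewrite lt_ba lt_Iab ltnn /= !expr0 expr1 !mul1r mulN1r opprK.
apply: eq_bigr => y yb; have [->|ya] := eqVneq y a.
  have -> : (a < b)%N = false by apply/negbTE; rewrite -leqNgt ltnW.
  by rewrite !ltnn /= !expr0 !mul1r.
have cov := @exch_cover y; rewrite exch_other // -!exprD -[LHS]signr_odd -[RHS]signr_odd.
congr (_ ^+ _); congr nat_of_bool.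
by rewrite addnA; apply: (exch_sign_nat lt_ba).
Qed.

End Exchange.
End Counting.

(** * The two cells in the chart of J *)

Section CellExchange.
Variables (R : realType) (N m : nat) (d : 'I_m -> nat).
Local Notation X := (flag R N d).
Implicit Types (K L : {ffun 'I_N -> 'I_m}) (g h p u A Y : 'M[R]_N) (F G : X).

Lemma delta_mulmx (a b l c : 'I_N) A :
  (delta_mx b a *m A) l c = if l == b then A a c else 0.
Proof.
rewrite mxE (bigD1 a) //= big1 ?addr0 => [|k ka].
  by rewrite mxE eqxx andbT; case: eqP; rewrite ?mul1r ?mul0r.
by rewrite mxE (negPf ka) andbF mul0r.
Qed.

(** The jump of dim (F_i & E_k) when the index l is added tells whether K l <= i. *)
Lemma cell_inj K L F : cell K F -> cell L F -> K = L.
Proof.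
move=> cK cL; have le (l : 'I_N) (i : 'I_m) : (K l <= i)%N = (L l <= i)%N.
  have E k : (k <= N)%N -> #|[set l : 'I_N | (K l <= i)%N && (l < k)%N]%SET| =
    #|[set l : 'I_N | (L l <= i)%N && (l < k)%N]%SET| by move=> kN; rewrite -cK // cL.
  have S M : #|[set c : 'I_N | (M c <= i)%N && (c < l.+1)%N]%SET| =
     ((M l <= i) + #|[set c : 'I_N | (M c <= i)%N && (c < l)%N]%SET|)%N.
    rewrite (cardsD1 l) inE ltnS leqnn andbT; congr addn.
    apply: eq_card => c; rewrite !inE ltnS ltn_neqAle -(inj_eq val_inj).
    by case: (M c <= i)%N; rewrite ?andbF ?andbT.
  have := E _ (ltn_ord l); rewrite !S (E _ (ltnW (ltn_ord l))) => /addIn.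
  by do 2!case: (_ <= _)%N.
apply/ffunP => l; apply/val_inj/eqP; rewrite eqn_leq.
by rewrite le leqnn /= -le.
Qed.

(** In the chart of K the space F_i is a graph over the coordinates of its blocks, because the
    inverse of u is unipotent too and a coordinate in block at most i receives nothing from later
    blocks. *)
Lemma kad_flag_eq0 K u F (i : 'I_m) (v : 'rV[R]_N) : unip K u -> kad K u F ->
  v \in F i -> (forall c, (K c <= i)%N -> v 0 c = 0) -> v = 0.
Proof.
move=> hu [uu uF] /uF h v0; rewrite -(mulmxKV uu v).
suff -> : v *m invmx u = 0 by rewrite mul0mx.
apply/rowP => c; rewrite [RHS]mxE; have [/h //|ci] := ltnP i (K c).
have hv := unip_inv hu.
rewrite mxE big1 // => k _; have [ki|ik] := leqP (K k) i; first by rewrite v0 ?mul0r.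
rewrite hv; last by rewrite (leq_trans ci) // ltnW.
case: eqP => [kc|]; last by rewrite mulr0.
by rewrite kc ltnNge ci in ik.
Qed.

(* If F meets E_k in the dimension prescribed by K, every vector of F i whose
   K-leading coordinates vanish from k on lies in E_k. *)
Lemma kad_flag_full K u F (i : 'I_m) (k : nat) (y : 'rV[R]_N) : unip K u -> kad K u F ->
  \dim (F i :&: first_rows 1%:M k)%VS = #|[set l : 'I_N | (K l <= i)%N && (l < k)%N]%SET| ->
  y \in F i -> (forall c : 'I_N, (k <= c)%N -> (K c <= i)%N -> y 0 c = 0) ->
  forall c : 'I_N, (k <= c)%N -> y 0 c = 0.
Proof.
move=> hu uF dimW yF y0.
pose P : pred 'I_N := fun l => (K l <= i)%N && (l < k)%N.
pose D : 'M[R]_N := \matrix_(l, c) ((l == c) && P l)%:R.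
have mulD (v : 'rV[R]_N) c : (v *m D) 0 c = if P c then v 0 c else 0.
  rewrite mxE (bigD1 c) //= big1 ?addr0 => [|l lc].
    by rewrite mxE eqxx /=; case: ifP; rewrite ?mulr1 ?mulr0.
  by rewrite mxE (negPf lc) mulr0.
pose W := (F i :&: first_rows 1%:M k)%VS.
pose f : 'End('rV[R]_N) := linfun (mulmxr D).
have fE v : f v = v *m D by rewrite lfunE.
have Winj v : v \in W -> v *m D = 0 -> v = 0.
  rewrite memv_cap => /andP[vF /first_rows1P vk] vD.
  apply: (kad_flag_eq0 hu uF vF) => c ci; have [kc|ck] := leqP k c; first exact: vk.
  by have /rowP/(_ c) := vD; rewrite mulD /P ci ck /= mxE.
have le : (f @: W <= rowspan 1%:M [seq l <- enum 'I_N | P l])%VS.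
  apply/subvP => _ /memv_imgP[v vW ->]; apply/rowspanP; first exact: unitmx1.
  move=> l; rewrite mem_filter mem_enum andbT invmx1 mulmx1 fE mulD.
  by move=> /negPf ->.
have dimf : \dim (f @: W) = \dim W.
  apply: limg_dim_eq; apply/eqP; rewrite -subv0; apply/subvP => v.
  rewrite memv_cap memv_ker memv0 fE => /andP[vW /eqP vD].
  by rewrite (Winj _ vW vD).
have leE : (f @: W)%VS = rowspan 1%:M [seq l <- enum 'I_N | P l].
  apply/eqP; by rewrite eqEdim le dimf dimW dim_rowspan_filter ?unitmx1 //= leqnn.
have : y *m D \in (f @: W)%VS.
  rewrite leE; apply/rowspanP; first exact: unitmx1.
  move=> l; rewrite mem_filter mem_enum andbT invmx1 mulmx1 mulD.
  by move=> /negPf ->.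
move=> /memv_imgP[v vW]; rewrite fE => yv.
move: vW; rewrite memv_cap => /andP[vF /first_rows1P vk].
have /eqP : y - v = 0.
  apply: (kad_flag_eq0 (i := i) hu uF); first exact: memvB.
  move=> c ci; rewrite !mxE; have [kc|ck] := leqP k c.
    by rewrite y0 // vk // subrr.
  by have /rowP/(_ c) := yv; rewrite !mulD /P ci ck /= => ->; rewrite subrr.
by rewrite subr_eq0 => /eqP -> c; exact: vk.
Qed.

Lemma row_in_flag K u F (i : 'I_m) l : kad K u F -> (K l <= i)%N -> row l u \in F i.
Proof.
move=> [uu uF] li; apply/uF => c ic; rewrite -row_mul mulmxV // !mxE.
by case: eqP => // lc; rewrite -lc ltnNge li in ic.
Qed.

Variables (I J : {ffun 'I_N -> 'I_m}) (a b : 'I_N).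
Hypotheses (ospI : is_osp d I) (ospJ : is_osp d J).
Hypotheses (lt_ba : (b < a)%N) (lt_Iab : (I a < I b)%N)
  (J_def : J = [ffun x => I (tperm a b x)]) (ellIJ : ell I = (ell J).+1).

Let Ja : J a = I b. Proof. exact: exch_a J_def. Qed.
Let Jb : J b = I a. Proof. exact: exch_b J_def. Qed.
Let Jo c : c != a -> c != b -> J c = I c. Proof. exact: exch_other J_def c. Qed.
Let nab : a != b. Proof. exact: exch_neq lt_ba. Qed.

(* In the chart of J the two cells are { twist t v | v lower unitriangular }: the
   cell of I for t <> 0, that of J for t = 0. *)
Definition untw u : 'M[R]_N := u - u b a *: (delta_mx b a *m u).
Definition twist (t : R) A : 'M[R]_N := A + t *: (delta_mx b a *m A).

Lemma untwE u l c : untw u l c = u l c - (if l == b then u b a * u a c else 0).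
Proof.
by rewrite mxE [X in _ + X]mxE mxE delta_mulmx; case: eqP; rewrite ?mulr0.
Qed.

Lemma twistE t u l c : twist t u l c = u l c + (if l == b then t * u a c else 0).
Proof. by rewrite 2!mxE delta_mulmx; case: eqP; rewrite ?mulr0. Qed.

Lemma untwK u : unip J u -> twist (u b a) (untw u) = u.
Proof.
move=> hu; apply/matrixP => l c; rewrite twistE !untwE (negPf nab) /= subr0.
by case: eqP => _; rewrite ?subrK ?subr0 ?addr0.
Qed.

Lemma unip_untw u : unip J u -> unip J (untw u).
Proof.
move=> hu l c cl; rewrite untwE hu //; have [lb|_] := eqVneq l b; last by rewrite subr0.
rewrite [u a c]hu; last by rewrite Ja (leq_trans cl) // lb Jb ltnW.
have [ac|_] := eqVneq a c; last by rewrite mulr0 subr0.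
by rewrite lb -ac Ja Jb leqNgt lt_Iab in cl.
Qed.

Lemma untw_ba u : unip J u -> untw u b a = 0.
Proof. by move=> hu; rewrite untwE eqxx (hu a a) // eqxx mulr1 subrr. Qed.

Lemma unip_twist t u : unip J u -> unip J (twist t u).
Proof.
move=> hu l c cl; rewrite twistE hu //; have [lb|_] := eqVneq l b; last by rewrite addr0.
rewrite [u a c]hu; last by rewrite Ja (leq_trans cl) // lb Jb ltnW.
have [ac|_] := eqVneq a c; last by rewrite mulr0 addr0.
by rewrite lb -ac Ja Jb leqNgt lt_Iab in cl.
Qed.

(** The Bruhat identity in the rows and columns b, a: exchanging the rows of (1, t; 0, 1) gives (0,
    1; 1, t), and subtracting t^-1 times the second row from the first gives the lower triangular
    (-t^-1, 0; 1, t). The exchange turns lifts for J into lifts for I, and the subtraction [P] lies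
    in the parabolic subgroup of I since I a < I b. *)
Lemma cellI_of_twist t u F : t != 0 -> unip J u -> supp (@lowR N) u ->
  kad J (twist t u) F -> cell I F.
Proof.
move=> t0 hu su uF; have uu := unip_unit hu.
pose w : 'M[R]_N := tperm_mx a b.
pose P : 'M[R]_N := 1%:M - t^-1 *: delta_mx b a.
have wF : kad I (w *m twist t u) F.
  have [ut hF] := uF; have uw : w \in unitmx by exact: unitmx_perm.
  have uwt : w *m twist t u \in unitmx by rewrite unitmx_mul uw.
  split => // i v; rewrite hF.
  have E l : (v *m invmx (w *m twist t u)) 0 l = (v *m invmx (twist t u)) 0 (tperm a b l).
    have <- : invmx (twist t u) *m w = invmx (w *m twist t u).
      apply: (can_inj (mulKmx uwt)); rewrite mulmxV // mulmxA mulmxK //.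
      by rewrite -perm_mxM tperm2 perm_mx1.
    rewrite mulmxA mxE (bigD1 (tperm a b l)) //= big1 ?addr0 => [|k kl].
      by rewrite !mxE tpermK eqxx mulr1.
    rewrite !mxE; case: eqP => [kE|_]; last by rewrite mulr0.
    by rewrite -kE tpermK eqxx in kl.
  split=> h l il.
    rewrite E; apply: h; move: il; rewrite J_def ffunE tpermK //.
  by rewrite -(tpermK a b l) -E; apply: h; move: il; rewrite J_def ffunE.
have blkP : supp (blockR I) P.
  move=> l c; rewrite /blockR -ltnNge => lc; rewrite !mxE.
  case: eqP => [E|_]; first by rewrite E ltnn in lc.
  case: eqP => [lb|_] /=; last by rewrite mulr0 subrr.
  case: eqP => [ca|_] /=; last by rewrite mulr0 subrr.
  by rewrite lb ca ltnNge ltnW in lc.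
have PE (B : 'M[R]_N) l c : (P *m B) l c = B l c - (if l == b then t^-1 * B a c else 0).
  rewrite /P mulmxBl mul1mx -scalemxAl.
  have -> : (B - t^-1 *: (delta_mx b a *m B)) l c =
    B l c - t^-1 * (delta_mx b a *m B) l c by rewrite 3!mxE.
  by rewrite delta_mulmx; case: eqP; rewrite ?mulr0.
have uP : P \in unitmx.
  apply: (@unip_unit _ _ _ J) => l c cl; rewrite !mxE.
  case: (eqVneq l b) => [lb|_] /=; last by rewrite mulr0 subr0.
  case: (eqVneq c a) => [ca|_] /=; last by rewrite mulr0 subr0.
  by rewrite lb ca Ja Jb leqNgt lt_Iab in cl.
have wE (B : 'M[R]_N) l c : (w *m B) l c = B (tperm a b l) c.
  by rewrite -row_permE mxE.
have := kad_mul uP blkP wF.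
have -> : twist t u = twist t 1%:M *m u.
  by rewrite /twist mulmxDl mul1mx -scalemxAl -mulmxA mul1mx.
rewrite !mulmxA => gF; apply: cell_of_kad gF _.
apply: supp_mul => //; first exact: lowR_trans.
move=> l c; rewrite /lowR -ltnNge => lc; rewrite -mulmxA PE !wE !twistE !mxE tpermL.
rewrite eqxx /=.
have [lb|lb] := eqVneq l b.
  subst l; rewrite tpermR (negPf nab) addr0.
  have -> : (b == c) = false by apply/eqP => E; rewrite E ltnn in lc.
  by rewrite add0r mulrA mulVf // mul1r subrr.
rewrite subr0; have [la|la] := eqVneq l a.
  subst l; rewrite tpermL eqxx.
  have -> : (a == c) = false by apply/eqP => E; rewrite E ltnn in lc.
  have -> : (b == c) = false by apply/eqP => E; rewrite -E ltnNge ltnW in lc.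
  by rewrite mulr0 addr0.
rewrite tpermD 1?eq_sym // (negPf lb) addr0.
by case: eqP => // E; rewrite E ltnn in lc.
Qed.

Lemma cellJ_of_lower u F : supp (@lowR N) u -> kad J u F -> cell J F.
Proof. by move=> su uF; exact: cell_of_kad uF su. Qed.

Lemma cell_disjoint F : cell I F -> ~ cell J F.
Proof.
move=> cI /(cell_inj cI) IJ; move: Jb; rewrite -IJ => E.
by move: lt_Iab; rewrite E ltnn.
Qed.

(** The rank conditions off the rectangle of [exch_rank] suffice: by [exch_cover] they make all rows
    but row b end at the diagonal, and row b end at column a. The combination of rows b and a in
    [untw] then ends at column b. If the coordinate (b, a) vanished, F would lie in the cell of
    J. *)
Lemma chart_cellI u F : unip J u -> kad J u F -> cell I F ->
  u b a != 0 /\ supp (@lowR N) (untw u).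
Proof.
move=> hu uF cI.
have full (i : 'I_m) (k : nat) (y : 'rV[R]_N) : (k <= N)%N ->
    ~~ ((I a <= i < I b) && (b < k <= a))%N -> y \in F i ->
    (forall c : 'I_N, (k <= c)%N -> (J c <= i)%N -> y 0 c = 0) ->
    forall c : 'I_N, (k <= c)%N -> y 0 c = 0.
  move=> kN out; apply: (kad_flag_full hu uF).
  by rewrite cI // (exch_rank lt_ba lt_Iab J_def ellIJ out).
have cov (c : 'I_N) : (b < c < a)%N -> ~~ (I a <= J c <= I b)%N.
  move=> bca; rewrite Jo; first exact: (exch_cover lt_ba lt_Iab J_def ellIJ).
    by apply/eqP => E; rewrite E ltnn andbF in bca.
  by apply/eqP => E; rewrite E ltnn in bca.
(* Row l lies in F (J l), and beyond the diagonal its entries in the blocks up to J l are 0; [full]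
   removes the remaining ones. *)
have rows (l : 'I_N) k : (l < k)%N -> (k <= N)%N ->
    ~~ ((I a <= J l < I b) && (b < k <= a))%N ->
    forall c : 'I_N, (k <= c)%N -> u l c = 0.
  move=> lk kN out c kc; have := full (J l) k (row l u) kN out (row_in_flag uF (leqnn _)).
  move=> /(_ _ c kc); rewrite mxE; apply => c' kc' c'l; rewrite mxE hu //.
  by case: eqP => // E; rewrite -E leqNgt lk in kc'.
have low (l c : 'I_N) : l != b -> (l < c)%N -> u l c = 0.
  move=> lb lc; apply: (rows l l.+1) => //.
  apply/negP => /andP[/andP[al lb'] /andP[bl la]].
  have {}bl : (b < l)%N.
    by rewrite ltn_neqAle eq_sym (inj_eq val_inj) lb -ltnS.
  by move: (cov l); rewrite bl la al (ltnW lb') => /(_ isT).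
have lowb (c : 'I_N) : (a < c)%N -> u b c = 0.
  move=> ac; apply: (rows b a.+1) => //; first by rewrite ltnS ltnW.
  by rewrite ltnn !andbF.
have s : supp (@lowR N) (untw u).
  move=> l c; rewrite /lowR -ltnNge => lc; rewrite untwE.
  have [lb|lb] := eqVneq l b; last by rewrite low // subr0.
  (* This row lies in F (J a), and J a = I b is just outside the rectangle, so the rank condition at
     k = b.+1 is available. *)
  subst l; pose y := row b u - u b a *: row a u.
  have yE c' : y 0 c' = u b c' - u b a * u a c' by rewrite !mxE.
  rewrite -yE; apply: (full (J a) b.+1) => //.
  - by rewrite Ja ltnn andbF.
  - apply: memvB; first by apply: (row_in_flag uF); rewrite Ja Jb ltnW.
    by apply/memvZ/(row_in_flag uF).
  - move=> c' bc'; rewrite Ja => c'b; rewrite yE.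
    have [->|c'a] := eqVneq c' a; first by rewrite (hu a a) // eqxx mulr1 subrr.
    have [ac'|] := ltnP a c'; first by rewrite lowb // (low a) // mulr0 subrr.
    rewrite leq_eqVlt (inj_eq val_inj) (negPf c'a) /= => c'la.
    have c'p : (J c' < I a)%N.
      by have := cov c'; rewrite bc' c'la /= => /(_ isT); rewrite c'b andbT -ltnNge.
    rewrite (hu b c') ?Jb 1?ltnW // (hu a c') ?Ja //.
    have -> : (b == c') = false by apply/eqP => E; rewrite E ltnn in bc'.
    by rewrite eq_sym (negPf c'a) mulr0 subrr.
split => //; apply/negP => /eqP u0.
have E : untw u = u by rewrite /untw u0 scale0r subr0.
by apply: (cell_disjoint cI); apply: cellJ_of_lower uF; rewrite -E.
Qed.

Lemma cellIP F : inchart J F ->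
  cell I F <-> ucoord J F b a != 0 /\ supp (@lowR N) (untw (ucoord J F)).
Proof.
move=> cF; have [hu uF] := ucoordP cF; split; first exact: chart_cellI.
move=> [t0 su]; apply: (cellI_of_twist t0 (unip_untw hu) su).
by rewrite untwK.
Qed.

End CellExchange.

(** * Conormal forms and coorientations *)

Section Conormal.
Variables (R : realType) (N m : nat) (d : 'I_m -> nat).
Local Notation X := (flag R N d).
Implicit Types (K : {ffun 'I_N -> 'I_m}) (u A Y : 'M[R]_N) (F G : X).

Lemma cvg_theta K (T : Type) (Fl : set_system T) {FF : Filter Fl}
    (U B : T -> 'M[R]_N) u A : U t @[t --> Fl] --> u -> B t @[t --> Fl] --> A ->
  u \in unitmx -> theta K (U t) (B t) @[t --> Fl] --> theta K u A.
Proof.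
move=> Uu BA uu; apply: cvg_mulmx => //.
have c : U t *m B t *m invmx (U t) @[t --> Fl] --> u *m A *m invmx u.
  by apply: cvg_mulmx; [exact: cvg_mulmx | exact: cvg_invmx].
apply: cvg_mx => i j; rewrite mxE; under eq_fun do rewrite mxE.
by case: (K i < K j)%N; [exact: cvg_coord | exact: cvg_cst].
Qed.

(** Connectedness of the unit interval, through the intermediate value theorem for f read as a real
    function without zeros. *)
Lemma ivt_sign (f : R -> int) : (forall s : R, 0 <= s <= 1 -> f s = 1 \/ f s = -1) ->
  (forall s : R, 0 <= s <= 1 -> \forall s' \near s, 0 <= s' <= 1 -> f s' = f s) ->
  f 0 = f 1.
Proof.
move=> f1 floc; pose h (s : R) : R := (f s)%:~R.
have h0 (s : R) : 0 <= s <= 1 -> h s != 0.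
  by move=> /f1; rewrite /h => -[->|->]; rewrite ?oppr_eq0 oner_eq0.
have hc : {within `[0, 1], continuous h}.
  apply/subspace_continuousP => s sI.
  have {}sI : 0 <= s <= 1 by move: sI; rewrite /= in_itv.
  apply: cvg_near_cst; rewrite /within /=; apply: filterS (floc _ sI) => s' H.
  by rewrite in_itv /= => /H E; rewrite /from_subspace /h E.
have l0 : 0 <= (0 : R) <= 1 by rewrite lexx ler01.
have l1 : 0 <= (1 : R) <= 1 by rewrite lexx ler01.
have nz : ~ (exists2 c, c \in `[0, 1] & h c = 0).
  by move=> [c]; rewrite in_itv /= => /h0 /eqP.
have iv := IVT ler01 hc (v := 0).
case: (f1 _ l0) => e0; case: (f1 _ l1) => e1; rewrite ?e0 ?e1 //;
  exfalso; apply: nz; apply: iv; rewrite /h e0 e1.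
  by rewrite ge_min le_max lerN10 ler01 orbT.
by rewrite ge_min le_max lerN10 ler01 orbT.
Qed.

Variables (K : {ffun 'I_N -> 'I_m}) (c : nat) (S : set X)
  (lam : 'M[R]_N -> 'M[R]_N -> 'rV[R]_c).

(* For F in S, the linear form A |-> lam u (theta u A), u the coordinate of F, is
   onto with kernel the tangent space of S at F. *)
Record is_conormal : Prop := IsConormal {
  conormal_add : forall u A Y, lam u (A + Y) = lam u A + lam u Y ;
  conormal_scale : forall u (a : R) A, lam u (a *: A) = a *: lam u A ;
  conormal_cvg : forall (T : Type) (Fl : set_system T) (FF : Filter Fl)
    (U B : T -> 'M[R]_N) u A, U t @[t --> Fl] --> u -> B t @[t --> Fl] --> A ->
    lam (U t) (B t) @[t --> Fl] --> lam u A ;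
  conormal_chart : forall F, S F -> inchart K F ;
  conormal_tangent : forall F A, S F ->
    tangent S F A <-> lam (ucoord K F) (theta K (ucoord K F) A) = 0 ;
  conormal_onto : forall F y, S F ->
    exists2 Y, supp (strictR K) Y & lam (ucoord K F) Y = y }.

Hypothesis cf : is_conormal.
Let lamD := conormal_add cf.
Let lamZ := conormal_scale cf.
Let lamC := conormal_cvg cf.
Let SK := conormal_chart cf.
Let tangentS := conormal_tangent cf.
Let lam_surj := conormal_onto cf.

Definition conormal F A : 'rV[R]_c := lam (ucoord K F) (theta K (ucoord K F) A).

Definition conormal_mx F (v : 'I_c -> 'M[R]_N) : 'M[R]_c := \matrix_i conormal F (v i).

Lemma conormalD F A Y : conormal F (A + Y) = conormal F A + conormal F Y.
Proof. by rewrite /conormal thetaD lamD. Qed.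

Lemma conormalZ F (a : R) A : conormal F (a *: A) = a *: conormal F A.
Proof. by rewrite /conormal thetaZ lamZ. Qed.

Lemma conormal_comb F (a : 'rV[R]_c) v :
  conormal F (\sum_i a 0 i *: v i) = a *m conormal_mx F v.
Proof.
rewrite mulmx_sum_row.
have S0 : conormal F 0 = 0 by rewrite -(scale0r 0) conormalZ scale0r.
elim/big_rec2: _ => [|i y z _ <-]; first exact: S0.
by rewrite conormalD conormalZ rowK.
Qed.

Lemma conormal_surj F y : S F -> exists A, conormal F A = y.
Proof.
move=> SF; have [hu _] := ucoordP (SK SF); have [Y sY lY] := lam_surj y SF.
by exists (invmx (ucoord K F) *m Y); rewrite /conormal theta_lift.
Qed.

Lemma conormal_basis F : S F -> exists v, conormal_mx F v = 1%:M.
Proof.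
move=> SF; have /choice[v hv] : forall i : 'I_c, exists A, conormal F A = row i 1%:M.
  by move=> i; exact: conormal_surj.
by exists v; apply/row_matrixP => i; rewrite rowK.
Qed.

Lemma quot_basis_conormal F v : S F ->
  quot_basis (tangent S F) v <-> conormal_mx F v \in unitmx.
Proof.
move=> SF; have tE A (a : 'rV[R]_c) : tangent S F (A - \sum_i a 0 i *: v i) <->
    conormal F A = a *m conormal_mx F v.
  rewrite (tangentS _ SF) -/(conormal F _) conormalD -scaleN1r conormalZ conormal_comb.
  by rewrite scaleN1r; split=> [/eqP|->]; [rewrite subr_eq0 => /eqP | rewrite subrr].
split=> [qb|uM].
  apply: unitmx_inj => a aM; have [a0 [_ a0u]] := qb 0.
  have c0 : conormal F 0 = 0 by rewrite -(scale0r 0) conormalZ scale0r.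
  rewrite -(a0u a); last by apply/tE; rewrite aM.
  by apply: a0u; apply/tE; rewrite mul0mx.
move=> A; exists (conormal F A *m invmx (conormal_mx F v)); split.
  by apply/tE; rewrite mulmxKV.
by move=> a /tE ->; rewrite mulmxK.
Qed.

Variable o : X -> ('I_c -> 'M[R]_N) -> int.
Hypothesis coor : coorientation S o.

(* The sign of the coorientation on bases of the normal space, relative to the
   coordinates given by the conormal form. *)
Definition cosign F : int := xget 1 [set e : int | (e = 1 \/ e = -1) /\
  forall v, conormal_mx F v \in unitmx -> o F v = e * sgz (\det (conormal_mx F v))].

Lemma cosignP F : S F -> (cosign F = 1 \/ cosign F = -1) /\
  forall v, conormal_mx F v \in unitmx ->
    o F v = cosign F * sgz (\det (conormal_mx F v)).
Proof.
move=> SF; rewrite /cosign; case: xgetP => [e _ //|H]; exfalso.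
have [v0 hv0] := conormal_basis SF; have [oa ob] := (coor.1 _ SF).
have qb0 : quot_basis (tangent S F) v0.
  by apply/quot_basis_conormal => //; rewrite hv0 unitmx1.
apply: (H (o F v0)); split; first exact: oa.
move=> v uv; rewrite mulrC.
apply: (ob v0 v) => //; first exact/quot_basis_conormal.
move=> i; rewrite (tangentS _ SF) -/(conormal F _) conormalD -scaleN1r conormalZ.
have -> : \sum_j conormal_mx F v i j *: v0 j =
    \sum_j (row i (conormal_mx F v)) 0 j *: v0 j.
  by apply: eq_bigr => j _; rewrite [in RHS]mxE.
by rewrite conormal_comb hv0 mulmx1 rowK scaleN1r subrr.
Qed.

(** A tuple dual to the conormal form at P s has determinant 1 there, hence positive determinant
    nearby. The coorientation is locally constant on this fixed tuple, so the sign relative to the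
    conormal form is locally constant too. *)
Lemma cosign_path (P : R -> X) (U : R -> 'M[R]_N) :
  (forall s : R, 0 <= s <= 1 -> [/\ S (P s), unip K (U s) & kad K (U s) (P s)]) ->
  (forall s, U s' @[s' --> s] --> U s) -> is_osp d K ->
  cosign (P 0) = cosign (P 1).
Proof.
move=> hP cU oK; apply: (ivt_sign (f := fun s => cosign (P s))) => s sI.
  by have [SP _ _] := hP _ sI; have [] := cosignP SP.
have [SP hU UP] := hP _ sI; have [v hv] := conormal_basis SP.
have uE (s' : R) : 0 <= s' <= 1 -> ucoord K (P s') = U s'.
  by move=> /hP[_ h1 h2]; exact: ucoordE.
pose M s' := \matrix_i lam (U s') (theta K (U s') (v i)).
have ME (s' : R) : 0 <= s' <= 1 -> conormal_mx (P s') v = M s'.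
  by move=> s'I; apply/row_matrixP => i; rewrite !rowK /conormal uE.
have cM : \det (M s') @[s' --> s] --> \det (M s).
  apply: (cvg_det (F := nbhs s)); apply: (cvg_mx (F := nbhs s)) => i j.
  rewrite mxE; under eq_fun do rewrite mxE; apply: (cvg_coord (F := nbhs s)).
  apply: lamC; first exact: cU.
  apply: (cvg_theta (Fl := nbhs s)); [exact: cU | exact: cvg_cst |].
  exact: unip_unit hU.
have dM : \det (M s) = 1 by rewrite -ME // hv det1.
have pos : \forall s' \near s, 0 < \det (M s').
  by apply: (cvgr_gt (F := nbhs s)) cM _ _; rewrite dM.
have qb : quot_basis (tangent S (P s)) v.
  by apply/quot_basis_conormal => //; rewrite hv unitmx1.
(* [P] is controlled on the unit interval only, so at its end points continuity is one-sided. *)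
pose W := within [set s' : R | 0 <= s' <= 1] (nbhs s).
have cP : P s' @[s' --> W] --> P s.
  apply: (cvg_flag oK UP (h := U)).
    exact: (cvg_trans (cvg_app U (cvg_within _)) (cU s)).
  by rewrite /W near_withinE; apply: nearW => s' /hP[].
have := cP _ (coor.2 _ _ SP qb); rewrite /W => oP.
apply: filterS (filterI pos oP) => s' [ps' os'] s'I.
have [SP' _ _] := hP _ s'I.
have um : conormal_mx (P s') v \in unitmx.
  by rewrite unitmxE unitfE ME // gt_eqF.
have := os' s'I SP' ((quot_basis_conormal _ SP').2 um).
have [_ ->//] := cosignP SP'; have [_ ->] := cosignP SP; last by rewrite hv unitmx1.
by rewrite ME // gtr0_sgz // hv det1 sgz1 !mulr1.
Qed.

End Conormal.

(** * Velocities of curves of flags *)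

Section Velocities.
Variables (R : realType) (N m : nat) (d : 'I_m -> nat).
Local Notation X := (flag R N d).
Implicit Types (K : {ffun 'I_N -> 'I_m}) (u A Y : 'M[R]_N) (F G : X).

Lemma velocity_adapted_cvg (V : normedModType R) K (f : V -> 'M[R]_N) (Fl : V -> X)
    (x : V) : is_osp d K -> {for x, continuous f} ->
  (\forall y \near x, adapted (f y) (Fl y)) -> Fl y @[y --> x] --> Fl x.
Proof.
move=> oK cf af; have [s sP] := osp_sort oK; pose w : 'M[R]_N := perm_mx s.
have uw : w \in unitmx by exact: unitmx_perm.
have kf : \forall y \near x, kad K (invmx w *m f y) (Fl y).
  by apply: filterS af => y ay; apply/(adapted_perm _ _ sP); rewrite -/w mulKVmx.
apply: (cvg_flag oK (nbhs_singleton kf) (Fl := nbhs x) _ kf).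
by apply: (cvg_mulmx (F := nbhs x)) => //; exact: cvg_cst.
Qed.

Lemma velocity_cvg K (gamma : R -> X) t A : is_osp d K -> velocity gamma t A ->
  gamma s @[s --> t] --> gamma t.
Proof.
move=> oK [g [dg ag _]]; apply: (velocity_adapted_cvg oK _ ag).
exact: differentiable_continuous.
Qed.

Lemma velocity_ucoord K (gamma : R -> X) t A : is_osp d K -> velocity gamma t A ->
  inchart K (gamma t) ->
  is_diff t (fun s => ucoord K (gamma s))
    (fun s : R => s *: theta K (ucoord K (gamma t)) A).
Proof.
move=> oK [g [dg ag ->]] ct; have := is_diff_ucoord oK dg ag ct.
suff -> : (fun v : R => theta K (ucoord K (gamma t)) (lift_deriv g t v)) =
  (fun s : R => s *: theta K (ucoord K (gamma t)) (lift_deriv g t 1)) by [].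
apply/funext => s; rewrite -thetaZ; congr theta.
by rewrite /lift_deriv -{1}[s]mulr1 -[s * 1]/(s *: 1) linearZ scalemxAr.
Qed.

(* A curve of coordinates through u with derivative theta u A lifts to a curve of
   flags having velocity exactly A: the discrepancy lies in the stabilizer and is
   absorbed in the choice of the lift. *)
Lemma ex_velocity K u F A (c : R -> 'M[R]_N) : is_osp d K -> unip K u -> kad K u F ->
  c 0 = u -> is_diff (0 : R) c (fun s => s *: theta K u A) ->
  (forall s, unip K (c s)) ->
  exists gamma : R -> X, [/\ gamma 0 = F, forall s, kad K (c s) (gamma s) &
    velocity gamma 0 A].
Proof.
move=> oK hu uF c0 dc hc; have uu := unip_unit hu.
have [s sP] := osp_sort oK; pose w : 'M[R]_N := perm_mx s.
have uw : w \in unitmx by exact: unitmx_perm.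
have /choice[gamma hg] : forall s' : R, exists G : X, kad K (c s') G.
  by move=> s'; apply: ex_kad => //; exact: unip_unit (hc s').
exists gamma; split => //; first by apply: kad_inj (hg 0) _; rewrite c0.
pose C := A - invmx u *m theta K u A.
have CF : stab F C.
  apply/(theta_eq0 _ hu uF); rewrite /C thetaD -scaleN1r thetaZ scaleN1r.
  by rewrite theta_lift ?subrr //; exact: theta_strict.
pose Y := u *m C *m invmx u.
have bY : supp (blockR K) Y by exact/(stab_kad C uF).
pose p (t : R) : 'M[R]_N := 1%:M + t *: Y.
have dp : is_diff (0 : R) p (fun t => t *: Y).
  suff -> : (fun t : R => t *: Y) = (fun t : R => 0 + t *: Y).
    have dY : is_diff (0 : R) (fun t => t *: Y) (fun t => t *: Y).
      exact: (is_diff_Zl Y (is_diff_id (0 : R))).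
    exact: is_diffD (is_diff_cst 1%:M (0 : R)) dY.
  by apply/funext => t; rewrite add0r.
have dwh : is_diff (0 : R) (fun t => w *m (p t *m c t))
    (fun t => t *: (w *m (Y *m u + theta K u A))).
  have := is_diff_mulmx (is_diff_cst w (0 : R)) (is_diff_mulmx dp dc).
  suff -> : (fun t : R => t *: (w *m (Y *m u + theta K u A))) =
    (fun v : R => (0 : R -> 'M[R]_N) v *m (p 0 *m c 0) +
        w *m (v *: Y *m c 0 + p 0 *m (v *: theta K u A))) by [].
  apply/funext => t; rewrite [(0 : R -> 'M[R]_N) t](_ : _ = 0) // mul0mx add0r.
  by rewrite c0 /p scale0r addr0 mul1mx -scalemxAl -scalerDr scalemxAr.
exists (fun t => w *m (p t *m c t)); have [dwh1 dwh2] := dwh; split => //.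
  have up : \forall t \near (0 : R), p t \in unitmx.
    apply: (near_unitmx (F := nbhs (0 : R)) (A := p 0)).
      by have [dp1 _] := dp; exact: differentiable_continuous.
    by rewrite /p scale0r addr0 unitmx1.
  apply: filterS up => t upt; apply/(adapted_perm _ _ sP); apply: kad_mul (hg t) => //.
  apply: supp_add; first by apply: supp_1; exact: blockR_refl.
  exact: supp_scale.
rewrite /lift_deriv dwh2 scale1r c0 /p scale0r addr0 mul1mx.
have -> : invmx (w *m u) *m (w *m (Y *m u + theta K u A)) =
    invmx u *m (Y *m u + theta K u A).
  have uwu : w *m u \in unitmx by rewrite unitmx_mul uw.
  by apply: (can_inj (mulKmx uwu)); rewrite (mulKVmx uwu) -[RHS]mulmxA (mulKVmx uu).
rewrite mulmxDr; have -> : invmx u *m (Y *m u) = C.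
  by rewrite /Y mulmxKV // mulKmx.
by rewrite /C subrK.
Qed.

Lemma deriv_entry_cst p q (U : R -> 'M[R]_(p, q)) (B : 'M[R]_(p, q)) (t x : R) l c :
  is_diff t U (fun s => s *: B) -> (\forall s \near t, U s l c = x) -> B l c = 0.
Proof.
by move=> dU Ux; have := @is_diff_entry_cst R R p q U _ t 1 l c x dU Ux; rewrite scale1r.
Qed.

Lemma is_diff_linear_path (u A : 'M[R]_N) :
  is_diff (0 : R) (fun s => u + s *: A) (fun s => s *: A).
Proof.
suff -> : (fun t : R => t *: A) = (fun t : R => 0 + t *: A).
  have dY : is_diff (0 : R) (fun t => t *: A) (fun t => t *: A).
    exact: (is_diff_Zl A (is_diff_id (0 : R))).
  exact: is_diffD (is_diff_cst u (0 : R)) dY.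
by apply/funext => t; rewrite add0r.
Qed.

End Velocities.

Section Pairs.
Variables (R : realType) (N m : nat).
Implicit Types (K : {ffun 'I_N -> 'I_m}) (A : {set 'I_N * 'I_N}).

Definition enumerates k (p : 'I_k -> 'I_N * 'I_N) A :=
  injective p /\ forall x, x \in A <-> exists j, p j = x.

Lemma ex_enumerates A k : #|A| = k -> exists p : 'I_k -> _, enumerates p A.
Proof.
move=> Ak; exists (fun j => enum_val (cast_ord (esym Ak) j)); split.
  by move=> i j /enum_val_inj /cast_ord_inj.
move=> x; split=> [xA|[j <-]]; last exact: enum_valP.
by exists (cast_ord Ak (enum_rank_in xA x)); rewrite cast_ordK enum_rankK_in.
Qed.

Lemma prod_enumerates k (p : 'I_k -> 'I_N * 'I_N) A (f : 'I_N * 'I_N -> R) :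
  enumerates p A -> \prod_j f (p j) = \prod_(x in A) f x.
Proof.
move=> [pinj pA].
have -> : A = [set p j | j in 'I_k]%SET.
  apply/setP => x; apply/idP/imsetP => [/pA[j <-]|[j _ ->]]; first by exists j.
  by apply/pA; exists j.
by rewrite big_imset //= => i j _ _ /pinj.
Qed.

Definition pairs_mx k (p : 'I_k -> 'I_N * 'I_N) (y : 'rV[R]_k) : 'M[R]_N :=
  \sum_j y 0 j *: delta_mx (p j).1 (p j).2.

Lemma pairs_mxE k (p : 'I_k -> 'I_N * 'I_N) A y j : enumerates p A ->
  pairs_mx p y (p j).1 (p j).2 = y 0 j.
Proof.
move=> [pinj _]; rewrite summxE (bigD1 j) //= big1 ?addr0 => [|i ij].
  by rewrite !mxE !eqxx mulr1.
rewrite !mxE; case: eqP => E1; rewrite ?mulr0 //; case: eqP => E2; rewrite ?mulr0 //.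
move: ij; have -> : i = j by apply: pinj; rewrite [p j]surjective_pairing E1 E2 -surjective_pairing.
by rewrite eqxx.
Qed.

Lemma pairs_mx0 k (p : 'I_k -> 'I_N * 'I_N) A y l c : enumerates p A ->
  (l, c) \notin A -> pairs_mx p y l c = 0.
Proof.
move=> [_ pA] nA; rewrite summxE big1 // => j _; rewrite !mxE.
case: eqP => E1; rewrite ?mulr0 //; case: eqP => E2; rewrite ?mulr0 //.
by move/negP: nA; case; apply/pA; exists j; rewrite E1 E2 -surjective_pairing.
Qed.

Lemma pairs_mx_strict k (p : 'I_k -> 'I_N * 'I_N) A K y : enumerates p A ->
  A \subset asc K -> supp (strictR K) (pairs_mx p y).
Proof.
move=> pA /fintype.subsetP sA l c nlc; apply: pairs_mx0 pA _.
by apply/negP => /sA; rewrite inE => /andP[_ h]; rewrite /strictR h in nlc.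
Qed.

Lemma asc_low K (Y : 'M[R]_N) : supp (strictR K) Y ->
  (forall l c, (l, c) \in asc K -> Y l c = 0) -> supp (@lowR N) Y.
Proof.
move=> sY h l c; rewrite /lowR -ltnNge => lc.
have [Klc|n] := boolP (K l < K c)%N; last by rewrite sY.
by apply: h; rewrite inE lc.
Qed.

Lemma low_asc K (Y : 'M[R]_N) l c : supp (@lowR N) Y -> (l, c) \in asc K -> Y l c = 0.
Proof. by move=> sY; rewrite inE => /andP[/= lc _]; apply: sY; rewrite /lowR -ltnNge. Qed.

End Pairs.

Section TangentOpen.
Variables (R : realType) (N m : nat) (d : 'I_m -> nat).
Local Notation X := (flag R N d).

(** A curve with a velocity is continuous, hence stays in the open chart for small parameters. *)
Lemma tangent_inchart (K : {ffun 'I_N -> 'I_m}) (S : set X) F : is_osp d K ->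
  inchart K F -> tangent [set G | S G /\ inchart K G] F = tangent S F.
Proof.
move=> oK cF; apply/seteqP; split=> A [gamma [g0 gS vg]]; exists gamma; split => //.
  by apply: filterS gS => s [].
have cg := velocity_cvg oK vg; rewrite g0 in cg.
by apply: filterS (filterI gS (cg _ (near_inchart oK cF))) => s [].
Qed.

End TangentOpen.

(** * Conormal forms of the two cells *)

Section ConormalForms.
Variables (R : realType) (N m : nat) (d : 'I_m -> nat).
Local Notation X := (flag R N d).
Implicit Types (u A Y : 'M[R]_N) (F G : X).

Variables (I J : {ffun 'I_N -> 'I_m}) (a b : 'I_N).
Hypotheses (ospI : is_osp d I) (ospJ : is_osp d J).
Hypotheses (lt_ba : (b < a)%N) (lt_Iab : (I a < I b)%N)
  (J_def : J = [ffun x => I (tperm a b x)]) (ellIJ : ell I = (ell J).+1).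
Variables (k : nat) (pI pJ : 'I_k -> 'I_N * 'I_N).
Hypotheses (pIP : enumerates pI (asc I)) (pJP : enumerates pJ (asc J :\ (b, a))).

Let Ja : J a = I b. Proof. exact: exch_a J_def. Qed.
Let Jb : J b = I a. Proof. exact: exch_b J_def. Qed.
Let nab : a != b. Proof. exact: exch_neq lt_ba. Qed.
Let Jba : (J b < J a)%N. Proof. by rewrite Ja Jb. Qed.
Let E : 'M[R]_N := delta_mx b a.

Definition lamI u A : 'rV[R]_k := \row_j A (pI j).1 (pI j).2.

(* The differential of untw at u. *)
Definition dtw u A : 'M[R]_N := A - A b a *: (delta_mx b a *m u) - u b a *: (delta_mx b a *m A).

(** The conormal form of the cell of I in the chart of J: the differential of the entries of [untw]
    at the ascents of J other than (b, a). *)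
Definition lamf u A : 'rV[R]_k := \row_j dtw u A (pJ j).1 (pJ j).2.

Definition consv n (x : R) (y : 'rV[R]_n) : 'rV[R]_n.+1 :=
  \row_j oapp (y 0) x (unlift ord0 j).

Lemma consv0 n x (y : 'rV[R]_n) : consv x y 0 ord0 = x.
Proof. by rewrite mxE unlift_none. Qed.

Lemma consvS n x (y : 'rV[R]_n) j : consv x y 0 (lift ord0 j) = y 0 j.
Proof. by rewrite mxE liftK. Qed.

Lemma consvP n (z : 'rV[R]_n.+1) x (y : 'rV[R]_n) : z 0 ord0 = x ->
  (forall j, z 0 (lift ord0 j) = y 0 j) -> z = consv x y.
Proof.
move=> z0 zS; apply/rowP => j; have [j' ->|->] := unliftP ord0 j.
  by rewrite consvS zS.
by rewrite consv0.
Qed.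

Definition lamJ u A : 'rV[R]_k.+1 := consv (A b a) (lamf u A).

(* Local equations: the cell of J is psi = 0, the union of the two cells is the
   vanishing of all the coordinates of psi but the first. *)
Definition psi u : 'rV[R]_k.+1 :=
  consv (u b a) (\row_j untw a b u (pJ j).1 (pJ j).2).

Lemma lamfE u A j : lamf u A 0 j = dtw u A (pJ j).1 (pJ j).2.
Proof. by rewrite mxE. Qed.

Lemma dtwE u A l c : dtw u A l c =
  A l c - (if l == b then A b a * u a c + u b a * A a c else 0).
Proof.
have -> : dtw u A l c = A l c - A b a * (E *m u) l c - u b a * (E *m A) l c.
  by rewrite /dtw !mxE.
rewrite !delta_mulmx; case: eqP => _; first by rewrite opprD addrA.
by rewrite !mulr0 !subr0.
Qed.

Lemma dtwD u A Y : dtw u (A + Y) = dtw u A + dtw u Y.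
Proof.
apply/matrixP => l c; rewrite [RHS]mxE !dtwE !mxE.
by case: eqP => _; lra.
Qed.

Lemma dtwZ u (x : R) A : dtw u (x *: A) = x *: dtw u A.
Proof.
apply/matrixP => l c; rewrite [RHS]mxE !dtwE !mxE.
by case: eqP => _; lra.
Qed.

Lemma cvg_dtw (T : Type) (Fl : set_system T) {FF : Filter Fl}
    (U B : T -> 'M[R]_N) u A : U t @[t --> Fl] --> u -> B t @[t --> Fl] --> A ->
  dtw (U t) (B t) @[t --> Fl] --> dtw u A.
Proof.
move=> Uu BA; apply: cvg_mxB; first apply: cvg_mxB => //.
  apply: cvgZ; first exact: cvg_coord.
  by apply: cvg_mulmx => //; exact: cvg_cst.
apply: cvgZ; first exact: cvg_coord.
by apply: cvg_mulmx => //; exact: cvg_cst.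
Qed.

Lemma dtw_strict u A : unip J u -> supp (strictR J) A -> supp (strictR J) (dtw u A).
Proof.
move=> hu sA l c; rewrite /strictR -leqNgt => cl; rewrite dtwE sA; last first.
  by rewrite /strictR -leqNgt.
have [lb|_] := eqVneq l b; last by rewrite subr0.
rewrite lb in cl; rewrite (sA a c) ?mulr0 ?addr0; last first.
  by rewrite /strictR -leqNgt (leq_trans cl) // ltnW.
rewrite hu ?(leq_trans cl) 1?ltnW //.
have [ac|_] := eqVneq a c; last by rewrite mulr0 subr0.
by rewrite -ac leqNgt Jba in cl.
Qed.

Lemma dtw_ba u A : unip J u -> supp (strictR J) A -> dtw u A b a = 0.
Proof.
move=> hu sA; rewrite dtwE eqxx (hu a a) // eqxx mulr1 (sA a a) ?mulr0 ?addr0 ?subrr //.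
by rewrite /strictR ltnn.
Qed.

Lemma lamf0 u A : unip J u -> supp (strictR J) A ->
  lamf u A = 0 <-> supp (@lowR N) (dtw u A).
Proof.
move=> hu sA; have sd := dtw_strict hu sA; split=> [/rowP l0|low].
  apply: (asc_low sd) => l c lc.
  have [[-> ->]|n] := eqVneq (l, c) (b, a); first exact: dtw_ba.
  have /(proj2 pJP)[j pj] : (l, c) \in asc J :\ (b, a) by rewrite in_setD1 n.
  by have := l0 j; rewrite mxE pj [RHS]mxE.
apply/rowP => j; rewrite mxE [RHS]mxE; apply: (low_asc low (K := J)).
have : pJ j \in asc J :\ (b, a) by apply/(proj2 pJP); exists j.
by rewrite -surjective_pairing in_setD1 => /andP[].
Qed.

Lemma low_ba u : supp (@lowR N) u -> u b a = 0.
Proof. by move=> su; apply: su; rewrite /lowR -ltnNge. Qed.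

Lemma lamJ0 u A : unip J u -> supp (@lowR N) u -> supp (strictR J) A ->
  lamJ u A = 0 <-> supp (@lowR N) A.
Proof.
move=> hu su sA; have u0 := low_ba su.
have dE : A b a = 0 -> dtw u A = A.
  by move=> A0; rewrite /dtw A0 u0 !scale0r !subr0.
split=> [/rowP l0|low].
  have A0 : A b a = 0 by have := l0 ord0; rewrite consv0 mxE.
  rewrite -(dE A0); apply/(lamf0 hu sA); apply/rowP => j.
  by have := l0 (lift ord0 j); rewrite consvS => ->; rewrite !mxE.
have A0 := low_ba low; rewrite /lamJ A0.
have -> : lamf u A = 0 by apply/(lamf0 hu sA); rewrite dE.
by apply/esym/consvP => [|j]; rewrite !mxE.
Qed.

(** In its own chart the cell is cut out by the linear condition that u be lower triangular, so
    straight paths realize all tangent vectors. *)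
Lemma conormalI_form : is_conormal I (cell I : set X) lamI.
Proof.
split.
- by move=> u A Y; apply/rowP => j; rewrite !mxE.
- by move=> u x A; apply/rowP => j; rewrite !mxE.
- move=> T Fl FF U B u A Uu BA; apply: cvg_mx => i j.
  by rewrite mxE; under eq_fun do rewrite mxE; exact: cvg_coord.
- by move=> F /(cell_inchart ospI)[].
- move=> F A cF; have [iF lF] := cell_inchart ospI cF; have [hu uF] := ucoordP iF.
  set u := ucoord I F in hu uF lF *; have sth := theta_strict A hu.
  have l0 : lamI u (theta I u A) = 0 <-> supp (@lowR N) (theta I u A).
    split=> [/rowP h|low].
      apply: (asc_low sth) => l c /(proj2 pIP)[j pj].
      by have := h j; rewrite mxE pj [RHS]mxE.
    apply/rowP => j; rewrite mxE [RHS]mxE; apply: (low_asc low (K := I)).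
    by rewrite -surjective_pairing; apply/(proj2 pIP); exists j.
  rewrite l0; split=> [[gamma [g0 gS vg]]|low].
    move=> l c lc; rewrite -g0 in iF.
    have dg := velocity_ucoord ospI vg iF.
    rewrite g0 in dg; apply: (deriv_entry_cst (x := 0) dg).
    by apply: filterS gS => s /(cell_inchart ospI)[_]; exact.
  pose cc (s : R) := u + s *: theta I u A.
  have cc0 : cc 0 = u by rewrite /cc scale0r addr0.
  have [gamma [g0 gk vg]] := ex_velocity ospI hu uF cc0 (is_diff_linear_path _ _)
    (fun s => unip_addr hu (supp_scale s sth)).
  exists gamma; split => //; apply: (nearW (F := nbhs (0 : R))) => s.
  apply: cell_of_kad (gk s) _.
  by apply: supp_add => //; exact: supp_scale.
- move=> F y _; exists (pairs_mx pI y); first exact: pairs_mx_strict pIP _.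
  by apply/rowP => j; rewrite mxE (pairs_mxE _ _ pIP).
Qed.

Lemma is_diff_untw (V : normedModType R) (f df : V -> 'M[R]_N) (x : V) :
  is_diff x f df ->
  is_diff x (fun y => untw a b (f y)) (fun v => dtw (f x) (df v)).
Proof.
move=> fx; apply: is_diff_mx => l c; have fc i j := is_diff_coord i j fx.
have -> : (fun y => untw a b (f y) l c) =
    (fun y => f y l c - (if l == b then f y b a * f y a c else 0)).
  by apply/funext => y; rewrite untwE.
have -> : (fun v => dtw (f x) (df v) l c) = (fun v => df v l c -
    (if l == b then f x b a * df v a c + f x a c * df v b a else 0)).
  by apply/funext => v; rewrite dtwE addrC [df v b a * _]mulrC; case: eqP;
    rewrite 1?addrC // [X in _ - X]addrC.
case: (l == b); last first.
  exact: is_diffB (fc l c) (is_diff_cst (0 : R^o) x).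
exact: is_diffB (fc l c) (is_diffM (fc b a) (fc a c)).
Qed.

Lemma is_diff_psi (V : normedModType R) (f df : V -> 'M[R]_N) (x : V) :
  is_diff x f df -> is_diff x (fun y => psi (f y)) (fun v => lamJ (f x) (df v)).
Proof.
move=> fx; apply: is_diff_mx => i j; rewrite ord1 /psi /lamJ.
have [j' ->|->] := unliftP ord0 j.
  under eq_fun do rewrite consvS mxE; under [X in is_diff _ _ X]eq_fun do rewrite consvS mxE.
  exact: is_diff_coord (is_diff_untw fx).
under eq_fun do rewrite consv0; under [X in is_diff _ _ X]eq_fun do rewrite consv0.
exact: is_diff_coord.
Qed.

(** In the chart of J the cell of I is not linear, but it is parametrized by t and v through
    [twist t v]; tangent vectors are realized by moving t and v affinely. *)
Lemma conormalf_form : is_conormal J [set F : X | cell I F /\ inchart J F] lamf.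
Proof.
split.
- by move=> u A Y; apply/rowP => j; rewrite [RHS]mxE !lamfE dtwD [LHS]mxE.
- by move=> u x A; apply/rowP => j; rewrite [RHS]mxE !lamfE dtwZ [LHS]mxE.
- move=> T Fl FF U B u A Uu BA; apply: cvg_mx => i j.
  by rewrite mxE; under eq_fun do rewrite mxE; apply: cvg_coord; exact: cvg_dtw.
- by move=> F [].
- move=> F A [cF iF]; rewrite tangent_inchart //; have [hu uF] := ucoordP iF.
  have /(cellIP lt_ba lt_Iab J_def ellIJ iF)[t0 lF] := cF.
  set u := ucoord J F in hu uF t0 lF *; have sth := theta_strict A hu.
  rewrite (lamf0 hu sth); split=> [[gamma [g0 gS vg]]|low].
    have cg := velocity_cvg ospJ vg; rewrite g0 in cg.
    have ng := cg _ (near_inchart ospJ iF).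
    have := velocity_ucoord ospJ vg; rewrite g0 => /(_ iF) /is_diff_untw dg.
    move=> l c lc.
    rewrite g0 -/u in dg.
    have dg' : is_diff (0 : R) (fun s => untw a b (ucoord J (gamma s)))
        (fun s => s *: dtw u (theta J u A)).
      suff -> : (fun s : R => s *: dtw u (theta J u A)) =
        (fun s => dtw u (s *: theta J u A)) by exact: dg.
      by apply/funext => s; rewrite dtwZ.
    apply: (deriv_entry_cst (x := 0) dg').
    apply: filterS (filterI gS ng) => s [cs ics].
    by have /(cellIP lt_ba lt_Iab J_def ellIJ ics)[_] := cs; exact.
  pose t := u b a; pose t' := theta J u A b a.
  pose v := untw a b u; pose n := dtw u (theta J u A).
  have hv : unip J v by refine (unip_untw lt_Iab J_def hu).
  have sn : supp (strictR J) n by exact: dtw_strict.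
  (* Its derivative at 0 is [theta J u A], because [n] is the derivative of [untw] in that
     direction; it lies over the cell of I as long as t + s * t' is nonzero. *)
  pose cc (s : R) := twist a b (t + s * t') (v + s *: n).
  have hvs s : unip J (v + s *: n) by apply: unip_addr => //; exact: supp_scale.
  have dcc : is_diff (0 : R) cc (fun s => s *: theta J u A).
    have aff (x y : R) : is_diff (0 : R) (fun s : R => x + s * y) (fun s : R => s * y).
      suff -> : (fun s : R => s * y) = (fun s : R => 0 + s * y).
        exact: is_diffD (is_diff_cst (x : R^o) (0 : R)) (is_diff_Zl (y : R^o) (is_diff_id (0 : R))).
      by apply/funext => s; rewrite add0r.
    have nE l c : n l c = theta J u A l c -
        (if l == b then t' * u a c + t * theta J u A a c else 0) by exact: dtwE.
    have vE l c : v l c = u l c - (if l == b then t * u a c else 0) by exact: untwE.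
    have ab : (a == b) = false by exact: negPf.
    apply: is_diff_mx => l c.
    have -> : (fun s : R => cc s l c) = (fun s : R => (v l c + s * n l c) +
        (if l == b then (t + s * t') * (v a c + s * n a c) else 0)).
      have vnE s i j : (v + s *: n) i j = v i j + s * n i j.
        by rewrite mxE [X in _ + X]mxE.
      by apply/funext => s; rewrite /cc twistE !vnE.
    have -> : (fun s : R => (s *: theta J u A) l c) = (fun s : R => s * n l c +
        (if l == b then (t + 0 * t') * (s * n a c) + (v a c + 0 * n a c) * (s * t') else 0)).
      apply/funext => s; rewrite [LHS]mxE !nE vE ab.
      by case: eqP => _; lra.
    case: (l == b); last first.
      exact: is_diffD (aff _ _) (is_diff_cst (0 : R^o) (0 : R)).
    exact: is_diffD (aff _ _) (is_diffM (aff _ _) (aff _ _)).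
  have cc0 : cc 0 = u by rewrite /cc mul0r addr0 scale0r addr0 /v (untwK lt_ba hu).
  have [gamma [g0 gk vg]] := ex_velocity ospJ hu uF cc0 dcc
    (fun s => unip_twist lt_Iab J_def _ (hvs s)).
  exists gamma; split => //.
  have : \forall s \near (0 : R), t + s * t' != 0.
    apply: (cvgr_neq0 (F := nbhs (0 : R)) t _ t0).
    rewrite -[X in _ --> X]addr0 -[X in _ + X](mul0r t').
    by apply: cvgD; [exact: cvg_cst | apply: cvgMl; exact: cvg_id].
  apply: filterS => s ts; apply: cellI_of_twist ts (hvs s) _ (gk s) => //.
  by apply: supp_add => //; exact: supp_scale.
- move=> F y [_ iF]; have [hu _] := ucoordP iF; set u := ucoord J F in hu *.
  have sY : supp (strictR J) (pairs_mx pJ y).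
    by apply: pairs_mx_strict pJP _; exact: subD1set.
  have Y0 (c : 'I_N) : (c <= a)%N -> pairs_mx pJ y a c = 0.
    move=> ca; apply: (pairs_mx0 _ pJP); rewrite in_setD1 inE /= ltnNge ca.
    by rewrite andbF.
  have Yba : pairs_mx pJ y b a = 0.
    by apply: (pairs_mx0 _ pJP); rewrite in_setD1 eqxx.
  (* The entry (b, a) of this matrix is 0, so [dtw] only subtracts u b a times its row a from its
     row b, which undoes the twist. *)
  exists (twist a b (u b a) (pairs_mx pJ y)).
    move=> l c nlc; rewrite twistE sY //; have [lb|_] := eqVneq l b; last by rewrite addr0.
    rewrite sY ?mulr0 ?addr0 //; move: nlc; rewrite /strictR lb -!leqNgt => cl.
    by rewrite (leq_trans cl) // ltnW.
  apply/rowP => j; rewrite mxE dtwE !twistE eqxx (negPf nab) Yba (Y0 a) // mulr0 addr0 mul0r add0r addr0.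
  by rewrite (pairs_mxE _ _ pJP); case: eqP => _; rewrite ?addrK ?addr0 ?subr0.
Qed.

Lemma conormalJ_form : is_conormal J (cell J : set X) lamJ.
Proof.
have [f1 f2 f3 _ _ _] := conormalf_form.
split.
- move=> u A Y; apply/esym/consvP => [|j].
    by rewrite mxE !consv0 mxE.
  by rewrite [LHS]mxE !consvS f1 [RHS]mxE.
- move=> u x A; apply/esym/consvP => [|j].
    by rewrite mxE !consv0 mxE.
  by rewrite [LHS]mxE !consvS f2 [RHS]mxE.
- move=> T Fl FF U B u A Uu BA; apply: cvg_mx => i j; rewrite ord1.
  have [j' ->|->] := unliftP ord0 j.
    rewrite consvS; under eq_fun do rewrite consvS; apply: cvg_coord; exact: f3.
  by rewrite consv0; under eq_fun do rewrite consv0; exact: cvg_coord.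
- by move=> F /(cell_inchart ospJ)[].
- move=> F A cF; have [iF lF] := cell_inchart ospJ cF; have [hu uF] := ucoordP iF.
  set u := ucoord J F in hu uF lF *; have sth := theta_strict A hu.
  rewrite (lamJ0 hu lF sth); split=> [[gamma [g0 gS vg]]|low].
    move=> l c lc; rewrite -g0 in iF.
    have dg := velocity_ucoord ospJ vg iF; rewrite g0 in dg.
    apply: (deriv_entry_cst (x := 0) dg).
    by apply: filterS gS => s /(cell_inchart ospJ)[_]; exact.
  pose cc (s : R) := u + s *: theta J u A.
  have cc0 : cc 0 = u by rewrite /cc scale0r addr0.
  have [gamma [g0 gk vg]] := ex_velocity ospJ hu uF cc0 (is_diff_linear_path _ _)
    (fun s => unip_addr hu (supp_scale s sth)).
  exists gamma; split => //; apply: (nearW (F := nbhs (0 : R))) => s.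
  apply: cell_of_kad (gk s) _.
  by apply: supp_add => //; exact: supp_scale.
- move=> F y cF; have [iF lF] := cell_inchart ospJ cF; have [hu _] := ucoordP iF.
  set u := ucoord J F in hu lF *; have u0 := low_ba lF.
  pose y' := \row_j y 0 (lift ord0 j); pose Y := pairs_mx pJ y'.
  have sY : supp (strictR J) Y.
    by apply: pairs_mx_strict pJP _; exact: subD1set.
  have Yba : Y b a = 0 by apply: (pairs_mx0 _ pJP); rewrite in_setD1 eqxx.
  (* The added term is the direction of the parameter t: it has the required entry (b, a), and [dtw]
     removes it since u b a = 0. *)
  pose Z := Y + y 0 ord0 *: (delta_mx b a *m u).
  have ZE l c : Z l c = Y l c + (if l == b then y 0 ord0 * u a c else 0).
    by rewrite mxE [X in _ + X]mxE delta_mulmx; case: eqP; rewrite ?mulr0.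
  have Zba : Z b a = y 0 ord0 by rewrite ZE Yba eqxx (hu a a) // eqxx mulr1 add0r.
  exists Z.
    move=> l c nlc; rewrite ZE sY // add0r; have [lb|//] := eqVneq l b.
    move: nlc; rewrite /strictR lb -leqNgt => cl.
    rewrite hu ?(leq_trans cl) 1?ltnW //.
    have [ac|_] := eqVneq a c; last by rewrite mulr0.
    by rewrite -ac leqNgt Jba in cl.
  apply/esym/consvP => [|j]; first by rewrite Zba.
  rewrite lamfE dtwE Zba u0 ZE; have -> : y 0 (lift ord0 j) = Y (pJ j).1 (pJ j).2.
    by rewrite (pairs_mxE _ _ pJP) mxE.
  by case: eqP => _; rewrite ?mul0r ?addr0 ?addrK ?subr0.
Qed.

End ConormalForms.

Section CosignCurve.
Variables (R : realType) (N m : nat) (d : 'I_m -> nat).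
Local Notation X := (flag R N d).
Implicit Types (u A Y : 'M[R]_N) (F G : X) (K : {ffun 'I_N -> 'I_m}).

Lemma cosign_curve K c (S : set X) lam o (U : R -> 'M[R]_N) F G :
  is_osp d K -> @is_conormal R N m d K c S lam -> coorientation S o ->
  (forall s, U s' @[s' --> s] --> U s) ->
  (forall s : R, 0 <= s <= 1 -> unip K (U s) /\ forall H : X, kad K (U s) H -> S H) ->
  kad K (U 0) F -> kad K (U 1) G ->
  cosign K lam o F = cosign K lam o G.
Proof.
move=> oK cf coor cU hU F0 G1.
have /choice[P hP] : forall s : R, exists H : X, 0 <= s <= 1 -> kad K (U s) H.
  move=> s; have [sI|sI] := boolP (0 <= s <= 1); last by exists F.
  by have [hu _] := hU _ sI; have [H ?] := ex_kad oK (unip_unit hu); exists H.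
have -> : F = P 0 by apply: kad_inj F0 _; apply: hP; rewrite lexx ler01.
have -> : G = P 1 by apply: kad_inj G1 _; apply: hP; rewrite lexx ler01.
apply: (cosign_path cf coor (U := U)) => // s sI; have [hu hS] := hU _ sI.
by split=> //; [apply: hS; exact: hP | exact: hP].
Qed.

Lemma unip_segment K u v (s : R) : unip K u -> unip K v -> unip K (u + s *: (v - u)).
Proof. by move=> hu hv l c cl; rewrite !mxE hu // hv // subrr mulr0 addr0. Qed.

Lemma cvg_segment u v (s : R) :
  u + s' *: (v - u) @[s' --> s] --> u + s *: (v - u).
Proof.
apply: (cvg_mxD (F := nbhs s)); first exact: cvg_cst.
by apply: (cvgZ (F := nbhs s)); [exact: cvg_id | exact: cvg_cst].
Qed.

(** The cell is convex in its own chart, so the segment between the two coordinates serves as a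
    path. *)
Lemma cosign_cell K c lam o F G :
  is_osp d K -> @is_conormal R N m d K c (cell K : set X) lam ->
  coorientation (cell K : set X) o -> cell K F -> cell K G ->
  cosign K lam o F = cosign K lam o G.
Proof.
move=> oK cf coor cF cG.
have [iF lF] := cell_inchart oK cF; have [hF kF] := ucoordP iF.
have [iG lG] := cell_inchart oK cG; have [hG kG] := ucoordP iG.
apply: (@cosign_curve K c _ lam o
  (fun s => ucoord K F + s *: (ucoord K G - ucoord K F)) F G oK cf coor).
- by move=> s; exact: cvg_segment.
- move=> s _; split; first exact: unip_segment.
  move=> H /cell_of_kad; apply; apply: supp_add => //; apply: supp_scale.
  by apply: supp_add => //; exact: supp_opp.
- by rewrite scale0r addr0.
- by rewrite scale1r addrC subrK.
Qed.

End CosignCurve.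

(** * The reflection of the coordinate a *)

Section DiagonalSign.
Variables (R : realType) (N m : nat) (d : 'I_m -> nat) (a : 'I_N).
Local Notation X := (flag R N d).
Implicit Types (u A Y : 'M[R]_N) (F G : X) (K : {ffun 'I_N -> 'I_m}).

(* The reflection e_a |-> -e_a preserves every cell and negates the coordinate
   (b, a), so it exchanges the two sides of the cell of J. *)
Definition flipmx A : 'M[R]_N := \matrix_(l, c) (flip a R l * flip a R c * A l c).

Let D : 'M[R]_N := diag_mx (\row_l flip a R l).

Lemma flip_sqr l : flip a R l * flip a R l = 1.
Proof. by rewrite /flip; case: eqP; rewrite ?mulrNN mulr1. Qed.

Lemma flipmxE A : flipmx A = D *m A *m D.
Proof.
apply/matrixP => l c; rewrite mul_mx_diag mxE mul_diag_mx !mxE.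
by rewrite mulrAC.
Qed.

Lemma flip_diag_sqr : D *m D = 1%:M.
Proof.
apply/matrixP => l c; rewrite mul_mx_diag !mxE; case: eqP => [->|_].
  by rewrite mulr1n flip_sqr.
by rewrite mulr0n mul0r.
Qed.

Lemma flip_diag_unit : D \in unitmx.
Proof. by have [] := mulmx1_unit flip_diag_sqr. Qed.

Lemma flipmxM A Y : flipmx (A *m Y) = flipmx A *m flipmx Y.
Proof.
by rewrite !flipmxE !mulmxA -[D *m A *m D *m D]mulmxA flip_diag_sqr mulmx1.
Qed.

Lemma flipmx1 : flipmx 1%:M = 1%:M.
Proof. by rewrite flipmxE mulmx1 flip_diag_sqr. Qed.

Lemma flipmx_unit A : (flipmx A \in unitmx) = (A \in unitmx).
Proof. by rewrite flipmxE !unitmx_mul flip_diag_unit andbT. Qed.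

Lemma flipmx_inv A : A \in unitmx -> invmx (flipmx A) = flipmx (invmx A).
Proof.
move=> uA; have ufA : flipmx A \in unitmx by rewrite flipmx_unit.
by apply: (can_inj (mulKmx ufA)); rewrite mulmxV // -flipmxM mulmxV // flipmx1.
Qed.

Lemma flipmx_unip K u : unip K u -> unip K (flipmx u).
Proof.
move=> hu l c cl; rewrite mxE hu //; case: eqP => [->|_]; last by rewrite mulr0.
by rewrite flip_sqr mulr1.
Qed.

Lemma flipmx_theta K u A : u \in unitmx ->
  theta K (flipmx u) (flipmx A) = flipmx (theta K u A).
Proof.
move=> uu; rewrite /theta flipmx_inv // -2!flipmxM [RHS]flipmxM; congr (_ *m _).
by apply/matrixP => l c; rewrite !mxE; case: ifP => _; rewrite ?mulr0.
Qed.

Definition flip_flag F G := forall i v, v \in G i <-> v *m D \in F i.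

Lemma mul_flip_diag_eq0 (v : 'rV[R]_N) l : (v *m D) 0 l = 0 <-> v 0 l = 0.
Proof.
rewrite mul_mx_diag mxE [X in _ * X]mxE /flip.
by case: eqP => _; rewrite ?mulr1 // mulrN1; split=> [/eqP|->]; rewrite ?oppr0 // oppr_eq0 => /eqP.
Qed.

Lemma flip_flagP K u F G : kad K u F -> kad K (flipmx u) G -> flip_flag F G.
Proof.
move=> [uu uF] [uf fG] i v; rewrite fG uF flipmx_inv // flipmxE.
by split=> h l /h; rewrite !mulmxA => /mul_flip_diag_eq0.
Qed.

Lemma kad_flip K u F G : flip_flag F G -> kad K u F -> kad K (flipmx u) G.
Proof.
move=> FG [uu uF]; split; first by rewrite flipmx_unit.
move=> i v; rewrite FG uF flipmx_inv // flipmxE.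
by split=> h l /h; rewrite !mulmxA => /mul_flip_diag_eq0.
Qed.

Lemma ucoord_flip K F G : inchart K F -> flip_flag F G ->
  inchart K G /\ ucoord K G = flipmx (ucoord K F).
Proof.
move=> iF FG; have [hu uF] := ucoordP iF.
have h1 := flipmx_unip hu; have h2 := kad_flip FG uF.
by split; [exists (flipmx (ucoord K F)) | exact: ucoordE].
Qed.

Lemma ex_flip_flag K F : is_osp d K -> inchart K F -> exists G, flip_flag F G.
Proof.
move=> oK /ucoordP[hu uF].
have [G kG] := ex_kad oK (unip_unit (flipmx_unip hu)).
by exists G; exact: flip_flagP uF kG.
Qed.

End DiagonalSign.

Lemma sign_cancel (e e' mu x y : int) : mu * mu = 1 -> y * y = 1 ->
  e * mu * x = e' * (mu * y) -> e' = e * (x * y).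
Proof.
move=> mu2 y2 E; transitivity (e' * (mu * y) * (mu * y)).
  by rewrite -mulrA [mu * y * _]mulrACA mu2 y2 !mulr1.
by rewrite -E -!mulrA; congr (e * _); rewrite mulrCA; congr (x * _); rewrite mulrA mu2 mul1r.
Qed.

(** * Comparison of the two sides *)

Section Signs.
Variables (R : realType) (N m : nat) (d : 'I_m -> nat).
Local Notation X := (flag R N d).
Implicit Types (u A Y : 'M[R]_N) (F G : X).

Variables (I J : {ffun 'I_N -> 'I_m}) (a b : 'I_N).
Hypotheses (ospI : is_osp d I) (ospJ : is_osp d J).
Hypotheses (lt_ba : (b < a)%N) (lt_Iab : (I a < I b)%N)
  (J_def : J = [ffun x => I (tperm a b x)]) (ellIJ : ell I = (ell J).+1).
Variables (k : nat) (pI pJ : 'I_k -> 'I_N * 'I_N).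
Hypotheses (pIP : enumerates pI (asc I)) (pJP : enumerates pJ (asc J :\ (b, a))).
Variable oI : X -> ('I_k -> 'M[R]_N) -> int.
Hypothesis coorI : coorientation (cell I) oI.

(* The part of the cell of I in the chart of J; it has two components, given by the
   sign of the coordinate (b, a). *)
Definition cellIJ : set X := [set F | cell I F /\ inchart J F].

Lemma coor_cellIJ : coorientation cellIJ oI.
Proof.
have tE F : cellIJ F -> tangent cellIJ F = tangent (cell I : set X) F.
  by move=> [_ iF]; exact: tangent_inchart.
split=> [F FS|F v FS]; first by rewrite tE //; apply: coorI.1; exact: FS.1.
rewrite tE // => qb; have := coorI.2 _ _ FS.1 qb.
by apply: filterS => G H GS; rewrite tE //; apply: H; exact: GS.1.
Qed.

Let cfI := conormalI_form R ospI pIP.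
Let cff := conormalf_form R ospJ lt_ba lt_Iab J_def ellIJ pJP.

Definition epsilon F : int := cosign J (lamf a b pJ) oI F.

(** In the parameters of [twist], t and v move along segments; t keeps its sign and so never
    vanishes, and the path stays in the cell of I. *)
Lemma epsilon_side F G : cellIJ F -> cellIJ G ->
  0 < ucoord J F b a * ucoord J G b a -> epsilon F = epsilon G.
Proof.
move=> FS GS tt; have [cF iF] := FS; have [cG iG] := GS.
have [hF kF] := ucoordP iF; have [hG kG] := ucoordP iG.
have /(cellIP lt_ba lt_Iab J_def ellIJ iF)[tF lF] := cF.
have /(cellIP lt_ba lt_Iab J_def ellIJ iG)[tG lG] := cG.
set uF := ucoord J F in tt hF kF tF lF; set uG := ucoord J G in tt hG kG tG lG.
pose t (s : R) := uF b a + s * (uG b a - uF b a).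
pose v (s : R) := untw a b uF + s *: (untw a b uG - untw a b uF).
have hv s : unip J (v s).
  by apply: unip_segment; exact: unip_untw lt_Iab J_def _ _.
apply: (cosign_curve ospJ cff coor_cellIJ (U := fun s => twist a b (t s) (v s))).
- move=> s; have cv : v s' @[s' --> s] --> v s by exact: cvg_segment.
  apply: (cvg_mxD (F := nbhs s)) => //; apply: (cvgZ (F := nbhs s)).
    apply: (cvgD (F := nbhs s)); first exact: cvg_cst.
    by apply: (cvgMl (F := nbhs s)); exact: cvg_id.
  by apply: (cvg_mulmx (F := nbhs s)) => //; exact: cvg_cst.
- move=> s /andP[s0 s1]; have ht := unip_twist lt_Iab J_def (t s) (hv s).
  split=> // H kH; split; last by exists (twist a b (t s) (v s)).
  apply: (cellI_of_twist lt_ba lt_Iab J_def _ (hv s) _ kH).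
    apply/eqP => t0; have x0 : 0 < uF b a * uF b a by rewrite -expr2 exprn_even_gt0.
    have : (1 - s) * (uF b a * uF b a) + s * (uF b a * uG b a) = 0.
      by rewrite -[RHS](mulr0 (uF b a)) -t0 /t; lra.
    have h2 : 0 <= s * (uF b a * uG b a) by rewrite mulr_ge0 // ltW.
    have [->|sn] := eqVneq s 1; first by lra.
    have h1 : 0 < (1 - s) * (uF b a * uF b a).
      by rewrite mulr_gt0 // subr_gt0 lt_neqAle sn.
    by lra.
  apply: supp_add => //; apply: supp_scale; apply: supp_add => //; exact: supp_opp.
- by rewrite /t /v mul0r addr0 scale0r addr0 (untwK lt_ba hF).
- have E (W : zmodType) (x y : W) : x + (y - x) = y by rewrite addrC subrK.
  by rewrite /t /v mul1r scale1r !E (untwK lt_ba hG).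
Qed.

Lemma lamI_flip u A : lamI pI (flipmx a u) (flipmx a A) =
  lamI pI u A *m diag_mx (\row_j (flip a R (pI j).1 * flip a R (pI j).2)).
Proof. by apply/rowP => j; rewrite mul_mx_diag !mxE mulrC. Qed.

Lemma dtw_flip u A : dtw a b (flipmx a u) (flipmx a A) = flipmx a (dtw a b u A).
Proof.
apply/matrixP => l c; rewrite dtwE [RHS]mxE dtwE !mxE.
have fa : flip a R a = -1 by rewrite /flip eqxx.
have [->|_] := eqVneq l b; last by rewrite !subr0.
rewrite fa; lra.
Qed.

Lemma lamf_flip u A : lamf a b pJ (flipmx a u) (flipmx a A) =
  lamf a b pJ u A *m diag_mx (\row_j (flip a R (pJ j).1 * flip a R (pJ j).2)).
Proof.
by apply/rowP => j; rewrite mul_mx_diag lamfE dtw_flip !mxE mulrC.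
Qed.

Lemma conormal_mx_flip K (lam : 'M[R]_N -> 'M[R]_N -> 'rV[R]_k) (r : 'rV[R]_k) F G v :
  (forall u A, lam (flipmx a u) (flipmx a A) = lam u A *m diag_mx r) ->
  inchart K F -> flip_flag a F G ->
  conormal_mx K lam G (fun i => flipmx a (v i)) = conormal_mx K lam F v *m diag_mx r.
Proof.
move=> lf iF FG; have [iG uG] := ucoord_flip iF FG; have [hu _] := ucoordP iF.
apply/row_matrixP => i; rewrite row_mul !rowK /conormal uG flipmx_theta ?lf //.
exact: unip_unit hu.
Qed.

(** Let F' be the reflection of F; it lies on the side of G. At F the value of [oI] on one tuple is
    measured by both conormal forms, and at F' its value on the reflected tuple. Relative to [lamI]
    the sign of [oI] is the same at F and F' by [cosign_cell], so [epsilon] changes by the product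
    of the determinants with which the reflection acts on the two forms; [exch_parity] evaluates
    it. *)
Lemma epsilon_flip F G : cellIJ F -> cellIJ G ->
  ucoord J F b a * ucoord J G b a < 0 -> epsilon G = epsilon F * (-1) ^+ NI I a b.
Proof.
move=> FS GS tt; have [cF iF] := FS.
have [iFI lFI] := cell_inchart ospI cF.
have [F' FF'] := ex_flip_flag a ospJ iF.
have [iF' uF'] := ucoord_flip iF FF'; have [iFI' uFI'] := ucoord_flip iFI FF'.
have cF' : cell I F'.
  apply/(cell_ucoord ospI iFI'); rewrite uFI' => l c lc.
  by rewrite mxE lFI // mulr0.
have FS' : cellIJ F' by split.
have fa : flip a R a = -1 by rewrite /flip eqxx.
have fb : flip a R b = 1 by rewrite /flip eq_sym (negPf (exch_neq lt_ba)).
have <- : epsilon F' = epsilon G.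
  apply: epsilon_side => //; rewrite uF' mxE fa fb mul1r mulN1r mulNr oppr_gt0 //.
set rI := \row_j (flip a R (pI j).1 * flip a R (pI j).2).
set rJ := \row_j (flip a R (pJ j).1 * flip a R (pJ j).2).
have [v hv] := conormal_basis cfI cF.
have qb : quot_basis (tangent cellIJ F) v.
  rewrite /cellIJ tangent_inchart //; apply/(quot_basis_conormal cfI) => //.
  by rewrite hv unitmx1.
have uM := (quot_basis_conormal cff v FS).1 qb.
have MI' := conormal_mx_flip v lamI_flip iFI FF'.
have MJ' := conormal_mx_flip v lamf_flip iF FF'.
have dI : \det (diag_mx rI) * \det (diag_mx rJ) = (-1) ^+ NI I a b.
  rewrite !det_diag -(exch_parity lt_ba lt_Iab J_def ellIJ R).
  rewrite -(prod_enumerates (fun p => flip a R p.1 * flip a R p.2) pIP).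
  rewrite -(prod_enumerates (fun p => flip a R p.1 * flip a R p.2) pJP).
  by congr (_ * _); apply: eq_bigr => j _; rewrite mxE.
have nz : \det (diag_mx rI) * \det (diag_mx rJ) != 0 by rewrite dI signr_eq0.
have [nzI nzJ] : \det (diag_mx rI) != 0 /\ \det (diag_mx rJ) != 0.
  by move: nz; rewrite mulf_eq0 negb_or => /andP.
have [_ e1] := cosignP cfI coorI cF; have [_ e2] := cosignP cff coor_cellIJ FS.
have [_ e3] := cosignP cfI coorI cF'; have [_ e4] := cosignP cff coor_cellIJ FS'.
have := e1 v; rewrite hv unitmx1 det1 sgz1 mulr1 => /(_ isT) E1.
have := e2 v uM; rewrite E1 -/(epsilon F) => E2.
have := e3 (fun i => flipmx a (v i)); rewrite MI' hv mul1mx unitmxE unitfE nzI.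
rewrite -(cosign_cell ospI cfI coorI cF cF') E2 => /(_ isT) E3.
have := e4 (fun i => flipmx a (v i)); rewrite MJ' unitmx_mul uM unitmxE unitfE nzJ.
rewrite E3 det_mulmx sgzM -/(epsilon F') => /(_ isT).
set mu := sgz (\det (conormal_mx _ _ _ v)).
have mu2 : mu * mu = 1.
  by rewrite /mu -sgzM gtr0_sgz // -expr2 exprn_even_gt0 //= -unitfE -unitmxE.
have sJ2 : sgz (\det (diag_mx rJ)) * sgz (\det (diag_mx rJ)) = 1.
  by rewrite -sgzM gtr0_sgz // -expr2 exprn_even_gt0.
have -> : (-1) ^+ NI I a b = sgz (\det (diag_mx rI)) * sgz (\det (diag_mx rJ)).
  rewrite -sgzM dI -[LHS]signr_odd -[in RHS]signr_odd.
  by case: odd; rewrite ?expr0 ?expr1 ?sgzN sgz1.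
exact: sign_cancel.
Qed.

End Signs.

(** * Slices near b0 *)

Section DiffImage.
Variable R : realType.

Lemma is_diff_bound (V W : normedModType R) (f df : V -> W) (x : V) (e : R) :
  0 < e -> is_diff x f df ->
  \forall y \near x, `|f y - f x - df (y - x)| <= e * `|y - x|.
Proof.
move=> e0 [dfx <-]; have /diff_locallyP[_ /eqaddoP H] := dfx.
have {}H := H e e0; rewrite (near_shift 0); apply: filterS H => y /=.
by rewrite !fctE subr0 /= addrK opprD addrA.
Qed.

(** The curve [xs] is only known to be continuous at 0. A right inverse [Y] of [T] bounds the
    displacement of [xs] by that of [P], so the error of linearizing [p] along it is o(s).
    Multiplying by [Z], which kills the image of [T], leaves s *: (B *m Z) = o(s). *)
Lemma diff_image q n (p : 'rV[R]_q -> 'rV[R]_n) (x0 : 'rV[R]_q) (T : 'M[R]_(q, n))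
    (xs : R -> 'rV[R]_q) (P : R -> 'rV[R]_n) (B : 'rV[R]_n) :
  is_diff x0 p (fun v => v *m T) -> row_free T ->
  xs s @[s --> (0 : R)] --> x0 -> is_diff (0 : R) P (fun s => s *: B) ->
  (\forall s \near (0 : R), p (xs s) = P s) -> p x0 = P 0 ->
  exists v, B = v *m T.
Proof.
move=> dp /row_freeP[Y TY] cx dP pP p0.
pose Z := 1%:M - Y *m T.
have TZ : T *m Z = 0 by rewrite mulmxBr mulmx1 mulmxA TY mul1mx subrr.
suff BZ : B *m Z = 0.
  exists (B *m Y); apply/eqP; rewrite -subr_eq0 -mulmxA -[X in X - _]mulmx1.
  by rewrite -mulmxBr -/Z BZ.
pose C := n%:R * `|Y|; have C0 : 0 <= C by rewrite mulr_ge0.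
pose L := n%:R * `|Z| * (1 + 2 * C * (`|B| + 1)).
have L0 : 0 <= L by rewrite !mulr_ge0 // addr_ge0 // !mulr_ge0 // addr_ge0.
apply/eqP; rewrite -normr_le0; apply/ler_addgt0Pl => e e0; rewrite addr0.
(* The first bound keeps the increment of [P] below (|B| + 1) |s|, the second lets half of |dx| be
   absorbed, and the third brings the total error below e |s|. *)
pose e1 := Num.min 1 (Num.min (2 * (C + 1))^-1 (e / (L + 1))).
have e10 : 0 < e1 by rewrite !lt_min ltr01 invr_gt0 divr_gt0 ?mulr_gt0 ?ltr_pwDr.
have [e1a e1b e1c] : [/\ e1 <= 1, e1 <= (2 * (C + 1))^-1 & e1 <= e / (L + 1)].
  by split; rewrite /e1 !ge_min lexx ?orbT.
have n1 : \forall s \near (0 : R), `|p (xs s) - p x0 - (xs s - x0) *m T| <= e1 * `|xs s - x0|.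
  exact: cx _ (is_diff_bound e10 dp).
have n2 := is_diff_bound e10 dP.
have : \forall s \near (0 : R)^', `|B *m Z| <= e.
  near=> s.
  have s0 : s != 0 by near: s; exact: nbhs_dnbhs_neq.
  have h1 : `|p (xs s) - p x0 - (xs s - x0) *m T| <= e1 * `|xs s - x0|.
    by near: s; exact: nbhs_dnbhs.
  have h2 : `|P s - P 0 - (s - 0) *: B| <= e1 * `|s - 0|.
    by near: s; exact: nbhs_dnbhs.
  have h3 : p (xs s) = P s by near: s; exact: nbhs_dnbhs.
  rewrite subr0 in h2; rewrite h3 p0 in h1.
  set r2 := P s - P 0 - s *: B in h2.
  set dx := xs s - x0 in h1; set r1 := P s - P 0 - dx *m T in h1.
  have PB : `|P s - P 0| <= (`|B| + 1) * `|s|.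
    have -> : P s - P 0 = s *: B + r2 by rewrite /r2 [RHS]addrC subrK.
    rewrite (le_trans (ler_normD _ _)) // normrZ mulrDl mul1r mulrC lerD2l.
    by rewrite (le_trans h2) // ler_piMl.
  have dxle : `|dx| <= 2 * C * `|P s - P 0|.
    have E : dx = (P s - P 0) *m Y - r1 *m Y.
      by rewrite -mulmxBl /r1 subKr -mulmxA TY mulmx1.
    have E1 : `|(P s - P 0) *m Y| <= C * `|P s - P 0|.
      by rewrite (le_trans (norm_mulmx_le _ _)) // /C -mulrA [`|Y| * _]mulrC.
    have E2 : `|r1 *m Y| <= `|dx| / 2.
      rewrite (le_trans (norm_mulmx_le _ _)) //.
      have -> : n%:R * (`|r1| * `|Y|) = C * `|r1| by rewrite /C -mulrA [`|Y| * _]mulrC.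
      apply: le_trans (_ : C * (e1 * `|dx|) <= _); first by rewrite ler_wpM2l.
      rewrite mulrA [leRHS]mulrC ler_wpM2r //.
      apply: le_trans (_ : C * (2 * (C + 1))^-1 <= _); first by rewrite ler_wpM2l.
      rewrite invfM mulrCA ler_piMr // ler_pdivrMr ?ltr_pwDr // mul1r lerDl //.
    have := ler_normB ((P s - P 0) *m Y) (r1 *m Y); rewrite -E.
    by rewrite -mulrA; lra.
  have sB : s *: (B *m Z) = r1 *m Z - r2 *m Z.
    rewrite -mulmxBl /r1 /r2 opprB addrA; rewrite scalemxAl.
    have -> : P s - P 0 - dx *m T + s *: B - (P s - P 0) = s *: B - dx *m T.
      by rewrite addrAC addrC; set w := P s - P 0; rewrite addrAC subrr sub0r.
    by rewrite mulmxBl -mulmxA TZ mulmx0 subr0.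
  have s_gt0 : 0 < `|s| by rewrite normr_gt0.
  rewrite -(ler_pM2l s_gt0) -normrZ sB.
  rewrite (le_trans (ler_normB _ _)) //.
  have E1 : `|r1 *m Z| <= n%:R * `|Z| * (e1 * (2 * C * (`|B| + 1)) * `|s|).
    rewrite (le_trans (norm_mulmx_le _ _)) // mulrA mulrAC ler_wpM2l ?mulr_ge0 //.
    rewrite (le_trans h1) // -mulrA ler_wpM2l ?(ltW e10) //.
    by apply: le_trans dxle _; rewrite -[leRHS]mulrA; apply: ler_wpM2l PB; rewrite mulr_ge0.
  have E2 : `|r2 *m Z| <= n%:R * `|Z| * (e1 * `|s|).
    by rewrite (le_trans (norm_mulmx_le _ _)) // -mulrA ler_wpM2l // mulrC ler_wpM2l.
  apply: le_trans (lerD E1 E2) _.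
  have -> : n%:R * `|Z| * (e1 * (2 * C * (`|B| + 1)) * `|s|) + n%:R * `|Z| * (e1 * `|s|)
    = `|s| * (e1 * L) by rewrite /L; ring.
  rewrite ler_pM2l //; apply: le_trans (_ : e / (L + 1) * L <= _).
    by rewrite ler_wpM2r.
  by rewrite mulrAC ler_pdivrMr ?ltr_pwDr // ler_pM2l // lerDl.
by move=> /filter_ex[s].
Unshelve. all: by end_near. Qed.

End DiffImage.

Section Charts.
Variables (R : realType) (N m : nat) (d : 'I_m -> nat).
Local Notation X := (flag R N d).
Implicit Types (u A Y : 'M[R]_N) (F G : X) (K : {ffun 'I_N -> 'I_m}).
Variables (q : nat) (D : set X) (U : set 'rV[R]_q) (phi : 'rV[R]_q -> X)
  (g : 'rV[R]_q -> 'M[R]_N).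
Hypothesis ch : chart D U phi g.

Lemma chart_open : open U. Proof. by case: ch => -[]. Qed.
Lemma chart_nbhs x : U x -> nbhs x U.
Proof. by move=> Ux; apply: open_nbhs_nbhs; split => //; exact: chart_open. Qed.
Lemma chart_adapted x : U x -> adapted (g x) (phi x). Proof. by case: ch => -[_ + _ _ _ _]; apply. Qed.

Lemma chart_near_adapted x : U x -> \forall y \near x, adapted (g y) (phi y).
Proof. by move=> Ux; apply: filterS (chart_nbhs Ux) => y; exact: chart_adapted. Qed.

Lemma chart_diff x : U x -> differentiable g x.
Proof. by case: ch => -[_ _ sm _] _ _ Ux; have [h _] := sm 1%N; exact: h. Qed.

Lemma chart_cvg_diff x v : U x -> 'd g y v @[y --> x] --> 'd g x v.
Proof. by case: ch => -[_ _ sm _] _ _ Ux; have [_ h] := sm 1%N; exact: (h v x Ux). Qed.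

Lemma chart_mem x : U x -> D (phi x).
Proof.
case: ch => _ _ op Ux; have [W _ WE] := op U chart_open (@subset_refl _ U).
have : (phi @` U) (phi x) by exists x.
by rewrite WE => -[].
Qed.

Lemma chart_cvg K x : is_osp d K -> U x -> phi y @[y --> x] --> phi x.
Proof.
move=> oK Ux; apply: (velocity_adapted_cvg oK _ (chart_near_adapted Ux)).
by apply: differentiable_continuous; exact: chart_diff.
Qed.

(** Continuity at phi x of the inverse of phi, as a map defined on D near phi x. *)
Lemma chart_near (V : set 'rV[R]_q) x : U x -> nbhs x V ->
  \forall G \near phi x, D G -> exists y, [/\ U y, V y & phi y = G].
Proof.
move=> Ux nV; case: ch => _ _ op.
have [W oW WE] := op (V° `&` U) (openI (open_interior V) chart_open) (@subIsetr _ _ _).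
have : (phi @` (V° `&` U)) (phi x) by exists x.
rewrite WE => -[Wx _]; apply: filterS (open_nbhs_nbhs (conj oW Wx)) => G WG DG.
have : (W `&` D) G by [].
by rewrite -WE => -[y [Vy Uy] <-]; exists y; split => //; exact: interior_subset.
Qed.

Lemma lift_deriv_rV x (v : 'rV[R]_q) :
  lift_deriv g x v = \sum_i v 0 i *: lift_deriv g x (row i 1%:M).
Proof.
rewrite /lift_deriv {1}(row_sum_delta v) linear_sum mulmx_sumr; apply: eq_bigr => i _.
by rewrite linearZ /= scalemxAr rowE mulmx1.
Qed.

Lemma cvg_lift_deriv x v : U x -> lift_deriv g y v @[y --> x] --> lift_deriv g x v.
Proof.
move=> Ux; apply: (cvg_mulmx (F := nbhs x)); last exact: chart_cvg_diff.
have [ug _] := chart_adapted Ux; apply: (cvg_invmx (F := nbhs x)) ug.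
by apply: differentiable_continuous; exact: chart_diff.
Qed.

(* A curve in D lifts to the chart, because phi is a homeomorphism onto an open part
   of D, and its lift is differentiable, because phi is an immersion. *)
Lemma tangent_chart K x A : is_osp d K -> U x -> inchart K (phi x) ->
  tangent D (phi x) A -> exists v,
    theta K (ucoord K (phi x)) A = theta K (ucoord K (phi x)) (lift_deriv g x v).
Proof.
move=> oK Ux iF [gamma [g0 gD vg]].
have [hu uF] := ucoordP iF; set u := ucoord K (phi x) in hu uF *.
pose L v := theta K u (lift_deriv g x v).
pose T : 'M[R]_(q, N * N) := \matrix_i mxvec (L (row i 1%:M)).
have TE v : mxvec (L v) = v *m T.
  rewrite mulmx_sum_row /L lift_deriv_rV.
  have lin (r : seq 'I_q) : mxvec (theta K u (\sum_(i <- r) v 0 i *: lift_deriv g x (row i 1%:M))) =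
      \sum_(i <- r) v 0 i *: row i T.
    elim: r => [|i r IH].
      by rewrite !big_nil -(scale0r 0) thetaZ scale0r linear0.
    by rewrite !big_cons thetaD thetaZ linearD linearZ /= IH rowK.
  exact: lin.
have rfT : row_free T.
  rewrite -kermx_eq0; apply/rowV0P => v /sub_kermxP; rewrite -TE => Lv.
  have : L v = 0 by apply: (can_inj mxvecK); rewrite Lv linear0.
  move=> /(theta_eq0 _ hu uF) sv.
  by case: ch => -[_ _ _ imm] _ _; exact: imm sv.
have is_diff_mxvec (W : normedModType R) (f df : W -> 'M[R]_N) w :
    is_diff w f df -> is_diff w (fun y => mxvec (f y)) (fun v => mxvec (df v)).
  move=> fw; apply: is_diff_mx => i j; rewrite ord1; case/mxvec_indexP: j => j1 j2.
  under eq_fun do rewrite mxvecE; under [X in is_diff _ _ X]eq_fun do rewrite mxvecE.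
  exact: is_diff_coord.
have du := is_diff_ucoord oK (chart_diff Ux) (chart_near_adapted Ux) iF.
have dp : is_diff x (fun y => mxvec (ucoord K (phi y))) (fun v => v *m T).
  suff -> : (fun v => v *m T) = (fun v => mxvec (L v)) by exact: is_diff_mxvec.
  by apply/funext => v; rewrite TE.
have iF0 : inchart K (gamma 0) by rewrite g0.
have dP : is_diff (0 : R) (fun s => mxvec (ucoord K (gamma s)))
    (fun s => s *: mxvec (theta K u A)).
  have := is_diff_mxvec _ _ _ _ (velocity_ucoord oK vg iF0); rewrite g0.
  suff -> : (fun s : R => s *: mxvec (theta K u A)) =
    (fun s : R => mxvec (s *: theta K u A)) by [].
  by apply/funext => s; rewrite linearZ.
have cg := velocity_cvg oK vg; rewrite g0 in cg.
have /choice[xs hxs] : forall s : R, exists y, D (gamma s) /\ (exists2 z, U z & phi z = gamma s) ->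
    U y /\ phi y = gamma s.
  move=> s; have [[_ [z Uz zE]]|n] := pselect (D (gamma s) /\ exists2 z, U z & phi z = gamma s).
    by exists z.
  by exists 0.
have near_xs (V : set 'rV[R]_q) : nbhs x V ->
    \forall s \near (0 : R), [/\ U (xs s), V (xs s) & phi (xs s) = gamma s].
  move=> nV; apply: filterS (filterI gD (cg _ (chart_near Ux nV))) => s [Ds /(_ Ds)].
  move=> [y [Uy Vy yE]]; have [Uxs xsE] : U (xs s) /\ phi (xs s) = gamma s.
    by apply: hxs; split => //; exists y.
  split => //; suff -> : xs s = y by [].
  by case: ch => _ inj _; apply: inj; rewrite ?inE // xsE yE.
have [||| v Bv] := diff_image dp rfT (xs := xs) _ dP.
- by move=> V /near_xs; apply: filterS => s [].
- by apply: filterS (near_xs _ (filterT : nbhs x setT)) => s [_ _ ->].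
- by rewrite g0.
by exists v; apply: (can_inj mxvecK); rewrite Bv -TE.
Qed.

End Charts.

Lemma sgz_mul_gt0 (R : realDomainType) (y z : R) : 0 < y * z -> sgz y = sgz z.
Proof.
move=> yz; have [zp|zn|zz] := ltrgt0P z; last by rewrite zz mulr0 ltxx in yz.
  by rewrite !gtr0_sgz //; rewrite pmulr_lgt0 // in yz.
by rewrite !ltr0_sgz //; rewrite nmulr_lgt0 // in yz.
Qed.

Section SliceChart.
Variables (R : realType) (N m : nat) (d : 'I_m -> nat).
Local Notation X := (flag R N d).
Implicit Types (u A Y : 'M[R]_N) (F G : X).

Variables (I J : {ffun 'I_N -> 'I_m}) (a b : 'I_N).
Hypotheses (ospI : is_osp d I) (ospJ : is_osp d J).
Hypotheses (lt_ba : (b < a)%N) (lt_Iab : (I a < I b)%N)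
  (J_def : J = [ffun x => I (tperm a b x)]) (ellIJ : ell I = (ell J).+1).
Variables (k : nat) (pJ : 'I_k -> 'I_N * 'I_N).
Hypothesis (pJP : enumerates pJ (asc J :\ (b, a))).

Let cfJ := conormalJ_form R ospJ lt_ba lt_Iab J_def ellIJ pJP.
Let Jba : (J b < J a)%N. Proof. by rewrite (exch_a J_def) (exch_b J_def). Qed.

Definition Psi F : 'rV[R]_k.+1 := psi a b pJ (ucoord J F).

Lemma Psi0 F : Psi F 0 ord0 = ucoord J F b a. Proof. exact: consv0. Qed.

Lemma untw_lowP F : inchart J F ->
  supp (@lowR N) (untw a b (ucoord J F)) <-> forall j, Psi F 0 (lift ord0 j) = 0.
Proof.
move=> iF; have [hu uF] := ucoordP iF; set u := ucoord J F in hu uF *.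
have hv : unip J (untw a b u) := unip_untw lt_Iab J_def hu.
have PE j : Psi F 0 (lift ord0 j) = untw a b u (pJ j).1 (pJ j).2.
  by rewrite /Psi /psi consvS mxE.
split=> [low j|h l c].
  rewrite PE; apply: (low_asc low (K := J)); rewrite -surjective_pairing.
  have : pJ j \in asc J :\ (b, a) by apply/(proj2 pJP); exists j.
  by rewrite in_setD1 => /andP[].
rewrite /lowR -ltnNge => lc.
have [Jlc|n] := ltnP (J l) (J c); last first.
  by rewrite hv //; case: eqP => // E; rewrite E ltnn in lc.
have [[-> ->]|n] := eqVneq (l, c) (b, a); first exact: untw_ba hu.
have /(proj2 pJP)[j pj] : (l, c) \in asc J :\ (b, a) by rewrite in_setD1 n inE lc.
by have := h j; rewrite PE pj.
Qed.

Lemma cellI_Psi F : inchart J F ->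
  cell I F <-> Psi F 0 ord0 != 0 /\ forall j, Psi F 0 (lift ord0 j) = 0.
Proof.
by move=> iF; rewrite (cellIP lt_ba lt_Iab J_def ellIJ iF) Psi0 (untw_lowP iF).
Qed.

Lemma cellJ_Psi F : inchart J F -> cell J F <-> Psi F = 0.
Proof.
move=> iF; have [hu uF] := ucoordP iF; rewrite (cell_ucoord ospJ iF).
have uE : ucoord J F b a = 0 -> untw a b (ucoord J F) = ucoord J F.
  by move=> u0; rewrite /untw u0 scale0r subr0.
split=> [low|P0].
  have u0 := low_ba lt_ba low.
  have /(untw_lowP iF) h : supp (@lowR N) (untw a b (ucoord J F)) by rewrite uE.
  apply/rowP => j; rewrite [RHS]mxE; have [j' ->|->] := unliftP ord0 j; first exact: h.
  by rewrite Psi0.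
have u0 : ucoord J F b a = 0 by rewrite -Psi0 P0 mxE.
by rewrite -(uE u0); apply/(untw_lowP iF) => j; rewrite P0 mxE.
Qed.

Lemma Psi_cvg F : inchart J F -> Psi G @[G --> F] --> Psi F.
Proof.
move=> iF; have cu := ucoord_continuous ospJ iF.
apply: (cvg_mx (F := nbhs F)) => i j; rewrite ord1 /Psi /psi.
have [j' ->|->] := unliftP ord0 j; last first.
  by rewrite consv0; under eq_fun do rewrite consv0; exact: (cvg_coord (F := nbhs F)).
rewrite consvS mxE; under eq_fun do rewrite consvS mxE.
apply: (cvg_coord (F := nbhs F)); apply: (cvg_mxB (F := nbhs F)) => //.
apply: (cvgZ (F := nbhs F)); first exact: (cvg_coord (F := nbhs F)).
by apply: (cvg_mulmx (F := nbhs F)) => //; exact: cvg_cst.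
Qed.

Variables (D : set X) (U : set 'rV[R]_k.+1) (phi : 'rV[R]_k.+1 -> X)
  (g : 'rV[R]_k.+1 -> 'M[R]_N) (x0 : 'rV[R]_k.+1).
Hypotheses (ch : chart D U phi g) (Ux0 : U x0) (cb0 : cell J (phi x0))
  (trJ : transverse D (cell J)).

(** By [is_diff_Psi], the Jacobian matrix of Psi in the chart. In this form its determinant at b0
    also measures [oJ] on the coordinate basis. *)
Definition jac x : 'M[R]_k.+1 :=
  conormal_mx J (lamJ a b pJ) (phi x) (fun i => lift_deriv g x (row i 1%:M)).

Let ib0 : inchart J (phi x0). Proof. by have [] := cell_inchart ospJ cb0. Qed.

Lemma conormal_lift x v : conormal J (lamJ a b pJ) (phi x) (lift_deriv g x v) = v *m jac x.
Proof. by rewrite (lift_deriv_rV g x v) (conormal_comb cfJ). Qed.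

Lemma is_diff_Psi x : U x -> inchart J (phi x) ->
  is_diff x (fun y => Psi (phi y)) (fun v => v *m jac x).
Proof.
move=> Ux ix.
have du := is_diff_ucoord ospJ (chart_diff ch Ux) (chart_near_adapted ch Ux) ix.
suff -> : (fun v => v *m jac x) = (fun v => lamJ a b pJ (ucoord J (phi x))
    (theta J (ucoord J (phi x)) (lift_deriv g x v))).
  exact: is_diff_psi du.
by apply/funext => v; rewrite -conormal_lift.
Qed.

Lemma jac_cvg : jac x @[x --> x0] --> jac x0.
Proof.
have cu : ucoord J (phi x) @[x --> x0] --> ucoord J (phi x0).
  apply: cvg_comp (ucoord_continuous ospJ ib0); exact: chart_cvg ch _ _ ospJ Ux0.
apply: (cvg_mx (F := nbhs x0)) => i j.
rewrite [X in _ --> X]mxE; under eq_fun do rewrite mxE; apply: (cvg_coord (F := nbhs x0)).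
apply: (conormal_cvg cfJ) => //; apply: (cvg_theta (Fl := nbhs x0)) => //.
  exact: cvg_lift_deriv ch _ _ Ux0.
by have [hu _] := ucoordP ib0; exact: unip_unit hu.
Qed.

(** Transversality: the conormal form is onto and kills the tangent space of the cell, so its
    restriction to T D is onto already, and T D has dimension k + 1. Concretely, a relation w
    between the columns of the Jacobian annihilates every value of the form. *)
Lemma jac_unit : jac x0 \in unitmx.
Proof.
rewrite -unitmx_tr; apply: unitmx_inj => w wM.
have Mw : jac x0 *m w^T = 0 by rewrite -[jac x0]trmxK -trmx_mul wM trmx0.
suff yw y : y *m w^T = 0 :> 'M[R]_1.
  apply/rowP => j; have /matrixP/(_ 0 0) := yw (row j 1%:M).
  by rewrite -row_mul mul1mx !mxE.
have [A <-] := conormal_surj cfJ y cb0.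
have [B [C [tB tC ->]]] := trJ (chart_mem ch Ux0) cb0 A.
rewrite (conormalD cfJ) [X in _ + X](_ : _ = 0); last first.
  by apply/(conormal_tangent cfJ _ cb0).
have [v vE] := tangent_chart ch ospJ Ux0 ib0 tB.
by rewrite addr0 /conormal vE -/(conormal _ _ _ _) conormal_lift -mulmxA Mw mulmx0.
Qed.

Lemma near_jac : \forall x \near x0, [/\ U x, inchart J (phi x) &
  sgz (\det (jac x)) = sgz (\det (jac x0))].
Proof.
have n1 := chart_nbhs ch Ux0.
have n2 : \forall x \near x0, inchart J (phi x).
  exact: (chart_cvg ch ospJ Ux0 (near_inchart ospJ ib0)).
have d0 : \det (jac x0) != 0 by rewrite -unitfE -unitmxE jac_unit.
have cd : \det (jac x) * \det (jac x0) @[x --> x0] --> \det (jac x0) * \det (jac x0).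
  apply: (cvgM (F := nbhs x0)); last exact: cvg_cst.
  by apply: (cvg_det (F := nbhs x0)); exact: jac_cvg.
have n3 : \forall x \near x0, 0 < \det (jac x) * \det (jac x0).
  by apply: (cvgr_gt (F := nbhs x0)) cd _ _; rewrite -expr2 exprn_even_gt0.
near=> x; have dx : 0 < \det (jac x) * \det (jac x0) by near: x; exact: n3.
have ix : inchart J (phi x) by near: x; exact: n2.
have Ux : U x by near: x; exact: n1.
split; [exact: Ux | exact: ix |].
exact: sgz_mul_gt0 dx.
Unshelve. all: by end_near. Qed.

(* D is a graph over the coordinates Psi near b0. *)
Lemma Psi_local : exists2 W : set X, nbhs (phi x0) W &
  (forall G G', D G -> D G' -> W G -> W G' -> Psi G = Psi G' -> G = G') /\
  forall V : set X, nbhs (phi x0) V -> exists2 e : R, 0 < e &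
    forall y, `|y| < e -> exists G, [/\ D G, V G & Psi G = y].
Proof.
have dfx : \forall x \near x0, is_diff x (fun y => Psi (phi y)) (fun v => v *m jac x).
  by apply: filterS near_jac => x [Ux ix _]; exact: is_diff_Psi.
have [r r0 [inj surj]] := local_diffeo dfx jac_cvg jac_unit.
have Psib0 : Psi (phi x0) = 0 by apply/(cellJ_Psi ib0).
exists [set G | D G -> exists y, [/\ U y, `|y - x0| < r & phi y = G]].
  apply: (chart_near ch Ux0 (V := [set y | `|y - x0| < r])).
  by apply/nbhs_ballP; exists r => // y; rewrite -ball_normE /= distrC.
split=> [G G' DG DG' /(_ DG)[y [Uy yr <-]] /(_ DG')[y' [Uy' y'r <-]] E|V nV].
  by rewrite (inj _ _ yr y'r E).
have nV' : nbhs x0 [set x | U x /\ V (phi x)].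
  by apply: filterI; [exact: chart_nbhs ch _ Ux0 | exact: (chart_cvg ch ospJ Ux0 nV)].
have /nbhs_ballP[e /= e0 he] := nV'.
have [dl dl0 hd] := surj e e0; exists dl => // y yd.
have [|x xe xy] := hd y; first by rewrite Psib0 subr0.
have [Ux Vx] : U x /\ V (phi x) by apply: he; rewrite -ball_normE /= distrC.
by exists (phi x); split => //; exact: chart_mem ch _ Ux.
Qed.

End SliceChart.

Section RealCurves.
Variables (R : realType) (f : R -> R) (eta : R).
Hypothesis eta0 : 0 < eta.
Hypothesis fc : forall t, 0 < t < eta -> {for t, continuous f}.

Lemma within_itv_continuous (s t : R) : 0 < s -> t < eta -> {within `[s, t], continuous f}.
Proof.
move=> s0 te; apply: continuous_in_subspaceT => x /[!inE].
rewrite /= in_itv /= => /andP[sx xt]; apply: fc.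
by rewrite (lt_le_trans s0 sx) (le_lt_trans xt te).
Qed.

Lemma ivt_itv (s t y : R) : 0 < s -> s <= t -> t < eta ->
  Num.min (f s) (f t) <= y <= Num.max (f s) (f t) -> exists2 c, s <= c <= t & f c = y.
Proof.
move=> s0 st te yI; have [c cI <-] := IVT st (within_itv_continuous s0 te) yI.
by exists c => //; move: cI; rewrite in_itv.
Qed.

Lemma const_sign : (forall t, 0 < t < eta -> f t != 0) ->
  exists s : R, (s = 1 \/ s = -1) /\ forall t, 0 < t < eta -> 0 < s * f t.
Proof.
move=> fn0; have h0 : 0 < eta / 2 < eta by rewrite divr_gt0 //= gtr_pMr // invf_lt1 // ltr1n.
have same (s t : R) : 0 < s < eta -> 0 < t < eta -> s <= t -> 0 < f s * f t.
  move=> /andP[s0 se] /andP[t0 te] st; rewrite ltNge; apply/negP => n.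
  have [|c /andP[sc ct] fc0] := @ivt_itv s t 0 s0 st te.
    rewrite ge_min le_max.
    have [fs|fs|fs] := ltrgt0P (f s); last by have := fn0 s; rewrite s0 se fs eqxx => /(_ isT).
      have [ft|ft|ft] := ltrgt0P (f t); last by have := fn0 t; rewrite t0 te ft eqxx => /(_ isT).
        by move: n; rewrite leNgt mulr_gt0.
      by [].
    have [ft|ft|ft] := ltrgt0P (f t); last by have := fn0 t; rewrite t0 te ft eqxx => /(_ isT).
      by [].
    by move: n; rewrite leNgt nmulr_rgt0 // ft.
  by have := fn0 c; rewrite fc0 eqxx (lt_le_trans s0 sc) (le_lt_trans ct te) => /(_ isT).
have same2 t : 0 < t < eta -> 0 < f (eta / 2) * f t.
  move=> tI; have [h|h] := leP t (eta / 2); last by apply: same => //; exact: ltW.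
  by rewrite mulrC; apply: same.
have [fp|fn|z] := ltrgt0P (f (eta / 2)).
- exists 1; split; first by left.
  by move=> t /same2; rewrite pmulr_rgt0 // mul1r.
- exists (-1); split; first by right.
  by move=> t /same2; rewrite nmulr_rgt0 // mulN1r oppr_gt0.
- by have := fn0 _ h0; rewrite z eqxx.
Qed.

Hypothesis f0 : f t @[t --> 0^'+] --> 0.
Hypothesis fpos : forall t, 0 < t < eta -> 0 < f t.

Lemma near_small (y : R) : 0 < y -> forall t1, 0 < t1 ->
  exists t, [/\ 0 < t, t < t1 & f t < y].
Proof.
move=> y0 t1 t10.
have n : \forall t \near 0^'+, f t < y by apply: (cvgr_lt (F := 0^'+)) f0 _ y0.
have [t [t0 [tt ft]]] : exists t, 0 < t /\ t < t1 /\ f t < y.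
  near (0:R)^'+ => t; exists t; split; first by near: t; exact: nbhs_right_gt.
  by split; [near: t; exact: nbhs_right_lt | near: t].
by exists t.
Unshelve. all: by end_near. Qed.

(** Intermediate values between eta / 2 and a parameter so small that f is already below y. *)
Lemma covers_small : exists2 dl : R, 0 < dl &
  forall y, 0 < y < dl -> exists2 t, 0 < t < eta & f t = y.
Proof.
have h0 : 0 < eta / 2 < eta by rewrite divr_gt0 //= gtr_pMr // invf_lt1 // ltr1n.
exists (f (eta / 2)); first exact: fpos.
move=> y /andP[y0 yf]; have [t [t0 tt ft]] := near_small y0 (proj1 (andP h0)).
have [|c /andP[c1 c2] <-] := @ivt_itv t (eta / 2) y t0 (ltW tt) (proj2 (andP h0)).
  by rewrite ge_min le_max (ltW ft) (ltW yf) orbT.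
by exists c => //; rewrite (lt_le_trans t0 c1) (le_lt_trans c2) //; have /andP[] := h0.
Qed.

(** Since f is positive and tends to 0, it takes a smaller value before any given parameter, and the
    mean value theorem applies between the two. Monotonicity of f near 0 is not assumed: one such
    parameter is enough to read the sign of a contribution. *)
Lemma ex_increasing (P : R -> Prop) : (forall t, 0 < t < eta -> derivable f t 1) ->
  (\forall t \near 0^'+, P t) -> exists t, [/\ P t, 0 < t < eta & 0 < 'D_1 f t].
Proof.
move=> fd nP; have [e e0 eP] : exists2 e, 0 < e & forall t, 0 < t < e -> P t.
  move: nP => [e /= e0 he]; exists e => // t /andP[t0 te]; apply: he => //=.
  by rewrite sub0r normrN gtr0_norm.
pose t1 := Num.min e eta / 2.
have me0 : 0 < Num.min e eta by rewrite lt_min e0.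
have t10 : 0 < t1 by rewrite divr_gt0.
have t1e : t1 < Num.min e eta by rewrite /t1; lra.
have [t1e1 t1e2] : t1 < e /\ t1 < eta by move: t1e; rewrite lt_min => /andP.
have t1I : 0 < t1 < eta by rewrite t10.
have [t2 [t20 t21 ft2]] := near_small (fpos t1I) t10.
have [t tI ft] := @MVT R f (fun t => 'D_1 f t) t2 t1 t21
  (fun t tI => derivableP (fd t ltac:(move: tI; rewrite in_itv /= => /andP[h1 h2];
     by rewrite (lt_trans t20 h1) (lt_trans h2 t1e2)))) (within_itv_continuous t20 t1e2).
move: tI; rewrite in_itv /= => /andP[h1 h2]; exists t; split.
- by apply: eP; rewrite (lt_trans t20 h1) (lt_trans h2).
- by rewrite (lt_trans t20 h1) (lt_trans h2).
- by rewrite -(pmulr_lgt0 _ (_ : 0 < t1 - t2)) ?subr_gt0 // -ft subr_gt0.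
Qed.

End RealCurves.

Lemma near_right_ex (R : realType) (P : R -> Prop) :
  (\forall t \near 0^'+, P t) -> exists2 e, 0 < e & forall t, 0 < t < e -> P t.
Proof.
move=> [e /= e0 he]; exists e => // t /andP[t0 te]; apply: he => //=.
by rewrite sub0r normrN gtr0_norm.
Qed.

Lemma sgz_sqr (R : realDomainType) (y : R) : y != 0 -> sgz y * sgz y = 1.
Proof. by move=> y0; rewrite -sgzM gtr0_sgz // -expr2 exprn_even_gt0. Qed.

Lemma sign_product (e sB sM sW sc : int) : sW * sW = 1 -> sM * sM = 1 ->
  sB * sM = - sc * sW -> sB * (e * sW) = - sc * e * sM.
Proof.
move=> W2 M2 E; transitivity (sB * (sM * sM) * (e * sW)); first by rewrite M2 mulr1.
rewrite [sB * (sM * sM)]mulrA E; transitivity (- sc * e * sM * (sW * sW)); last by rewrite W2 mulr1.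
ring.
Qed.

Lemma sign_quotient (e s eps om sM : int) : sM * sM = 1 -> om * om = 1 ->
  e * (om * sM) = - s * eps * sM -> e = - s * eps * om.
Proof.
move=> M2 o2 E; transitivity (e * (om * sM) * sM * om); last first.
  by rewrite E; transitivity (- s * eps * om * (sM * sM)); [ring | rewrite M2 mulr1].
by transitivity (e * (om * om) * (sM * sM)); [rewrite M2 o2 !mulr1 | ring].
Qed.

(** * The contribution of a single arc *)

Section Contribution.
Variables (R : realType) (N m : nat) (d : 'I_m -> nat).
Local Notation X := (flag R N d).
Implicit Types (u A Y : 'M[R]_N) (F G : X).

Variables (I J : {ffun 'I_N -> 'I_m}) (a b : 'I_N).
Hypotheses (ospI : is_osp d I) (ospJ : is_osp d J).
Hypotheses (lt_ba : (b < a)%N) (lt_Iab : (I a < I b)%N)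
  (J_def : J = [ffun x => I (tperm a b x)]) (ellIJ : ell I = (ell J).+1).
Variables (k : nat) (pJ : 'I_k -> 'I_N * 'I_N).
Hypothesis (pJP : enumerates pJ (asc J :\ (b, a))).
Variables (oI : X -> ('I_k -> 'M[R]_N) -> int) (oJ : X -> ('I_k.+1 -> 'M[R]_N) -> int).
Hypotheses (coorI : coorientation (cell I) oI) (coorJ : coorientation (cell J) oJ).

Let cff := conormalf_form R ospJ lt_ba lt_Iab J_def ellIJ pJP.
Let cfJ := conormalJ_form R ospJ lt_ba lt_Iab J_def ellIJ pJP.
Local Notation Psi := (Psi J a b pJ).
Local Notation jac := (jac J a b pJ).
Local Notation eps := (epsilon J a b pJ oI).

Definition omega F : int := cosign J (lamJ a b pJ) oJ F.

Lemma det_consv n (A : 'M[R]_n.+1) c : row ord0 A = consv c 0 ->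
  \det A = c * \det (\matrix_(i, j) A (lift ord0 i) (lift ord0 j)).
Proof.
move=> /rowP rA; have A0 j : A ord0 j = consv c 0 0 j by rewrite -rA mxE.
rewrite (expand_det_row A ord0) (bigD1 ord0) //= big1 ?addr0 => [|j j0].
  rewrite A0 consv0 /cofactor addn0 expr0 mul1r; congr (_ * \det _).
  by apply/matrixP => i j; rewrite !mxE.
rewrite A0; have [j' jE|jE] := unliftP ord0 j; last by rewrite jE eqxx in j0.
by rewrite jE consvS mxE mul0r.
Qed.

(* In the coordinates Psi the basis B of T D has first vector -c times the first
   coordinate vector, and the others represent the normal space to the cell of I. *)
Lemma signed_basis_coords (phi : 'rV[R]_k.+1 -> X) (g : 'rV[R]_k.+1 -> 'M[R]_N)
    (x : 'rV[R]_k.+1) (B : 'M[R]_k.+1) (c : R) :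
  cellIJ I J (phi x) -> \det (jac phi g x) != 0 -> B \in unitmx ->
  row ord0 B *m jac phi g x = consv (- c) 0 ->
  sgz (\det B) * oI (phi x) (fun i => lift_deriv g x (row (lift ord0 i) B)) =
  - sgz c * eps (phi x) * sgz (\det (jac phi g x)).
Proof.
move=> cx dM uB r0; set M := jac phi g x in dM r0 *.
pose v i := lift_deriv g x (row (lift ord0 i) B).
have WE : conormal_mx J (lamf a b pJ) (phi x) v =
    \matrix_(i, j) (B *m M) (lift ord0 i) (lift ord0 j).
  apply/matrixP => i j; rewrite mxE [RHS]mxE.
  have := conormal_lift ospJ lt_ba lt_Iab J_def ellIJ pJP phi g x (row (lift ord0 i) B).
  move=> /rowP/(_ (lift ord0 j)); rewrite /conormal consvS => ->.
  by rewrite -row_mul mxE.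
have dBM : \det B * \det M = - c * \det (conormal_mx J (lamf a b pJ) (phi x) v).
  by rewrite WE -det_mulmx; apply: det_consv; rewrite row_mul.
have dB : \det B != 0 by rewrite -unitfE -unitmxE.
have dW : \det (conormal_mx J (lamf a b pJ) (phi x) v) != 0.
  apply/eqP => W0; have /eqP := dBM; rewrite W0 mulr0 mulf_eq0.
  by rewrite (negPf dB) (negPf dM).
have [_ ->] := cosignP cff (coor_cellIJ ospJ coorI) cx; last by rewrite unitmxE unitfE.
have := congr1 (fun x => sgz x) dBM; rewrite /= !sgzM sgzN -/(eps (phi x)).
have := sgz_sqr dM; have := sgz_sqr dW; rewrite -/M.
set sB := sgz (\det B); set sM := sgz (\det M); set sW := sgz (\det _).
move: (eps (phi x)) sB sM sW (sgz c) => e sB sM sW sc W2 M2 E.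
exact: sign_product.
Qed.

Lemma velocity_Psi (gamma : R -> X) t A : velocity gamma t A -> inchart J (gamma t) ->
  is_diff t (fun s => Psi (gamma s))
    (fun s : R => s *: conormal J (lamJ a b pJ) (gamma t) A).
Proof.
move=> vg ig; have := is_diff_psi a b pJ (velocity_ucoord ospJ vg ig).
suff -> : (fun s : R => s *: conormal J (lamJ a b pJ) (gamma t) A) =
  (fun s : R => lamJ a b pJ (ucoord J (gamma t))
     (s *: theta J (ucoord J (gamma t)) A)) by [].
by apply/funext => s; rewrite (conormal_scale cfJ).
Qed.

(** In the coordinates Psi the cell of I is the first axis without its origin, so all other
    coordinates are constant along a curve in it. *)
Lemma velocity_cellI (gamma : R -> X) t A : velocity gamma t A -> inchart J (gamma t) ->
  (\forall s \near t, cell I (gamma s)) ->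
  conormal J (lamJ a b pJ) (gamma t) A = consv ('D_1 (fun s => Psi (gamma s) 0 ord0) t) 0
  /\ derivable (fun s => Psi (gamma s) 0 ord0) t 1.
Proof.
move=> vg ig cg; have dP := velocity_Psi vg ig.
have ng : \forall s \near t, inchart J (gamma s).
  exact: (velocity_cvg ospJ vg (near_inchart ospJ ig)).
have [d0 dE] := is_diff_coord 0 ord0 dP.
split; last exact: diff_derivable.
apply: consvP => [|j].
  by rewrite deriveE // dE scale1r.
rewrite [RHS]mxE; apply: (deriv_entry_cst (x := 0) dP).
apply: filterS (filterI cg ng) => s [cs js].
by have [_] := (cellI_Psi lt_ba lt_Iab J_def ellIJ pJP js).1 cs; apply.
Qed.

(* The part of a curve of the slice close to b0 lies on one side, s = 1 or s = -1,
   of the cell of J in the union of the two cells. *)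
Definition on_side (gamma : R -> X) (V : set X) (eta s : R) : Prop :=
  [/\ 0 < eta <= 1, s = 1 \/ s = -1,
    forall t, 0 < t < eta -> [/\ V (gamma t), inchart J (gamma t),
       {for t, continuous (fun t => Psi (gamma t) 0 ord0)} &
       0 < s * Psi (gamma t) 0 ord0] &
    Psi (gamma t) 0 ord0 @[t --> 0^'+] --> (0 : R)].

Lemma curve_side b0 gamma (V : set X) : cell J b0 -> nbhs b0 V ->
  curve_from b0 gamma -> (forall t, 0 < t < 1 -> cell I (gamma t)) ->
  exists eta s, on_side gamma V eta s.
Proof.
move=> cb0 nV [[hl [op ad sm im]] _ cg _] cI.
have [ib0 _] := cell_inchart ospJ cb0.
have n : \forall t \near 0^'+, (V `&` inchart J) (gamma t).
  exact: (cg _ (filterI (F := nbhs b0) nV (near_inchart ospJ ib0))).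
have [e e0 he] := near_right_ex n.
pose eta := Num.min e 1; have eta0 : 0 < eta by rewrite lt_min e0 ltr01.
have le t : 0 < t < eta -> [/\ V (gamma t), inchart J (gamma t) & 0 < t < 1].
  rewrite lt_min => /andP[t0 /andP[te t1]].
  have tI : 0 < t < e by rewrite t0.
  by have [? ?] := he t tI; split => //; rewrite t0.
have cc t : 0 < t < eta -> {for t, continuous (fun t => Psi (gamma t) 0 ord0)}.
  move=> /le[_ it tI].
  have ut : (`]0, 1[%classic : set R) t by rewrite /= in_itv.
  have cgt : gamma s @[s --> t] --> gamma t.
    apply: (velocity_adapted_cvg ospJ (sm 0%N _ ut)).
    have nt := open_nbhs_nbhs (conj op ut).
    by apply: filterS nt => s; exact: ad.
  apply: (cvg_coord (F := nbhs t)); apply: cvg_comp cgt _; exact: (Psi_cvg ospJ).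
have [s [s1 hs]] : exists s : R, (s = 1 \/ s = -1) /\
    forall t, 0 < t < eta -> 0 < s * Psi (gamma t) 0 ord0.
  apply: const_sign => // t tI; have [_ it t01] := le t tI.
  by have [] := (cellI_Psi lt_ba lt_Iab J_def ellIJ pJP it).1 (cI t t01).
exists eta, s; split => //.
- by rewrite eta0 ge_min lexx orbT.
- by move=> t tI; have [? ? _] := le t tI; split => //; [exact: cc | exact: hs].
have P0 : Psi b0 = 0 by apply/(cellJ_Psi ospJ lt_ba lt_Iab J_def pJP).
suff : Psi (gamma t) 0 ord0 @[t --> (0:R)^'+] --> Psi b0 0 ord0 by rewrite P0 mxE.
apply: (cvg_coord (F := 0^'+)); apply: cvg_comp cg _; exact: (Psi_cvg ospJ).
Qed.

(** The equation defining the contribution holds for all small t; it is read at a t where s * Psi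
    increases, so that the reversed velocity has a first coordinate of sign - s. Then
    [signed_basis_coords] applies, the Jacobian has the sign it has at b0, and [epsilon_side]
    replaces the point of the curve by G. *)
Lemma contribution_value D b0 gamma (V : set X) eta s e G : transverse D (cell J) ->
  cell J b0 -> D b0 -> curve_from b0 gamma ->
  (forall t, 0 < t < 1 -> D (gamma t) /\ cell I (gamma t)) ->
  on_side gamma V eta s ->
  contribution oI oJ D b0 gamma e -> cellIJ I J G -> 0 < s * Psi G 0 ord0 ->
  e = - sgz s * eps G * omega b0.
Proof.
move=> tr cb0 Db0 [[hl [op ad sm im]] _ cg _] gDI [/andP[eta0 eta1] s1 hs h0].
move=> [U [phi [g [x0 [ch Ux0 x0E hB]]]]] cG sG.
have cx0 : cell J (phi x0) by rewrite x0E.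
have nj := near_jac ospJ lt_ba lt_Iab J_def ellIJ pJP ch Ux0 cx0 tr.
have uj := jac_unit ospJ lt_ba lt_Iab J_def ellIJ pJP ch Ux0 cx0 tr.
have nG := chart_near ch Ux0 nj; rewrite x0E in nG.
pose f t := s * Psi (gamma t) 0 ord0.
have fE : f = (fun t => s * Psi (gamma t) 0 ord0) by [].
have fc t : 0 < t < eta -> {for t, continuous f}.
  move=> /hs[_ _ c _]; exact: (cvgMr (F := nbhs t)).
have f0 : f t @[t --> 0^'+] --> 0.
  by rewrite -[X in _ --> X](mulr0 s); apply: (cvgMr (F := 0^'+)).
have fp t : 0 < t < eta -> 0 < f t by move=> /hs[].
have t01 t : 0 < t < eta -> 0 < t < 1.
  by move=> /andP[-> te]; exact: lt_le_trans te eta1.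
have ncI (t : R) : 0 < t < 1 -> \forall r \near t, cell I (gamma r).
  move=> tI; have ut : (`]0, 1[%classic : set R) t by rewrite /= in_itv.
  by apply: filterS (open_nbhs_nbhs (conj op ut)) => r /=; rewrite in_itv /= => /gDI[].
have fd (t : R) : 0 < t < eta -> derivable f t 1.
  move=> tI; have [_ it _ _] := hs t tI.
  have ut : (`]0, 1[%classic : set R) t by rewrite /= in_itv /= t01.
  have vt : velocity gamma t (lift_deriv hl t 1).
    exists hl; split => //; first by have [h _] := sm 1%N; exact: h.
    by apply: filterS (open_nbhs_nbhs (conj op ut)) => r; exact: ad.
  have [_ dh] := velocity_cellI vt it (ncI _ (t01 _ tI)).
  by apply: derivableM => //; exact: derivable_cst.
have nn : \forall t \near 0^'+, (exists y, [/\ U y, [/\ U y, inchart J (phi y) &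
    sgz (\det (jac phi g y)) = sgz (\det (jac phi g x0))] & phi y = gamma t]) /\
    exists x (B : 'M[R]_k.+1), [/\ U x, phi x = gamma t, B \in unitmx,
      velocity gamma t (- lift_deriv g x (row ord0 B)) &
      sgz (\det B) * oI (gamma t) (fun i => lift_deriv g x (row (lift ord0 i) B)) =
      e * oJ b0 (fun i => lift_deriv g x0 (row i 1%:M))].
  near=> t; split; last by near: t.
  have : D (gamma t) -> exists y, [/\ U y, [/\ U y, inchart J (phi y) &
    sgz (\det (jac phi g y)) = sgz (\det (jac phi g x0))] & phi y = gamma t].
    by near: t; exact: cg _ nG.
  apply; have [] // := gDI t; apply/andP; split.
    by near: t; exact: nbhs_right_gt.
  by near: t; exact: nbhs_right_lt.
have [t [[[y [Uy [_ iy sy] yE]] [x [B [Ux xE uB vB eB]]]] tI ft]] :=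
  ex_increasing eta0 fc f0 fp fd nn.
(* The point x provided by [contribution] is not known to be close to x0. The point y is, and it has
   the same image. *)
have xy : x = y.
  by have [_ inj _] := ch; exact: (inj x y (mem_set Ux) (mem_set Uy) (etrans xE (esym yE))).
subst y; have [_ it _ st] := hs t tI; have tI1 := t01 _ tI.
have [_ cIt] := gDI t tI1.
have [cv dh] := velocity_cellI vB it (ncI _ tI1).
have cx : cellIJ I J (phi x) by rewrite xE; split.
have dx : \det (jac phi g x) != 0.
  rewrite -sgz_eq0 sy sgz_eq0 -unitfE -unitmxE //.
pose c := 'D_1 (fun r => Psi (gamma r) 0 ord0) t.
have r0 : row ord0 B *m jac phi g x = consv (- c) 0.
  have := conormal_lift ospJ lt_ba lt_Iab J_def ellIJ pJP phi g x (row ord0 B).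
  move=> <-; rewrite -[lift_deriv _ _ _]opprK -scaleN1r (conormalZ cfJ) xE cv.
  apply: consvP => [|j]; first by rewrite mxE consv0 mulN1r.
  by rewrite mxE consvS !mxE mulr0.
have := signed_basis_coords cx dx uB r0; rewrite xE eB sy.
have [_ ->] := cosignP cfJ coorJ cb0; last first.
  by have := uj; rewrite /jac x0E.
have -> : conormal_mx J (lamJ a b pJ) b0 (fun i => lift_deriv g x0 (row i 1%:M)) =
  jac phi g x0 by rewrite /jac x0E.
have -> : eps (gamma t) = eps G.
  have cgt : cellIJ I J (gamma t) by rewrite -xE.
  apply: (epsilon_side ospJ lt_ba lt_Iab J_def ellIJ pJP coorI cgt cG).
  have E1 : Psi (gamma t) 0 ord0 = ucoord J (gamma t) b a := Psi0 J a b pJ _.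
  have E2 : Psi G 0 ord0 = ucoord J G b a := Psi0 J a b pJ _.
  move: st sG; rewrite E1 E2; case: s1 => ->; rewrite ?mul1r ?mulN1r.
    exact: mulr_gt0.
  by rewrite !oppr_gt0 => h1 h2; rewrite nmulr_rgt0.
have -> : sgz c = sgz s.
  have fD : 'D_1 f t = s * c.
    exact: (deriveZ s dh).
  move: ft; rewrite fD; case: s1 => ->; rewrite ?mul1r ?mulN1r ?oppr_gt0 => cp.
    by rewrite gtr0_sgz ?sgz1.
  by rewrite ltr0_sgz ?sgzN ?sgz1.
have dx0 : \det (jac phi g x0) != 0 by rewrite -unitfE -unitmxE.
have M2 := sgz_sqr dx0.
have [om1 _] := cosignP cfJ coorJ cb0.
have o2 : omega b0 * omega b0 = 1.
  by rewrite /omega; case: om1 => ->; rewrite ?mulrNN mul1r.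
exact: sign_quotient.
Unshelve. all: by end_near. Qed.

End Contribution.

(** * The two arcs of an arbitrary slice *)

Section Avoid.
Variables (R : realType) (N m : nat) (d : 'I_m -> nat).
Local Notation X := (flag R N d).

Lemma kad_of_adapted K g (F : X) : is_osp d K -> adapted g F -> exists h, kad K h F.
Proof.
move=> oK ag; have [s sP] := osp_sort oK.
by exists (invmx (perm_mx s) *m g); apply/(adapted_perm _ _ sP); rewrite mulKVmx // unitmx_perm.
Qed.

(** Each point of the segment is separated from b0 by [near_neq], and compactness makes one
    neighbourhood of b0 work for all of them. *)
Lemma near_avoid_segment K (gamma : R -> X) h (b0 : X) g (p q : R) : is_osp d K ->
  kad K g b0 -> (forall t, p <= t <= q -> adapted (h t) (gamma t)) ->
  (forall t, p <= t <= q -> gamma s @[s --> t] --> gamma t) ->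
  (forall t, p <= t <= q -> gamma t <> b0) ->
  \forall G \near b0, forall t, p <= t <= q -> gamma t <> G.
Proof.
move=> oK gb ag cg nb.
have [cp _] := compact_near_coveringP (`[p, q]%classic : set R).
have nc := cp (@segment_compact R p q).
suff H : \forall G \near b0, (`[p, q]%classic : set R) `<=` (fun t => gamma t <> G).
  by apply: filterS H => G HG t tI; apply: HG; rewrite /= in_itv.
apply: (nc X (nbhs b0) (fun G t => gamma t <> G) _) => t.
rewrite /= in_itv /= => tI; have [k' kt] := kad_of_adapted oK (ag t tI).
have [[A B] /= [nA nB] AB] := near_neq oK kt gb (nb t tI).
exists (gamma @^-1` A, B) => /=; first by split => //; exact: cg.
by move=> [x G] /= [Ax BG]; exact: (AB (gamma x, G) (conj Ax BG)).
Qed.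

(** Up to parameter 1/2 this is compactness; beyond it, the clause of [curve_from] that the far half
    does not accumulate at b0. A small neighbourhood of b0 thus meets the curve only at parameters
    below p. *)
Lemma near_avoid_curve K (gamma : R -> X) (b0 : X) g (p : R) : is_osp d K ->
  kad K g b0 -> curve_from b0 gamma -> (forall t, 0 < t < 1 -> gamma t <> b0) -> 0 < p ->
  \forall G \near b0, forall t, p <= t < 1 -> gamma t <> G.
Proof.
move=> oK gb [[hl [op ad sm im]] _ cg cl] nb p0.
have half t : p <= t <= 2^-1 -> (`]0, 1[%classic : set R) t.
  move=> /andP[pt th]; rewrite /= in_itv /= (lt_le_trans p0 pt) /=.
  by rewrite (le_lt_trans th) // invf_lt1 // ltr1n.
have n1 : \forall G \near b0, forall t, p <= t <= 2^-1 -> gamma t <> G.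
  apply: (near_avoid_segment oK gb (h := hl)) => t tI.
  - exact: ad (half t tI).
  - apply: (velocity_adapted_cvg oK (sm 0%N _ (half t tI))).
    by apply: filterS (open_nbhs_nbhs (conj op (half t tI))) => s; exact: ad.
  - by apply: nb; have := half t tI; rewrite /= in_itv.
have n2 : \forall G \near b0, forall t, 2^-1 <= t < 1 -> gamma t <> G.
  have [B [nB BP]] : exists B, nbhs b0 B /\ ~ (gamma @` (`[2^-1, 1[%classic : set R) `&` B !=set0).
    by apply: contrapT => H; apply: cl => B nB; apply: contrapT => H'; apply: H; exists B.
  apply: filterS nB => G BG t tI E; apply: BP; exists G; split => //.
  by exists t => //; rewrite /= in_itv.
apply: filterS (filterI n1 n2) => G [h1 h2] t /andP[pt t1].
have [th|th] := leP t 2^-1; first by apply: h1; rewrite pt.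
by apply: h2; rewrite (ltW th).
Qed.

End Avoid.

Section SliceSum.
Variables (R : realType) (N m : nat) (d : 'I_m -> nat).
Local Notation X := (flag R N d).
Implicit Types (u A Y : 'M[R]_N) (F G : X).

Variables (I J : {ffun 'I_N -> 'I_m}) (a b : 'I_N).
Hypotheses (ospI : is_osp d I) (ospJ : is_osp d J).
Hypotheses (lt_ba : (b < a)%N) (lt_Iab : (I a < I b)%N)
  (J_def : J = [ffun x => I (tperm a b x)]) (ellIJ : ell I = (ell J).+1).
Variables (k : nat) (pJ : 'I_k -> 'I_N * 'I_N).
Hypothesis (pJP : enumerates pJ (asc J :\ (b, a))).
Variables (oI : X -> ('I_k -> 'M[R]_N) -> int) (oJ : X -> ('I_k.+1 -> 'M[R]_N) -> int).
Hypotheses (coorI : coorientation (cell I) oI) (coorJ : coorientation (cell J) oJ).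
Hypothesis closIJ : (cell J : set X) `<=` closure (cell I).

Local Notation Psi := (Psi J a b pJ).
Local Notation eps := (epsilon J a b pJ oI).

Lemma mx_norm_consv0 (y : R) : `|consv y (0 : 'rV[R]_k)| <= `|y|.
Proof.
apply: mx_norm_le => // i j; rewrite ord1.
have [j' ->|->] := unliftP ord0 j; last by rewrite consv0.
by rewrite consvS mxE normr0.
Qed.

Lemma eq_Psi_cellI F G : inchart J F -> inchart J G -> cell I F -> cell I G ->
  Psi F 0 ord0 = Psi G 0 ord0 -> Psi F = Psi G.
Proof.
move=> iF iG cF cG E.
have [_ hF] := (cellI_Psi lt_ba lt_Iab J_def ellIJ pJP iF).1 cF.
have [_ hG] := (cellI_Psi lt_ba lt_Iab J_def ellIJ pJP iG).1 cG.
apply/rowP => j; have [j' ->|->] := unliftP ord0 j; last exact: E.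
by rewrite hF hG.
Qed.

Variables (D : set X) (b0 : X) (r : nat) (gamma : 'I_r -> R -> X).
Hypothesis (sl : slice k I J D b0 gamma).

Lemma slice_base : [/\ D b0, cell J b0 & transverse D (cell J)].
Proof.
case: sl => _ tr Db _ _.
have [? ?] : (D `&` cell J) b0 by rewrite Db.
by split => //; exact: tr.
Qed.

Lemma slice_curve i t : 0 < t < 1 -> D (gamma i t) /\ cell I (gamma i t).
Proof.
move=> tI; case: sl => _ _ _ _ [_ DI].
by rewrite -[_ /\ _]/((D `&` cell I) _) DI; exists i => //; exists t; rewrite //= in_itv.
Qed.

Lemma slice_local : exists2 W : set X, nbhs b0 W &
  (forall G G', D G -> D G' -> W G -> W G' -> Psi G = Psi G' -> G = G') /\
  forall V : set X, nbhs b0 V -> exists2 e : R, 0 < e &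
    forall y, `|y| < e -> exists G, [/\ D G, V G & Psi G = y].
Proof.
have [Db0 cb0 tr] := slice_base; case: sl => sm _ _ _ _.
have [U [phi [g [x [ch Ux xE]]]]] := sm _ Db0.
have cx : cell J (phi x) by rewrite xE.
by have := Psi_local ospJ lt_ba lt_Iab J_def ellIJ pJP ch Ux cx tr; rewrite xE.
Qed.

Lemma curve_from_slice i : curve_from b0 (gamma i).
Proof. by case: sl. Qed.

(** Two curves on the same side both take every small value of the first coordinate, by
    [covers_small]. As Psi is injective on D near b0 they share a point, and distinct curves of a
    slice are disjoint. *)
Lemma side_inj (W : set X) i j (eta eta' s : R) :
  (forall G G', D G -> D G' -> W G -> W G' -> Psi G = Psi G' -> G = G') ->
  on_side J a b pJ (gamma i) W eta s -> on_side J a b pJ (gamma j) W eta' s -> i = j.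
Proof.
move=> inj [/andP[e0 e1] s1 hi ci] [/andP[e0' e1'] _ hj cj].
have cov l e : 0 < e -> e <= 1 -> (forall t, 0 < t < e -> [/\ W (gamma l t), inchart J (gamma l t),
     {for t, continuous (fun t => Psi (gamma l t) 0 ord0)} & 0 < s * Psi (gamma l t) 0 ord0]) ->
    Psi (gamma l t) 0 ord0 @[t --> 0^'+] --> (0 : R) ->
    exists2 dl : R, 0 < dl & forall y, 0 < y < dl ->
      exists2 t, 0 < t < e & s * Psi (gamma l t) 0 ord0 = y.
  move=> l0 l1 h c0; apply: (covers_small (f := fun t => s * Psi (gamma l t) 0 ord0) l0).
  - by move=> t /h[_ _ c _]; exact: (cvgMr (F := nbhs t)).
  - by rewrite -[X in _ --> X](mulr0 s); apply: (cvgMr (F := 0^'+)).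
  - by move=> t /h[].
have [dl dl0 hdl] := cov i eta e0 e1 hi ci.
have [dl' dl0' hdl'] := cov j eta' e0' e1' hj cj.
pose y := Num.min dl dl' / 2.
have m0 : 0 < Num.min dl dl' by rewrite lt_min dl0.
have y0 : 0 < y by rewrite divr_gt0.
have ym : y < Num.min dl dl' by rewrite /y; lra.
have [yd yd'] : y < dl /\ y < dl' by move: ym; rewrite lt_min => /andP.
have [t tI tE] := hdl y (introT andP (conj y0 yd)).
have [t' tI' tE'] := hdl' y (introT andP (conj y0 yd')).
have [Wt it _ _] := hi t tI; have [Wt' it' _ _] := hj t' tI'.
have t1 : 0 < t < 1 by case/andP: tI => -> te; exact: lt_le_trans te e1.
have t1' : 0 < t' < 1 by case/andP: tI' => -> te; exact: lt_le_trans te e1'.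
have [Dt ct] := slice_curve i t1; have [Dt' ct'] := slice_curve j t1'.
have s0 : s != 0 by case: s1 => ->; rewrite ?oppr_eq0 oner_eq0.
have PE : Psi (gamma i t) 0 ord0 = Psi (gamma j t') 0 ord0.
  by apply: (mulfI s0); rewrite tE tE'.
have GE := inj _ _ Dt Dt' Wt Wt' (eq_Psi_cellI it it' ct ct' PE).
case: sl => _ _ _ _ [tv _]; apply: tv => //; exists (gamma i t); split.
  by exists t; rewrite //= in_itv.
by exists t'; rewrite //= in_itv.
Qed.

(** D contains points G arbitrarily close to b0 on the half axis of sign s. Such a G lies in the
    cell of I, hence on some curve, and [near_avoid_curve] forces its parameter into the initial
    part where the side of the curve is defined. *)
Lemma side_surj (W : set X) (eta sg : 'I_r -> R) (s : R) : s = 1 \/ s = -1 ->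
  (forall V : set X, nbhs b0 V -> exists2 e : R, 0 < e &
    forall y, `|y| < e -> exists G, [/\ D G, V G & Psi G = y]) ->
  (forall i, on_side J a b pJ (gamma i) W (eta i) (sg i)) -> exists i, sg i = s.
Proof.
move=> s1 surj hs; have [Db0 cb0 tr] := slice_base.
have [g [gb _ _]] := kad_of_cell ospJ cb0.
have [ib0 _] := cell_inchart ospJ cb0.
have nb i t : 0 < t < 1 -> gamma i t <> b0.
  move=> tI E; have [_ cI] := slice_curve i tI; move: cI; rewrite E => cI.
  have [n _] := (cellI_Psi lt_ba lt_Iab J_def ellIJ pJP ib0).1 cI.
  by move: n; rewrite ((cellJ_Psi ospJ lt_ba lt_Iab J_def pJP ib0).1 cb0) mxE eqxx.
have nV : \forall G \near b0, forall i t, eta i / 2 <= t < 1 -> gamma i t <> G.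
  apply: (filter_forall (F := nbhs b0)
    (f := fun i G => forall t, eta i / 2 <= t < 1 -> gamma i t <> G)) => i.
  have [/andP[e0 _] _ _ _] := hs i.
  apply: (near_avoid_curve ospJ gb (curve_from_slice i) (nb i)).
  by rewrite divr_gt0.
have [e e0 he] := surj _ (filterI (F := nbhs b0) nV (near_inchart ospJ ib0)).
have [|G [DG [VG iG] PG]] := he (consv (s * (e / 2)) 0).
  apply: le_lt_trans (mx_norm_consv0 _) _; rewrite normrM.
  have -> : `|s| = 1 by case: s1 => ->; rewrite ?normrN normr1.
  by rewrite mul1r gtr0_norm; lra.
have G0 : Psi G 0 ord0 = s * (e / 2) by rewrite PG consv0.
have s0 : s != 0 by case: s1 => ->; rewrite ?oppr_eq0 oner_eq0.
have cG : cell I G.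
  apply/(cellI_Psi lt_ba lt_Iab J_def ellIJ pJP iG); rewrite G0; split.
    by rewrite mulf_neq0 // gt_eqF // divr_gt0.
  by move=> j; rewrite PG consvS mxE.
have [i [t /= tI tG]] : exists i, (gamma i @` `]0, 1[%classic) G.
  have : (D `&` cell I) G by [].
  by case: sl => _ _ _ _ [_ ->] [i _ h]; exists i.
exists i; have [/andP[ei0 _] si hi _] := hs i.
rewrite in_itv /= in tI; have /andP[t0 t1] := tI.
have te : t < eta i / 2.
  by rewrite ltNge; apply/negP => h; apply: (VG i t _ tG); rewrite h.
have [|_ _ _] := hi t; first by rewrite t0; lra.
rewrite tG G0 mulrA pmulr_lgt0 ?divr_gt0 //.
by case: s1 si => -> [] ->; rewrite ?mul1r ?mulN1r ?opprK // oppr_gt0 ltr10.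
Qed.

(** By [side_inj] and [side_surj] the curves correspond to the two sides, so the sum has exactly two
    terms; their prefactors - s are opposite. *)
Lemma slice_sum (e : 'I_r -> int) Gp Gm F0 :
  (forall i, contribution oI oJ D b0 (gamma i) (e i)) -> cell J F0 ->
  cellIJ I J Gp -> cellIJ I J Gm -> 0 < Psi Gp 0 ord0 -> Psi Gm 0 ord0 < 0 ->
  \sum_i e i = (eps Gm - eps Gp) * omega J a b pJ oJ F0.
Proof.
move=> he cF0 cp cm tp tm; have [Db0 cb0 tr] := slice_base.
have [W nW [inj surj]] := slice_local.
have /choice[et hes] : forall i, exists es : R * R, on_side J a b pJ (gamma i) W es.1 es.2.
  move=> i; have gI t : 0 < t < 1 -> cell I (gamma i t) by move=> /(slice_curve i)[].
  have [eta [s h]] := curve_side ospJ lt_ba lt_Iab J_def ellIJ pJP cb0 nW (curve_from_slice i) gI.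
  by exists (eta, s).
have sinj i j : (et i).2 = (et j).2 -> i = j.
  by move=> E; have := hes j; rewrite -E => hj; exact: side_inj inj (hes i) hj.
have cfJ := conormalJ_form R ospJ lt_ba lt_Iab J_def ellIJ pJP.
have oE : omega J a b pJ oJ b0 = omega J a b pJ oJ F0.
  exact: cosign_cell ospJ cfJ coorJ cb0 cF0.
have val i G : cellIJ I J G -> 0 < (et i).2 * Psi G 0 ord0 ->
    e i = - sgz (et i).2 * eps G * omega J a b pJ oJ F0.
  rewrite -oE => cG sG.
  exact: (contribution_value ospJ lt_ba lt_Iab J_def ellIJ pJP coorI coorJ tr cb0 Db0
    (curve_from_slice i) (slice_curve i) (hes i) (he i) cG sG).
have [ip sp] := side_surj (or_introl erefl) surj hes.
have [im sm] := side_surj (or_intror erefl) surj hes.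
have imp : im != ip.
  apply/eqP => E; move: sp; rewrite -E sm => /eqP.
  by rewrite -subr_eq0 -opprD oppr_eq0 (_ : 1 + 1 = 2%:R) ?pnatr_eq0.
have vp : e ip = - eps Gp * omega J a b pJ oJ F0.
  by rewrite (val ip Gp) // sp ?mul1r // sgz1 mulN1r.
have vm : e im = eps Gm * omega J a b pJ oJ F0.
  by rewrite (val im Gm) // sm ?mulN1r ?oppr_gt0 // sgzN sgz1 opprK mul1r.
rewrite (bigD1 ip) //= (bigD1 im) //= big1 => [|i /andP[i1 i2]].
  by rewrite addr0 vp vm mulrBl mulNr addrC.
have [_ si _ _] := hes i.
by case: si => E; [case/eqP: i1|case/eqP: i2]; apply: sinj; rewrite E.
Qed.

End SliceSum.

(** * A transversal slice *)

Section SmoothAffine.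
Variables (R : realType) (V W : normedModType R).

Lemma smooth_affine (U : set V) (f df : V -> W) : (forall x, is_diff x f df) -> smooth U f.
Proof.
have cst n c : @Cn R V W n U (fun=> c).
  elim: n c => [|n IH] c /=; first by move=> x _; exact: cst_continuous.
  split=> [x _|v]; first exact: differentiable_cst.
  by rewrite (_ : (fun x => _) = (fun=> 0)) //; apply/funext => x; rewrite diff_cst.
move=> fd [|n] /=.
  by move=> x _; apply: differentiable_continuous; have [] := fd x.
split=> [x _|v]; first by have [] := fd x.
rewrite (_ : (fun x => _) = (fun=> df v)); first exact: cst.
by apply/funext => x; have [_ ->] := fd x.
Qed.

End SmoothAffine.

Section StandardSlice.
Variables (R : realType) (N m : nat) (d : 'I_m -> nat).
Local Notation X := (flag R N d).
Implicit Types (u A Y : 'M[R]_N) (F G : X).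

(** Lower triangular matrices preserve every E_k and hence every cell. In the chart: [theta] of a
    lower triangular velocity at a lower triangular u is lower triangular. *)
Lemma tangent_lower K F A : is_osp d K -> cell K F -> supp (@lowR N) A ->
  tangent (cell K : set X) F A.
Proof.
move=> oK cF lA; have [iF lu] := cell_inchart oK cF; have [hu uF] := ucoordP iF.
set u := ucoord K F in lu hu uF.
have lt : supp (@lowR N) (theta K u A).
  apply: (supp_mul (@lowR_trans N) _ lu).
  move=> l c n; rewrite mxE; case: ifP => // _.
  apply: (supp_mul (@lowR_trans N) (supp_mul (@lowR_trans N) lu lA) _ n).
  exact: supp_inv (@lowR_refl N) (@lowR_trans N) lu (unip_unit hu).
have hus (s : R) : unip K (u + s *: theta K u A).
  by apply: (unip_addr hu); apply: supp_scale; exact: theta_strict.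
have [|gamma [g0 gs vg]] := ex_velocity (A := A) (c := fun s => u + s *: theta K u A)
    oK hu uF _ (is_diff_linear_path _ _) hus; first by rewrite scale0r addr0.
exists gamma; split => //; apply: (nearW (F := nbhs (0:R))) => s; apply: (cell_of_kad (gs s)).
by apply: (supp_add lu); exact: supp_scale.
Qed.

Variables (I J : {ffun 'I_N -> 'I_m}) (a b : 'I_N).
Hypotheses (ospI : is_osp d I) (ospJ : is_osp d J).
Hypotheses (lt_ba : (b < a)%N) (lt_Iab : (I a < I b)%N)
  (J_def : J = [ffun x => I (tperm a b x)]) (ellIJ : ell I = (ell J).+1).
Variables (k : nat) (pJ : 'I_k -> 'I_N * 'I_N).
Hypothesis (pJP : enumerates pJ (asc J :\ (b, a))).

Let Jba : (J b < J a)%N. Proof. by rewrite (exch_a J_def) (exch_b J_def). Qed.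

Definition ascents (j : 'I_k.+1) : 'I_N * 'I_N := oapp pJ (b, a) (unlift ord0 j).

Lemma ascentsP : enumerates ascents (asc J).
Proof.
have [pi pA] := pJP.
have nba j : pJ j <> (b, a).
  by move=> E; have : pJ j \in asc J :\ (b, a) by [apply/pA; exists j]; rewrite E !inE eqxx.
split=> [i j|x].
  rewrite /ascents; have [i' ->|->] := unliftP ord0 i; have [j' ->|->] := unliftP ord0 j => //=.
  - by move=> /pi ->.
  - by move=> E; case: (nba i').
  - by move=> E; case: (nba j').
have [->|n] := eqVneq x (b, a).
  split=> _; first by exists ord0; rewrite /ascents unlift_none.
  by rewrite inE lt_ba Jba.
have -> : (x \in asc J) = (x \in asc J :\ (b, a)) by rewrite in_setD1 n.
split=> [/pA[j <-]|[j]]; first by exists (lift ord0 j); rewrite /ascents liftK.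
rewrite /ascents; have [j' _|_] := unliftP ord0 j => /= E; first by apply/pA; exists j'.
by rewrite E eqxx in n.
Qed.

(* The flags of the chart of J with upper unitriangular coordinate form a
   submanifold transverse to all cells. Bounding the coordinate (b, a) by 1 lets
   ]0, 1[ parametrize linearly its two curves of intersection with the cell of I. *)
Definition sect (x : 'rV[R]_k.+1) : 'M[R]_N := pairs_mx ascents x.

Lemma sect_ba x : sect x b a = x 0 ord0.
Proof. by have := pairs_mxE x ord0 ascentsP; rewrite /ascents unlift_none. Qed.

Lemma sect_strict x : supp (strictR J) (sect x).
Proof. exact: pairs_mx_strict ascentsP _. Qed.

Lemma sect_upper x (l c : 'I_N) : (c <= l)%N -> sect x l c = 0.
Proof. by move=> cl; apply: pairs_mx0 ascentsP _; rewrite inE ltnNge cl. Qed.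

Lemma sect_inj : injective sect.
Proof.
move=> x y E; apply/rowP => j.
by rewrite -(pairs_mxE x j ascentsP) -(pairs_mxE y j ascentsP) -!/(sect _) E.
Qed.

Lemma unip_sect x : unip J (1%:M + sect x).
Proof. by apply: unip_addr (@sect_strict x); exact: unip1. Qed.

Definition coords u : 'rV[R]_k.+1 := \row_j u (ascents j).1 (ascents j).2.

Lemma coordsK u : unip J u -> supp (@upR N) u -> u = 1%:M + sect (coords u).
Proof.
move=> hu uu; apply/matrixP => l c; rewrite mxE [X in X + _]mxE.
have [/(proj2 ascentsP)[j E]|n] := boolP ((l, c) \in asc J); last first.
  rewrite /sect (pairs_mx0 _ ascentsP n) addr0.
  have [Jcl|Jlc] := leqP (J c) (J l); first exact: hu.
  have cl : (c <= l)%N by rewrite leqNgt; apply: contra n => h; rewrite inE h.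
  have [lc|lc] := eqVneq l c; first by move: Jlc; rewrite lc ltnn.
  by apply: uu; rewrite /upR -ltnNge ltn_neqAle cl andbT eq_sym.
have [El Ec] : (ascents j).1 = l /\ (ascents j).2 = c by rewrite E.
have := pairs_mxE (coords u) j ascentsP; rewrite El Ec /sect => ->.
rewrite mxE El Ec; have : (l, c) \in asc J by apply/(proj2 ascentsP); exists j.
by rewrite inE => /andP[/= lc _]; case: eqP lc => [->|_ _]; rewrite ?ltnn // add0r.
Qed.

Lemma sect_consv (s : R) : sect (consv s 0) = s *: delta_mx b a.
Proof.
rewrite /sect /pairs_mx big_ord_recl consv0 big1 ?addr0 => [|j _].
  by rewrite /ascents unlift_none.
by rewrite consvS mxE scale0r.
Qed.

Lemma sectZ (s : R) x : sect (s *: x) = s *: sect x.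
Proof. by rewrite /sect /pairs_mx scaler_sumr; apply: eq_bigr => j _; rewrite mxE scalerA. Qed.

Lemma is_diff_sect x : is_diff x sect sect.
Proof.
apply: is_diff_bigsum => j; apply: is_diff_Zl.
exact: is_diff_coord (is_diff_id x).
Qed.

Definition sect_flag (x : 'rV[R]_k.+1) : X :=
  projT1 (cid (ex_kad ospJ (unip_unit (unip_sect x)))).

Lemma sect_flagP x : kad J (1%:M + sect x) (sect_flag x).
Proof. by rewrite /sect_flag; case: cid. Qed.

Lemma inchart_sect x : inchart J (sect_flag x).
Proof. by exists (1%:M + sect x); split; [exact: unip_sect | exact: sect_flagP]. Qed.

Lemma ucoord_sect x : ucoord J (sect_flag x) = 1%:M + sect x.
Proof. exact: ucoordE (unip_sect x) (sect_flagP x). Qed.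

Lemma sect_flag_inj : injective sect_flag.
Proof.
move=> x y E; apply: sect_inj; apply: (addrI 1%:M).
by rewrite -!ucoord_sect E.
Qed.

Lemma coords_sect x : coords (ucoord J (sect_flag x)) = x.
Proof.
apply/rowP => j; rewrite mxE ucoord_sect mxE [X in X + _]mxE.
rewrite -[RHS](pairs_mxE x j ascentsP) -/(sect x).
have : ascents j \in asc J by apply/(proj2 ascentsP); exists j.
by rewrite inE => /andP[/= lc _]; case: eqP lc => [->|_ _]; rewrite ?ltnn // add0r.
Qed.

Definition sect_dom : set 'rV[R]_k.+1 := [set x | `|x 0 ord0| < 1].
Definition sect_slice : set X := sect_flag @` sect_dom.

Lemma open_sect_dom : open sect_dom.
Proof.
rewrite openE => x /= x1.
have c : `|y 0 ord0| @[y --> x] --> `|x 0 ord0|.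
  by apply: cvg_norm; apply: (cvg_coord (F := nbhs x)); exact: cvg_id.
exact: (cvgr_lt (F := nbhs x) _ c _ x1).
Qed.

Definition sorting : 'M[R]_N := perm_mx (projT1 (cid (osp_sort ospJ))).

Lemma sorting_unit : sorting \in unitmx. Proof. exact: unitmx_perm. Qed.

Lemma adapted_sorting g F : adapted (sorting *m g) F <-> kad J g F.
Proof. by rewrite /sorting; case: cid => s /= sP; exact: adapted_perm. Qed.

Definition sect_lift x : 'M[R]_N := sorting *m (1%:M + sect x).

Lemma is_diff_sect_lift x : is_diff x sect_lift (fun v => sorting *m sect v).
Proof.
have := is_diff_mulmx (is_diff_cst sorting x) (is_diffD (is_diff_cst 1%:M x) (is_diff_sect x)).
suff -> : (fun v => sorting *m sect v) = (fun v : 'rV[R]_k.+1 =>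
    0 *m ((cst 1%:M + sect) x) + cst sorting x *m (0 + sect v)) by [].
by apply/funext => v; rewrite mul0mx !add0r.
Qed.

Lemma lift_deriv_sect x v :
  lift_deriv sect_lift x v = invmx (1%:M + sect x) *m sect v.
Proof.
have [_ E] := is_diff_sect_lift x; rewrite /lift_deriv E.
have uu := unip_unit (unip_sect x).
have uS : sect_lift x \in unitmx by rewrite unitmx_mul sorting_unit.
apply: (can_inj (mulKmx uS)); rewrite mulKVmx //.
by rewrite -[sect_lift x *m _]mulmxA mulKVmx.
Qed.

Lemma chart_sect : chart sect_slice sect_dom sect_flag sect_lift.
Proof.
split.
- split; first exact: open_sect_dom.
  + by move=> x _; apply/adapted_sorting; exact: sect_flagP.
  + exact: smooth_affine is_diff_sect_lift.
  + move=> x v _; rewrite lift_deriv_sect => /(theta_eq0 _ (unip_sect x) (sect_flagP x)).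
    rewrite theta_lift //; [|exact: unip_sect|exact: sect_strict].
    move=> v0; apply: sect_inj; rewrite v0.
    by apply/matrixP => l c; rewrite -(scale0r (0 : 'rV[R]_k.+1)) sectZ scale0r.
- by move=> x y _ _; exact: sect_flag_inj.
(* The entries at the ascents are defined on the whole chart of J and restrict to the parameter x on
   the slice, so they provide the open set of flags. *)
move=> U' oU sU; exists [set G | inchart J G /\ U' (coords (ucoord J G))]°.
  exact: open_interior.
apply/seteqP; split=> [_ [x Ux <-]|G [hG [x xd xE]]]; last first.
  have [_ UG] := interior_subset hG; by exists x => //; rewrite -xE coords_sect in UG.
split; last by exists x => //; exact: sU.
have ix := inchart_sect x.
apply: filterI; first exact: near_inchart.
have c : coords (ucoord J G) @[G --> sect_flag x] --> x.
  rewrite -[X in _ --> X]coords_sect; apply: (cvg_mx (F := nbhs (sect_flag x))) => i j.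
  rewrite mxE; under eq_fun do rewrite mxE.
  by apply: (cvg_coord (F := nbhs (sect_flag x))); exact: ucoord_continuous.
exact: (c _ (open_nbhs_nbhs (conj oU Ux))).
Qed.

(** Every matrix is a strictly upper plus a lower triangular one. The lower part is tangent to all
    cells; the upper part keeps the coordinate upper triangular, so the straight path stays in the
    slice while its entry (b, a) is below 1 in absolute value. *)
Lemma sect_transverse K : is_osp d K -> transverse sect_slice (cell K).
Proof.
move=> oK _ [x x1 <-] cF A.
pose C := \matrix_(l, c) if (c <= l)%N then A l c else 0.
have lC : supp (@lowR N) C by move=> l c n; rewrite mxE; move: n; rewrite /lowR => /negPf ->.
exists (A - C), C; split; [|exact: tangent_lower|by rewrite subrK].
have uB : supp (@upR N) (A - C).
  move=> l c; rewrite /upR -ltnNge => cl.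
  by rewrite !mxE (ltnW cl) subrr.
set u := 1%:M + sect x; have hu : unip J u := unip_sect x.
have uu : supp (@upR N) u.
  move=> l c; rewrite /upR -ltnNge => cl.
  by rewrite mxE sect_upper 1?ltnW // addr0 mxE; case: eqP cl => // ->; rewrite ltnn.
have ut : supp (@upR N) (theta J u (A - C)).
  apply: (supp_mul (@upR_trans N) _ uu).
  move=> l c n; rewrite mxE; case: ifP => // _.
  apply: (supp_mul (@upR_trans N) (supp_mul (@upR_trans N) uu uB) _ n).
  exact: supp_inv (@upR_refl N) (@upR_trans N) uu (unip_unit hu).
have hus (s : R) : unip J (u + s *: theta J u (A - C)).
  by apply: (unip_addr hu); apply: supp_scale; exact: theta_strict.
have [|gamma [g0 gs vg]] := ex_velocity (A := A - C) (c := fun s => u + s *: theta J u (A - C))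
    ospJ hu (sect_flagP x) _ (is_diff_linear_path _ _) hus; first by rewrite scale0r addr0.
exists gamma; split => //.
have c0 : `|(u + s *: theta J u (A - C)) b a| @[s --> (0 : R)] --> `|x 0 ord0|.
  have -> : x 0 ord0 = (u + (0 : R) *: theta J u (A - C)) b a.
    rewrite scale0r addr0 mxE sect_ba [X in X + _]mxE.
    by have [E|_] := eqVneq b a; [move: lt_ba; rewrite E ltnn | rewrite add0r].
  apply: cvg_norm; apply: (cvg_coord (F := nbhs (0 : R))).
  have [h _] := is_diff_linear_path u (theta J u (A - C)).
  exact: differentiable_continuous h.
have n1 : \forall s \near (0 : R), `|(u + s *: theta J u (A - C)) b a| < 1.
  exact: (cvgr_lt (F := nbhs (0 : R)) _ c0 _ x1).
apply: filterS n1 => s s1; exists (coords (u + s *: theta J u (A - C))).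
  by rewrite /sect_dom /= mxE /ascents unlift_none.
apply: (kad_inj (sect_flagP _)); rewrite -coordsK //.
by apply: (supp_add uu); exact: supp_scale.
Qed.

End StandardSlice.

Lemma sgz_eq_neq0 (R : realDomainType) (x y : R) : sgz x = sgz y -> y != 0 -> x != 0.
Proof. by move=> E; rewrite -sgz_eq0 -E sgz_eq0. Qed.

Lemma sign_transport (l s e e1 om sM sM0 o : int) : om * om = 1 ->
  l = - s * e * sM -> e = e1 -> sM = sM0 -> o = om * sM0 -> l = - s * e1 * om * o.
Proof.
move=> om2 -> -> -> ->; transitivity (- s * e1 * sM0 * (om * om)); last by ring.
by rewrite om2 mulr1.
Qed.

Section DiagConsv.
Variables (R : realType) (k : nat).

Lemma row_diag_consv (s : R) (y : 'rV[R]_k) : row ord0 (diag_mx (consv s y)) = consv s 0.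
Proof.
apply: consvP => [|j]; first by rewrite !mxE eqxx unlift_none.
by rewrite mxE mxE (negPf (neq_lift _ _)) mulr0n mxE.
Qed.

Lemma diag_consv_unit (s : R) : s != 0 ->
  diag_mx (consv s (const_mx 1 : 'rV[R]_k)) \in unitmx.
Proof.
move=> s0; rewrite unitmxE unitfE det_diag; apply/prodf_neq0 => j _.
have [j' ->|->] := unliftP ord0 j; last by rewrite consv0.
by rewrite consvS mxE oner_eq0.
Qed.

Lemma consv_opp (s : R) : -1 *: consv s (0 : 'rV[R]_k) = consv (- s) 0.
Proof. by apply: consvP => [|j]; rewrite mxE ?consv0 ?consvS ?mulN1r // mxE oppr0. Qed.

End DiagConsv.

(** * The arcs of the standard slice *)

Section StandardCurves.
Variables (R : realType) (N m : nat) (d : 'I_m -> nat).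
Local Notation X := (flag R N d).
Implicit Types (u A Y : 'M[R]_N) (F G : X).

Variables (I J : {ffun 'I_N -> 'I_m}) (a b : 'I_N).
Hypotheses (ospI : is_osp d I) (ospJ : is_osp d J).
Hypotheses (lt_ba : (b < a)%N) (lt_Iab : (I a < I b)%N)
  (J_def : J = [ffun x => I (tperm a b x)]) (ellIJ : ell I = (ell J).+1).

(** For u over the cell of J, the flags of [twist a b t u] with t nonzero lie in the cell of I and
    converge to that of u as t tends to 0. *)
Lemma cell_closure : (cell J : set X) `<=` closure (cell I).
Proof.
move=> F cF B nB; have [iF lu] := cell_inchart ospJ cF; have [hu uF] := ucoordP iF.
set u := ucoord J F in lu hu uF.
have ht t : unip J (twist a b t u) := unip_twist lt_Iab J_def t hu.
have /choice[G hG] : forall t : R, exists G : X, kad J (twist a b t u) G.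
  by move=> t; apply: ex_kad ospJ _; exact: unip_unit (ht t).
have c0 : G t @[t --> (0 : R)^'] --> F.
  apply: (cvg_flag (Fl := (0 : R)^') ospJ uF (h := fun t => twist a b t u)); last exact: nearW.
  rewrite -[X in _ --> X]addr0; apply: (cvg_mxD (F := (0 : R)^')); first exact: cvg_cst.
  rewrite -[X in _ --> X](scale0r (delta_mx b a *m u)).
  apply: (cvgZ (F := (0 : R)^')); last exact: cvg_cst.
  exact: cvg_within.
have [t [t0 Bt]] : exists t : R, t != 0 /\ B (G t).
  near (0 : R)^' => t; exists t; split; last by near: t; exact: c0 nB.
  by near: t; exact: nbhs_dnbhs_neq.
by exists (G t); split => //; exact: (cellI_of_twist lt_ba lt_Iab J_def t0 hu lu (hG t)).
Unshelve. all: by end_near. Qed.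

Variables (k : nat) (pJ : 'I_k -> 'I_N * 'I_N).
Hypothesis (pJP : enumerates pJ (asc J :\ (b, a))).

Local Notation sect := (sect a b pJ).
Local Notation sect_flag := (sect_flag ospJ lt_ba lt_Iab J_def pJP).
Local Notation sect_lift := (sect_lift a b ospJ pJ).
Local Notation sect_slice := (sect_slice ospJ lt_ba lt_Iab J_def pJP).

Lemma Psi_sect (x : 'rV[R]_k.+1) : Psi J a b pJ (sect_flag x) 0 ord0 = x 0 ord0.
Proof.
rewrite Psi0 ucoord_sect mxE (sect_ba lt_ba lt_Iab J_def pJP) [X in X + _]mxE.
by have [E|_] := eqVneq b a; [move: lt_ba; rewrite E ltnn | rewrite add0r].
Qed.

Lemma sect_upR (x : 'rV[R]_k.+1) : supp (@upR N) (1%:M + sect x).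
Proof.
move=> l c; rewrite /upR -ltnNge => cl.
rewrite mxE (sect_upper lt_ba lt_Iab J_def pJP) 1?ltnW // addr0 mxE.
by case: eqP cl => // ->; rewrite ltnn.
Qed.

Lemma unip_upper_lower u : unip J u -> supp (@upR N) u -> supp (@lowR N) u -> u = 1%:M.
Proof.
move=> hu uu lu; apply/matrixP => l c; rewrite [RHS]mxE.
have [<-|lc] := eqVneq l c; first by rewrite hu ?eqxx.
have [lt|lt] := ltnP l c; first by rewrite lu // /lowR -ltnNge.
by rewrite uu // /upR -ltnNge ltn_neqAle eq_sym lc.
Qed.

Lemma sect0 : sect (0 : 'rV[R]_k.+1) = 0.
Proof. by rewrite -(scale0r (0 : 'rV[R]_k.+1)) sectZ scale0r. Qed.

Lemma sect_cellJ (x : 'rV[R]_k.+1) : cell J (sect_flag x) <-> x = 0.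
Proof.
have ix := inchart_sect ospJ lt_ba lt_Iab J_def pJP x.
rewrite (cell_ucoord ospJ ix) ucoord_sect.
have hu : unip J (1%:M + sect x) := unip_sect lt_ba lt_Iab J_def pJP x.
split=> [low|->]; last by rewrite sect0 addr0; apply: supp_1; exact: lowR_refl.
apply: (sect_inj lt_ba lt_Iab J_def pJP); apply: (addrI 1%:M).
by rewrite sect0 addr0; apply: unip_upper_lower => //; exact: sect_upR.
Qed.

Lemma twist1 (t : R) : twist a b t 1%:M = 1%:M + sect (consv t (0 : 'rV[R]_k)).
Proof. by rewrite sect_consv /twist mulmx1. Qed.

(** Over the cell of I the matrix [untw u] is lower triangular; on the slice it is upper triangular
    as well, hence 1, and u is the twist of 1. *)
Lemma sect_cellI (x : 'rV[R]_k.+1) : cell I (sect_flag x) <-> x 0 ord0 != 0 /\ x = consv (x 0 ord0) 0.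
Proof.
have ix := inchart_sect ospJ lt_ba lt_Iab J_def pJP x.
have hu : unip J (1%:M + sect x) := unip_sect lt_ba lt_Iab J_def pJP x.
have uba : ucoord J (sect_flag x) b a = x 0 ord0 by rewrite -(Psi0 J a b pJ) Psi_sect.
split=> [/(cellIP lt_ba lt_Iab J_def ellIJ ix)|[x0 xE]].
  rewrite uba => -[x0 low]; split => //.
  apply: (sect_inj lt_ba lt_Iab J_def pJP); apply: (addrI 1%:M).
  rewrite -twist1 -(ucoord_sect ospJ lt_ba lt_Iab J_def pJP x) -uba.
  rewrite -[LHS](untwK lt_ba (J := J)) ?ucoord_sect //; congr (twist _ _ _ _).
  rewrite ucoord_sect in low.
  apply: unip_upper_lower => //; first exact: (unip_untw lt_Iab J_def hu).
  move=> l c; rewrite /upR -ltnNge => cl; rewrite untwE.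
  have up : supp (@upR N) (1%:M + sect x) := sect_upR x.
  rewrite (up l) /upR -?ltnNge // sub0r; case: eqP => [E|_]; rewrite ?oppr0 //.
  by rewrite (up a c) ?mulr0 ?oppr0 // /upR -ltnNge (ltn_trans cl) // E.
have kt : kad J (twist a b (x 0 ord0) 1%:M) (sect_flag x).
  by rewrite twist1 -xE; exact: sect_flagP.
have l1 : supp (@lowR N) (1%:M : 'M[R]_N) by apply: supp_1; exact: lowR_refl.
exact: (cellI_of_twist lt_ba lt_Iab J_def x0 (@unip1 R N m J) l1 kt).
Qed.

Definition sect_curve (s t : R) : X := sect_flag (consv (s * t) 0).

Let lift_curve (s t : R) : 'M[R]_N := sect_lift (consv (s * t) 0).

Lemma is_diff_lift_curve (s t : R) :
  is_diff t (lift_curve s) (fun v => v *: (sorting R ospJ *m (s *: delta_mx b a))).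
Proof.
have lE : lift_curve s = (fun t => sorting R ospJ + t *: (sorting R ospJ *m (s *: delta_mx b a))).
  apply/funext => r; rewrite -[LHS]/(sorting R ospJ *m (1%:M + sect _)) sect_consv mulmxDr mulmx1.
  by rewrite -[in RHS]scalemxAr -scalemxAr scalerA [r * s]mulrC.
rewrite lE.
suff -> : (fun v => v *: (sorting R ospJ *m (s *: delta_mx b a))) =
  (fun v : R => 0 + v *: (sorting R ospJ *m (s *: delta_mx b a))).
  have dY := is_diff_Zl (sorting R ospJ *m (s *: delta_mx b a)) (is_diff_id (t : R^o)).
  exact: is_diffD (is_diff_cst (sorting R ospJ) (t : R^o)) dY.
by apply/funext => v; rewrite add0r.
Qed.

Lemma lift_deriv_curve (s t v : R) :
  lift_deriv (lift_curve s) t v = lift_deriv sect_lift (consv (s * t) 0) (consv (v * s) 0).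
Proof.
have [_ E] := is_diff_lift_curve s t.
have [_ E'] := is_diff_sect_lift a b ospJ pJ (consv (s * t) 0).
rewrite /lift_deriv E E' sect_consv; congr (_ *m _).
by rewrite -scalemxAr scalerA scalemxAr.
Qed.

Lemma sect_curve_dom (s t : R) : s = 1 \/ s = -1 -> 0 < t < 1 ->
  sect_dom (consv (s * t) (0 : 'rV[R]_k)).
Proof.
move=> s1 /andP[t0 t1]; rewrite /sect_dom /= consv0 normrM (gtr0_norm t0).
by case: s1 => ->; rewrite ?normrN normr1 mul1r.
Qed.

Lemma sect_curve_cvg (s : R) : consv (s * t) (0 : 'rV[R]_k) @[t --> (0 : R)^'+] --> (0 : 'rV[R]_k.+1).
Proof.
have c : s * t @[t --> (0 : R)^'+] --> 0.
  rewrite -[X in _ --> X](mulr0 s); apply: (cvgMr (F := (0 : R)^'+)).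
  exact: cvg_within.
apply: (cvg_mx (F := (0 : R)^'+)) => i j; rewrite ord1 mxE.
have [j' ->|->] := unliftP ord0 j.
  by under eq_fun do rewrite consvS mxE; exact: cvg_cst.
by under eq_fun do rewrite consv0.
Qed.

Lemma sect_curve_from (s : R) : s = 1 \/ s = -1 ->
  curve_from (sect_flag (0 : 'rV[R]_k.+1)) (sect_curve s).
Proof.
move=> s1; have s0 : s != 0 by case: s1 => ->; rewrite ?oppr_eq0 oner_eq0.
have ch := chart_sect R ospJ lt_ba lt_Iab J_def pJP.
have dom (t : R) : (`]0, 1[%classic : set R) t -> sect_dom (consv (s * t) (0 : 'rV[R]_k)).
  by rewrite /= in_itv /= => tI; exact: sect_curve_dom.
have i0 := inchart_sect ospJ lt_ba lt_Iab J_def pJP (0 : 'rV[R]_k.+1).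
have z0 : sect_dom (0 : 'rV[R]_k.+1) by rewrite /sect_dom /= mxE normr0.
have u0 : ucoord J (sect_flag (0 : 'rV[R]_k.+1)) b a = 0 by rewrite -(Psi0 J a b pJ) Psi_sect mxE.
split.
- exists (lift_curve s); split.
  + exact: interval_open.
  + by move=> t _; apply/adapted_sorting; exact: sect_flagP.
  + exact: (smooth_affine _ (is_diff_lift_curve s)).
  + move=> t v tI; rewrite lift_deriv_curve => st.
    case: ch => -[_ _ _ im] _ _; have /rowP/(_ ord0) := im _ _ (dom t tI) st.
    by rewrite consv0 mxE => /eqP; rewrite mulf_eq0 (negPf s0) orbF => /eqP.
- move=> t t' _ _ /(sect_flag_inj (pJP := pJP))/rowP/(_ ord0).
  by rewrite !consv0 => /(mulfI s0).
- apply: cvg_comp (sect_curve_cvg s) _; exact: (chart_cvg ch ospJ z0).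
move=> cl; have cu := ucoord_continuous ospJ i0.
have n1 : \forall G \near sect_flag (0 : 'rV[R]_k.+1), `|ucoord J G b a| < 2^-1.
  have c : `|ucoord J G b a| @[G --> sect_flag (0 : 'rV[R]_k.+1)] --> (0 : R).
    rewrite -(normr0 R) -[in X in _ --> X]u0.
    apply: (cvg_norm (F := nbhs (sect_flag (0 : 'rV[R]_k.+1)))).
    exact: (cvg_coord (F := nbhs (sect_flag (0 : 'rV[R]_k.+1)))).
  exact: (cvgr_lt (F := nbhs (sect_flag (0 : 'rV[R]_k.+1))) _ c _ _).
have [G [[t tI <-]]] := cl _ n1; rewrite /= -(Psi0 J a b pJ) Psi_sect consv0.
move: tI; rewrite /= in_itv /= => /andP[t2 _].
have t0 : 0 <= t by apply: le_trans t2; rewrite invr_ge0.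
rewrite normrM (ger0_norm t0) ltNge; apply/negP; rewrite negbK.
by case: s1 => ->; rewrite ?normrN normr1 mul1r.
Qed.

Definition side (i : 'I_2) : R := if i == ord0 then 1 else -1.

Lemma side_pm i : side i = 1 \/ side i = -1.
Proof. by rewrite /side; case: eqP; [left|right]. Qed.

Lemma sect_sliceP : slice k I J sect_slice (sect_flag (0 : 'rV[R]_k.+1)) (fun i => sect_curve (side i)).
Proof.
have ch := chart_sect R ospJ lt_ba lt_Iab J_def pJP.
split.
- move=> F [x x1 xE]; exists (@sect_dom R k), sect_flag, sect_lift, x; split => //.
- by move=> K oK _; exact: sect_transverse.
- apply/seteqP; split=> [_ [[x _ <-] /sect_cellJ ->] //|_ ->]; split; last exact/sect_cellJ.
  by exists 0 => //; rewrite /sect_dom /= mxE normr0.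
- by move=> i; exact: sect_curve_from (side_pm i).
split.
  move=> i j _ _ [G [[t]]]; rewrite /= !in_itv /= => /andP[t0 _] <- [t'].
  rewrite /= in_itv /= => /andP[t0' _] /(sect_flag_inj (pJP := pJP))/rowP/(_ ord0).
  rewrite !consv0 /side; case: eqP => [->|/eqP ni]; case: eqP => [->|/eqP nj] //.
  - by move=> E; have : 0 < - 1 * t by [rewrite -E mul1r]; rewrite mulN1r oppr_gt0 ltNge ltW.
  - by move=> E; have : 0 < - 1 * t' by [rewrite E mul1r]; rewrite mulN1r oppr_gt0 ltNge ltW.
  - move=> _; apply/val_inj; move: ni nj; rewrite -!val_eqE /=.
    by case: i j => [[|[|i]] // hi] [[|[|j]] // hj].
apply/seteqP; split=> [_ [[x x1 <-] /sect_cellI[x0 xE]]|_ [i _ [t tI <-]]].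
  have t01 : (`]0, 1[%classic : set R) `|x 0 ord0| by rewrite /= in_itv /= normr_gt0 x0.
  have [xp|xn|E] := ltgtP 0 (x 0 ord0); last by rewrite -E eqxx in x0.
    exists ord0 => //; exists `|x 0 ord0| => //; rewrite /sect_curve [in RHS]xE.
    by rewrite /side eqxx gtr0_norm // mul1r.
  exists ord_max => //; exists `|x 0 ord0| => //; rewrite /sect_curve [in RHS]xE.
  by rewrite /side /= ltr0_norm // mulrNN mul1r.
rewrite /= in_itv /= in tI; split.
  by exists (consv (side i * t) 0) => //; exact: sect_curve_dom (side_pm i) tI.
apply/sect_cellI; rewrite consv0; split => //; case/andP: tI => t0 _.
by rewrite mulf_neq0 ?(gt_eqF t0) //; case: (side_pm i) => ->; rewrite ?oppr_eq0 oner_eq0.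
Qed.

Variables (oI : X -> ('I_k -> 'M[R]_N) -> int) (oJ : X -> ('I_k.+1 -> 'M[R]_N) -> int).
Hypotheses (coorI : coorientation (cell I) oI) (coorJ : coorientation (cell J) oJ).

Lemma sect_curve_cellI (s t : R) : s != 0 -> 0 < t -> cell I (sect_curve s t).
Proof.
move=> s0 t0; apply/sect_cellI; rewrite consv0; split => //.
by rewrite mulf_neq0 // gt_eqF.
Qed.

Lemma sect_curve_velocity (s t : R) : velocity (sect_curve s) t
  (lift_deriv sect_lift (consv (s * t) 0) (consv s 0)).
Proof.
exists (lift_curve s); split.
- by have [] := is_diff_lift_curve s t.
- apply: (nearW (F := nbhs t)) => r; apply/adapted_sorting; exact: sect_flagP.
- by rewrite lift_deriv_curve mul1r.
Qed.

Lemma sect_curve_conormal (s t : R) : s != 0 -> 0 < t ->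
  conormal J (lamJ a b pJ) (sect_curve s t)
    (lift_deriv sect_lift (consv (s * t) 0) (consv s 0)) = consv s 0.
Proof.
move=> s0 t0; have it := inchart_sect ospJ lt_ba lt_Iab J_def pJP (consv (s * t) (0 : 'rV[R]_k)).
have ncI : \forall r \near t, cell I (sect_curve s r).
  by apply: filterS (lt_nbhsr t0) => r; exact: sect_curve_cellI.
have [-> _] := velocity_cellI ospJ lt_ba lt_Iab J_def ellIJ pJP
  (sect_curve_velocity s t) it ncI.
have -> : (fun r => Psi J a b pJ (sect_curve s r) 0 ord0) = s \*: id.
  by apply/funext => r; rewrite Psi_sect consv0.
have -> : 'D_1 (s \*: (id : R -> R)) t = s; last by [].
have := deriveZ s (@derivable_id R R^o t 1); rewrite derive_id => ->.
by rewrite [LHS]mulr1.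
Qed.

Lemma sect_curve_epsilon (s t t' : R) : s != 0 -> 0 < t -> 0 < t' ->
  epsilon J a b pJ oI (sect_curve s t) = epsilon J a b pJ oI (sect_curve s t').
Proof.
move=> s0 t0 t0'.
apply: (epsilon_side ospJ lt_ba lt_Iab J_def ellIJ pJP coorI).
- by split; [exact: sect_curve_cellI | exact: inchart_sect].
- by split; [exact: sect_curve_cellI | exact: inchart_sect].
rewrite -!(Psi0 J a b pJ) !Psi_sect !consv0 mulrACA.
have ss : 0 < s * s by rewrite -expr2 exprn_even_gt0.
exact: mulr_gt0 ss (mulr_gt0 t0 t0').
Qed.

(** The basis is diagonal with entries - s, 1, ..., 1 in the coordinates of the slice: its first
    vector is the velocity of the curve reversed. The witness e is the value dictated by
    [contribution_value]. *)
Lemma sect_contribution (s : R) : s = 1 \/ s = -1 ->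
  exists e, contribution oI oJ sect_slice (sect_flag (0 : 'rV[R]_k.+1)) (sect_curve s) e.
Proof.
move=> s1; have s0 : s != 0 by case: s1 => ->; rewrite ?oppr_eq0 oner_eq0.
have ch := chart_sect R ospJ lt_ba lt_Iab J_def pJP.
have z0 : sect_dom (0 : 'rV[R]_k.+1) by rewrite /sect_dom /= mxE normr0.
have cb0 : cell J (sect_flag (0 : 'rV[R]_k.+1)) by apply/sect_cellJ.
have tr : transverse (sect_slice : set X) (cell J).
  exact: (@sect_transverse R N m d I J a b ospJ lt_ba lt_Iab J_def k pJ pJP J ospJ).
have nj := near_jac ospJ lt_ba lt_Iab J_def ellIJ pJP ch z0 cb0 tr.
have uj := jac_unit ospJ lt_ba lt_Iab J_def ellIJ pJP ch z0 cb0 tr.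
have cfJ := conormalJ_form R ospJ lt_ba lt_Iab J_def ellIJ pJP.
pose jac0 (y : 'rV[R]_k.+1) := jac J a b pJ sect_flag sect_lift y.
have dj0 : \det (jac0 0) != 0 by rewrite -unitfE -unitmxE.
have [om1 omE] := cosignP cfJ coorJ cb0.
pose om := omega J a b pJ oJ (sect_flag (0 : 'rV[R]_k.+1)).
pose e1 := epsilon J a b pJ oI (sect_curve s 1).
exists (- sgz s * e1 * om), (@sect_dom R k), sect_flag, sect_lift, 0; split.
- exact: ch.
- exact: z0.
- by [].
have nt : \forall t \near (0 : R)^'+, [/\ sect_dom (consv (s * t) (0 : 'rV[R]_k)),
    inchart J (sect_flag (consv (s * t) 0)) &
    sgz (\det (jac0 (consv (s * t) 0))) = sgz (\det (jac0 0))].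
  exact: (@sect_curve_cvg s _ nj).
have om2 : om * om = 1.
  by rewrite /om /omega; case: om1 => ->; rewrite ?mulrNN mul1r.
apply: filterS (filterI nt (nbhs_right_gt (0 : R))) => t [[xd it sj] /= t0].
have uB : diag_mx (consv (- s) (const_mx 1 : 'rV[R]_k)) \in unitmx.
  by apply: diag_consv_unit; rewrite oppr_eq0.
have rB : row ord0 (diag_mx (consv (- s) (const_mx 1 : 'rV[R]_k))) = consv (- s) 0.
  exact: row_diag_consv.
have rE : lift_deriv sect_lift (consv (s * t) 0)
      (row ord0 (diag_mx (consv (- s) (const_mx 1 : 'rV[R]_k)))) =
    - lift_deriv sect_lift (consv (s * t) 0) (consv s 0).
  by rewrite rB !(lift_deriv_sect ospJ lt_ba lt_Iab J_def pJP) !sect_consv scaleNr mulmxN.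
exists (consv (s * t) 0), (diag_mx (consv (- s) (const_mx 1))); split.
- exact: xd.
- by [].
- exact: uB.
- by rewrite rE opprK; exact: sect_curve_velocity.
have cx : cellIJ I J (sect_flag (consv (s * t) (0 : 'rV[R]_k))).
  by split; [exact: (@sect_curve_cellI s t s0 t0) | exact: it].
have dx : \det (jac0 (consv (s * t) 0)) != 0.
  exact: (sgz_eq_neq0 sj dj0).
have rj : row ord0 (diag_mx (consv (- s) (const_mx 1 : 'rV[R]_k))) *m
    jac0 (consv (s * t) 0) = consv (- s) 0.
  have cl := conormal_lift ospJ lt_ba lt_Iab J_def ellIJ pJP sect_flag sect_lift
    (consv (s * t) 0) (row ord0 (diag_mx (consv (- s) (const_mx 1 : 'rV[R]_k)))).
  apply: (etrans (esym cl)).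
  rewrite rE -scaleN1r (conormalZ cfJ) (sect_curve_conormal s0 t0).
  exact: consv_opp.
have cc := signed_basis_coords ospJ lt_ba lt_Iab J_def ellIJ pJP coorI cx dx uB rj.
have eE : epsilon J a b pJ oI (sect_flag (consv (s * t) 0)) = e1.
  exact: (sect_curve_epsilon s0 t0 ltr01).
have oE : oJ (sect_flag (0 : 'rV[R]_k.+1)) (fun i => lift_deriv sect_lift 0 (row i 1%:M)) =
  om * sgz (\det (jac0 0)) by exact: omE.
exact: (sign_transport om2 cc eE sj oE).
Qed.

End StandardCurves.

(** * The incidence coefficient *)

Section Incidence.
Variables (R : realType) (N m : nat) (d : 'I_m -> nat).
Local Notation X := (flag R N d).

Variables (I J : {ffun 'I_N -> 'I_m}) (a b : 'I_N).
Hypotheses (ospI : is_osp d I) (ospJ : is_osp d J).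
Hypotheses (lt_ba : (b < a)%N) (lt_Iab : (I a < I b)%N)
  (J_def : J = [ffun x => I (tperm a b x)]) (ellIJ : ell I = (ell J).+1).
Variables (k : nat) (codimI : codim_cell d I = k).

Lemma card_asc_codim : #|asc I| = k.
Proof. by have := card_asc ospI; rewrite -codimI /codim_cell; lia. Qed.

Lemma card_asc_rem : #|asc J :\ (b, a)| = k.
Proof.
have Jba : (b, a) \in asc J by rewrite inE lt_ba (exch_a J_def) (exch_b J_def) lt_Iab.
have EJ := card_asc ospJ; rewrite (cardsD1 (b, a)) Jba add1n in EJ.
have EI := card_asc ospI; rewrite card_asc_codim ellIJ -EJ in EI.
by apply/eqP; rewrite -(eqn_add2r (ell J).+1) EI addSnnS.
Qed.

Variables (oI : X -> ('I_k -> 'M[R]_N) -> int) (oJ : X -> ('I_k.+1 -> 'M[R]_N) -> int).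
Hypotheses (coorI : coorientation (cell I) oI) (coorJ : coorientation (cell J) oJ).

(** Here e is the sign of [oI] on the positive side in the chart of J, and w that of [oJ];
    [epsilon_flip] expresses the sign on the negative side through e. *)
Lemma incidence_value : exists e w : int, [/\ e = 1 \/ e = -1, w = 1 \/ w = -1 &
  incidence I J oI oJ ((e * (-1) ^+ NI I a b - e) * w)].
Proof.
have [pI pIP] := ex_enumerates card_asc_codim.
have [pJ pJP] := ex_enumerates card_asc_rem.
pose F0 : X := sect_flag ospJ lt_ba lt_Iab J_def pJP 0.
pose G (s : R) : X := sect_curve ospJ lt_ba lt_Iab J_def pJP s 1.
have cF0 : cell J F0 by apply/(sect_cellJ ospJ lt_ba lt_Iab J_def pJP).
have cG s : s != 0 -> cellIJ I J (G s).
  move=> s0; split; last exact: inchart_sect.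
  exact: (sect_curve_cellI ospJ lt_ba lt_Iab J_def ellIJ pJP s0 ltr01).
have PG s : Psi J a b pJ (G s) 0 ord0 = s by rewrite Psi_sect consv0 mulr1.
have c1 := cG 1 (oner_neq0 R).
have cm : cellIJ I J (G (-1)) by apply: cG; rewrite oppr_eq0 oner_eq0.
exists (epsilon J a b pJ oI (G 1)), (omega J a b pJ oJ F0); split.
- have cff := conormalf_form R ospJ lt_ba lt_Iab J_def ellIJ pJP.
  by have [] := cosignP cff (coor_cellIJ ospJ coorI) c1.
- have cfJ := conormalJ_form R ospJ lt_ba lt_Iab J_def ellIJ pJP.
  by have [] := cosignP cfJ coorJ cF0.
have clo : (cell J : set X) `<=` closure (cell I) := cell_closure ospJ lt_ba lt_Iab J_def.
have <- : epsilon J a b pJ oI (G (-1)) = epsilon J a b pJ oI (G 1) * (-1) ^+ NI I a b.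
  apply: (epsilon_flip ospI ospJ lt_ba lt_Iab J_def ellIJ pIP pJP coorI c1 cm).
  by rewrite -!(Psi0 J a b pJ) !PG mulrN1 oppr_lt0 ltr01.
have sum D b0 r gamma (e : 'I_r -> int) : slice k I J D b0 gamma ->
    (forall i, contribution oI oJ D b0 (gamma i) (e i)) ->
    \sum_i e i = (epsilon J a b pJ oI (G (-1)) - epsilon J a b pJ oI (G 1)) *
      omega J a b pJ oJ F0.
  move=> sl he.
  apply: (slice_sum ospJ lt_ba lt_Iab J_def ellIJ pJP coorI coorJ clo sl he cF0 c1 cm).
    by rewrite PG.
  by rewrite PG oppr_lt0.
split=> [//|_ n']; split=> [[D [b0 [r [gamma [e [sl he ->]]]]]]|->]; first exact: sum sl he.
(* For the converse the standard slice realizes the value. Its contributions are only shown to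
   exist; their sum is given by the computation for an arbitrary slice. *)
have sl := sect_sliceP R ospJ lt_ba lt_Iab J_def ellIJ pJP.
have /choice[e he] : forall i : 'I_2, exists e, contribution oI oJ
    (sect_slice ospJ lt_ba lt_Iab J_def pJP) F0
    (sect_curve ospJ lt_ba lt_Iab J_def pJP (side R i)) e.
  by move=> i; apply: (sect_contribution ospJ lt_ba lt_Iab J_def ellIJ pJP coorI coorJ);
    exact: side_pm.
exists (sect_slice ospJ lt_ba lt_Iab J_def pJP), F0, 2%N.
exists (fun i => sect_curve ospJ lt_ba lt_Iab J_def pJP (side R i)), e.
by split => //; rewrite (sum _ _ _ _ _ sl he).
Qed.

End Incidence.

Theorem theorem3p9 (R : realType) (m N : nat) (d : 'I_m -> nat)
  (d_gt0 : forall i, (0 < d i)%N) (sum_d : (\sum_(i < m) d i)%N = N)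
  (I J : {ffun 'I_N -> 'I_m}) (ospI : is_osp d I) (ospJ : is_osp d J)
  (ellIJ : ell I = (ell J).+1)
  (a b : 'I_N) (lt_ba : (b < a)%N) (lt_Iab : (I a < I b)%N)
  (J_def : J = [ffun x => I (tperm a b x)])
  (k : nat) (codimI : codim_cell d I = k)
  (oI : flag R N d -> ('I_k -> 'M[R]_N) -> int)
  (oJ : flag R N d -> ('I_k.+1 -> 'M[R]_N) -> int)
  (coorI : coorientation (cell I) oI) (coorJ : coorientation (cell J) oJ) :
  (~~ odd (NI I a b) -> incidence I J oI oJ 0) /\
  (odd (NI I a b) -> incidence I J oI oJ 2 \/ incidence I J oI oJ (- 2)).
Proof.
have [e [w [e1 w1 h]]] := incidence_value ospI ospJ lt_ba lt_Iab J_def ellIJ codimI coorI coorJ.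
move: h; rewrite -signr_odd; case: (odd _) => h; split=> // _.
  (* The value is -2 e w, hence -2 when the two signs agree and 2 when they differ. *)
  rewrite expr1 in h; case: e1 w1 h => -> [] ->; [right|left|left|right]; exact: h.
by rewrite expr0 mulr1 subrr mul0r in h.
Qed.
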